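(* For $j\in\{\frac12,-\frac12\}$ let $V^{[2,j]}$ be the irreducible highest weight (Neveu-Schwarz) module over the N=4 superconformal algebra with parameters $c=c^{[2]}$, $h=h^{[2,j]}$, $s=s^{[2,j]}$, where for $M\ge1$: $c^{[M]}=\frac{6(1-M)}M$, $h^{[M,j]}=\frac{j^2}M+\frac1{4M}-\frac12$, $s^{[M,j]}=\frac{2j}M-1$. Then: 1) $c^{[2]}=-3$; $h^{[2,\frac12]}=-\frac14$, $s^{[2,\frac12]}=-\frac12$; $h^{[2,-\frac12]}=-\frac14$, $s^{[2,-\frac12]}=-\frac32$. 2) The characters and super-characters are $$\mathrm{ch}^{(+)}_{V^{[2,\pm\frac12]}}(\tau,z)=i\Big[\frac{\eta(2\tau)}{\eta(\tau)}\Big]^3\frac{\vartheta_{00}(2\tau,z\pm\frac\tau2)\,\vartheta_{00}(\tau,z)}{\vartheta_{10}(2\tau,z\pm\frac\tau2)\,\vartheta_{11}(2\tau,2z)},$$ $$\mathrm{ch}^{(-)}_{V^{[2,\pm\frac12]}}(\tau,z)=\pm\Big[\frac{\eta(2\tau)}{\eta(\tau)}\Big]^3\frac{\vartheta_{01}(2\tau,z\pm\frac\tau2)\,\vartheta_{01}(\tau,z)}{\vartheta_{11}(2\tau,z\pm\frac\tau2)\,\vartheta_{11}(2\tau,2z)}.$$ 3) The leading terms (the terms of least degree in $q$) are: for both the character $\mathrm{ch}^{(+)}$ and the super-character $\mathrm{ch}^{(-)}$ of $V^{[2,\frac12]}$, $$q^{\frac18-\frac14}\frac{e^{-\pi iz}}{1-e^{-4\pi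 iz}}=q^{-\frac1{24}c^{[2]}+h^{[2,\frac12]}}\frac{e^{2\pi is^{[2,\frac12]}z}}{1-e^{-4\pi iz}},$$ and for both the character and the super-character of $V^{[2,-\frac12]}$, $$q^{\frac18-\frac14}\frac{e^{-3\pi iz}}{1-e^{-4\pi iz}}=q^{-\frac1{24}c^{[2]}+h^{[2,-\frac12]}}\frac{e^{2\pi is^{[2,-\frac12]}z}}{1-e^{-4\pi iz}}.$$
   Context: Notation: $\tau$ is in the upper half plane, $q=e^{2\pi i\tau}$, $z\in\mathbf C$, $\eta(\tau)=q^{1/24}\prod_{n\ge1}(1-q^n)$. Mumford's theta functions are $\vartheta_{ab}(\tau,z)=\sum_{n\in\mathbf Z}e^{\pi i(n+\frac a2)^2\tau+2\pi i(n+\frac a2)(z+\frac b2)}$ for $a,b\in\{0,1\}$. N=4 superconformal algebra: the (small) N=4 superconformal algebra of central charge $c$ is generated by a Virasoro field $L$, primary even fields $J^0=J,J^{\pm}$ of conformal weight $1$, and primary odd fields $G^\pm,\bar G^\pm$ of conformal weight $\frac32$, with nonzero $\lambda$-brackets (with $\partial$ the derivation; besides those with $L$): $[J^0{}_\lambda J^\pm]=\pm2J^\pm$, $[J^0{}_\lambda J^0]=\frac c3\lambda$, $[J^+{}_\lambda J^-]=J^0+\frac c6\lambda$, $[J^0{}_\lambda G^\pm]=\pm G^\pm$, $[J^0{}_\lambda\bar G^\pm]=\pm\bar G^\pm$, $[J^+{}_\lambda G^-]=G^+$, $[J^-{}_\lambda G^+]=G^-$, $[J^+{}_\lambda\bar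 G^-]=-\bar G^+$, $[J^-{}_\lambda\bar G^+]=-\bar G^-$, $[G^\pm{}_\lambda\bar G^\pm]=(\partial+2\lambda)J^\pm$, $[G^\pm{}_\lambda\bar G^\mp]=L\pm\frac12\partial J^0\pm\lambda J^0+\frac c6\lambda^2$. It is the algebra obtained by quantum Hamiltonian reduction of $\widehat A(1,1)$ with respect to the lowest root vector $e_{-\theta}$. Modules: the modes of $L,J^0,J^\pm$ are indexed by $\mathbf Z$ and those of $G^\pm,\bar G^\pm$ by $\frac12+\mathbf Z$ (with $L(w)=\sum L_nw^{-n-2}$, $J(w)=\sum J_nw^{-n-1}$, $G(w)=\sum G_nw^{-n-3/2}$). A highest weight module is generated by a vector $v_0$ (taken to be even) annihilated by all modes of positive index and by $J_0^+$, with $L_0v_0=hv_0$, $J_0v_0=sv_0$; an irreducible highest weight module is determined by $(c,h,s)$. Characters: $\mathrm{ch}^{(+)}_V(\tau,z)=\mathrm{tr}_V\,q^{L_0-c/24}e^{2\pi izJ_0}$ and $\mathrm{ch}^{(-)}_V(\tau,z)=\mathrm{str}_V\,q^{L_0-c/24}e^{2\pi izJ_0}$, the right-hand sides being expanded in the domain $1<|e^{2\pi iz}|<|q|^{-1/2}$. *)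

(* Defs.v *)
From HB Require Import structures.
From mathcomp Require Import all_boot all_order all_algebra.
From mathcomp Require Import finmap complex.
From mathcomp Require Import all_classical all_reals all_analysis.
From mathcomp Require Import analysis.showcase.summability.

Set Implicit Arguments.
Unset Strict Implicit.
Unset Printing Implicit Defensive.

Import Order.TTheory GRing.Theory Num.Theory.
Import numFieldNormedType.Exports.

Local Open Scope classical_set_scope.
Local Open Scope ring_scope.
Local Open Scope complex_scope.

Section Functions.
Variable R : realType.
Local Notation C := R[i].

Definition cexp (z : C) : C :=
  (expR (complex.Re z))%:C * (cos (complex.Im z) +i* sin (complex.Im z)).

Definition piC : C := (pi : R)%:C.

(* [e2pi x] is e^{2 pi i x}; in particular q^x is [e2pi (tau * x)]. *)
Definition e2pi (x : C) : C := cexp (2 * piC * 'i%C * x).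

(* Unconditional convergence of a family to [S]: the finite partial sums
   converge to [S] along the directed set of finite subsets of [I]. *)
Definition has_sum (I : choiceType) (f : I -> C) (S : C) : Prop :=
  partial_sum (f : I -> C^o) @ totally --> (S : C^o).

Definition theta (a b : nat) (tau z : C) : C :=
  let r (n : int) : C := n%:~R + a%:R / 2 in
  sum (fun n : int =>
    cexp (piC * 'i%C * r n ^+ 2 * tau + 2 * piC * 'i%C * r n * (z + b%:R / 2)) : C^o).

Definition dedekind_eta (tau : C) : C :=
  e2pi (tau / 24) *
  lim ((fun N => \prod_(1 <= n < N.+1) (1 - e2pi tau ^+ n) : C^o) @ \oo).

(* tau in the upper half plane and 1 < |e^{2 pi i z}| < |q|^{-1/2} *)
Definition ch_domain (tau z : C) : Prop :=
  [/\ 0 < complex.Im tau, 1 < Normc.normc (e2pi z)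
    & Normc.normc (e2pi z) < Normc.normc (e2pi tau) `^ (- 2^-1)].

End Functions.

(* The boolean argument is the sign in the superscript: [true] is +. *)
Inductive gen : Type :=
  | gL | gJ0 | gJ of bool | gG of bool | gGbar of bool.

Definition conf_weight (a : gen) : rat :=
  match a with gL => 2 | gJ0 | gJ _ => 1 | gG _ | gGbar _ => 3%:Q / 2 end.

(* [true] is odd *)
Definition parity (a : gen) : bool :=
  match a with gL | gJ0 | gJ _ => false | gG _ | gGbar _ => true end.

Section SuperconformalAlgebra.
Variable R : realType.
Local Notation C := R[i].

(* [LTerm k j l a] is the summand [k lambda^j d^l a] of a lambda-bracket,
   where d is the derivation and [a = None] stands for the vacuum vector. *)
Record lterm := LTerm {
  lcoef : C; lpow : nat; dpow : nat; lfield : option gen }.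

Definition sgnC (s : bool) : C := if s then 1 else -1.

(* The table [a_lambda b].  [None] means that the pair is not in the table:
   its bracket is obtained by skew-symmetry from that of (b, a), and is zero
   if (b, a) is not in the table either. *)
Definition lbracket (c : C) (a b : gen) : option (seq lterm) :=
  match a, b with
  | gL, gL => Some [:: LTerm 1 0 1 (Some gL); LTerm 2 1 0 (Some gL);
                       LTerm (c / 12) 3 0 None]
  | gL, _ => Some [:: LTerm 1 0 1 (Some b);
                      LTerm (ratr (conf_weight b)) 1 0 (Some b)]
  | gJ0, gJ0 => Some [:: LTerm (c / 3) 1 0 None]
  | gJ0, gJ s => Some [:: LTerm (sgnC s * 2) 0 0 (Some (gJ s))]
  | gJ0, gG s => Some [:: LTerm (sgnC s) 0 0 (Some (gG s))]
  | gJ0, gGbar s => Some [:: LTerm (sgnC s) 0 0 (Some (gGbar s))]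
  | gJ true, gJ false => Some [:: LTerm 1 0 0 (Some gJ0);
                                  LTerm (c / 6) 1 0 None]
  | gJ true, gG false => Some [:: LTerm 1 0 0 (Some (gG true))]
  | gJ false, gG true => Some [:: LTerm 1 0 0 (Some (gG false))]
  | gJ true, gGbar false => Some [:: LTerm (-1) 0 0 (Some (gGbar true))]
  | gJ false, gGbar true => Some [:: LTerm (-1) 0 0 (Some (gGbar false))]
  | gG s, gGbar t =>
      if s == t then Some [:: LTerm 1 0 1 (Some (gJ s));
                              LTerm 2 1 0 (Some (gJ s))]
      else Some [:: LTerm 1 0 0 (Some gL); LTerm (sgnC s / 2) 0 1 (Some gJ0);
                    LTerm (sgnC s) 1 0 (Some gJ0); LTerm (c / 6) 2 0 None]
  | _, _ => None
  end.

Definition int_ffact (n : int) (j : nat) : C := \prod_(i < j) (n - i%:Z)%:~R.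

(* Fourier modes are indexed as a(w) = \sum_m a_(m) w^(-m-1); in the indexing
   a(w) = \sum_r a_r w^(-r-Delta) one has a_(m) = a_r with r = m - Delta + 1,
   so that r runs over Z for even fields and over 1/2 + Z for odd ones. *)
Definition mode_index (a : gen) (m : int) : rat := m%:~R - conf_weight a + 1.

Section Modes.
Variables (V : lmodType C) (act : gen -> int -> V -> V).

Definition field_mode (o : option gen) (n : int) (v : V) : V :=
  if o is Some a then act a n v else if n == -1 then v else 0.

(* (d^l a)_(n) = (-1)^l n (n-1) ... (n-l+1) a_(n-l) *)
Definition der_mode (l : nat) (o : option gen) (n : int) (v : V) : V :=
  ((-1) ^+ l * int_ffact n l) *: field_mode o (n - l%:Z) v.

(* If [a_lambda b] = \sum_j lambda^j p_j, then the commutator formula reads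
   [a_(m), b_(n)] = \sum_j m (m-1) ... (m-j+1) (p_j)_(m+n-j). *)
Definition bracket_mode (ts : seq lterm) (m n : int) (v : V) : V :=
  \sum_(t <- ts) (lcoef t * int_ffact m (lpow t)) *:
    der_mode (dpow t) (lfield t) (m + n - (lpow t)%:Z) v.

Definition supercomm (a : gen) (m : int) (b : gen) (n : int) (v : V) : V :=
  act a m (act b n v) - (-1) ^+ (parity a && parity b) *: act b n (act a m v).

End Modes.

Definition is_subspace (V : lmodType C) (W : set V) : Prop :=
  W 0 /\ forall (k : C) u v, W u -> W v -> W (k *: u + v).

(* A Neveu-Schwarz module of central charge c *)
Record n4_module (c : C) := N4Module {
  n4_space :> lmodType C;
  n4_deg : bool -> set n4_space;
  n4_act : gen -> int -> n4_space -> n4_space;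
  n4_deg_subspace : forall p, is_subspace (n4_deg p);
  n4_deg_sum : forall v, exists v0 v1,
    [/\ n4_deg false v0, n4_deg true v1 & v = v0 + v1];
  n4_deg_direct : forall v, n4_deg false v -> n4_deg true v -> v = 0;
  n4_act_linear : forall a m (k : C) u v,
    n4_act a m (k *: u + v) = k *: n4_act a m u + n4_act a m v;
  n4_act_parity : forall a m p v,
    n4_deg p v -> n4_deg (p (+) parity a) (n4_act a m v);
  n4_act_bracket : forall a b m n v,
    match lbracket c a b, lbracket c b a with
    | Some ts, _ => supercomm n4_act a m b n v = bracket_mode n4_act ts m n v
    | None, None => supercomm n4_act a m b n v = 0
    | None, Some _ => True
    end }.

Section ModuleTheory.
Variables (c : C) (V : n4_module c).

Definition op_L0 : V -> V := n4_act gL 1.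
Definition op_J0 : V -> V := n4_act gJ0 0.

Definition is_submodule (W : set V) : Prop :=
  [/\ is_subspace W,
      (forall v, W v -> exists v0 v1,
         [/\ n4_deg false v0, n4_deg true v1, v = v0 + v1, W v0 & W v1])
    & forall a m v, W v -> W (n4_act a m v)].

Definition highest_weight_vector (h s : C) (v0 : V) : Prop :=
  [/\ v0 <> 0, n4_deg false v0,
      (forall a m, 0 < mode_index a m -> n4_act a m v0 = 0)
      /\ (forall m, mode_index (gJ true) m = 0 -> n4_act (gJ true) m v0 = 0),
      op_L0 v0 = h *: v0
    & op_J0 v0 = s *: v0].

Definition generated_by (v0 : V) : Prop :=
  forall W, is_submodule W -> W v0 -> W = setT.

Definition irreducible_module : Prop :=
  (exists v : V, v <> 0) /\
  forall W, is_submodule W -> W = [set 0] \/ W = setT.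

Definition irreducible_highest_weight (h s : C) : Prop :=
  irreducible_module /\
  exists v0, highest_weight_vector h s v0 /\ generated_by v0.

Definition weight_space (p : bool) (Delta mu : C) : set V :=
  [set v | [/\ n4_deg p v, op_L0 v = Delta *: v & op_J0 v = mu *: v]].

Definition weight_decomposable : Prop :=
  forall v : V, exists (n : nat) (u : 'I_n -> V),
    v = \sum_i u i /\ forall i, exists p Delta mu, weight_space p Delta mu (u i).

Definition has_dim (W : set V) (n : nat) : Prop :=
  exists e : 'I_n -> V,
    (forall x : 'I_n -> C, \sum_i x i *: e i = 0 -> forall i, x i = 0) /\
    W = [set v | exists x : 'I_n -> C, v = \sum_i x i *: e i].

(* tr (str if [super]) of q^(L_0 - c/24) e^(2 pi i z J_0) is the formal sum
   \sum m(Delta,mu) q^(Delta - c/24) e^(2 pi i z mu) over the joint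
   eigenvalues (Delta,mu) of (L_0, J_0), all joint eigenspaces being
   finite-dimensional; [m] is the family of its coefficients. *)
Definition trace_coefs (super : bool) (m : C * C -> int) : Prop :=
  weight_decomposable /\
  exists d : bool -> C * C -> nat,
    (forall p w, has_dim (weight_space p w.1 w.2) (d p w)) /\
    (forall w, m w = (d false w)%:Z + (-1) ^+ super * (d true w)%:Z).

Definition trace_term (m : C * C -> int) (tau z : C) (w : C * C) : C :=
  (m w)%:~R * e2pi (tau * (w.1 - c / 24)) * e2pi (z * w.2).

(* ch^(+) for [super = false] and ch^(-) for [super = true] *)
Definition has_character (super : bool) (tau z S : C) : Prop :=
  exists m, trace_coefs super m /\ has_sum (trace_term m tau z) S.

(* The terms of least degree in q of ch^(+-) add up to [S].  The order [<=]
   on complex numbers is x <= y iff y - x is a nonnegative real. *)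
Definition has_leading_term (super : bool) (tau z S : C) : Prop :=
  exists m (Delta0 : C),
    [/\ trace_coefs super m,
        (exists mu, m (Delta0, mu) <> 0),
        (forall Delta mu, m (Delta, mu) <> 0 -> Delta0 <= Delta)
      & has_sum (fun mu => trace_term m tau z (Delta0, mu)) S].

End ModuleTheory.

Definition cM (M : nat) : C := 6 * (1 - M%:R) / M%:R.
Definition hM (M : nat) (j : C) : C := j ^+ 2 / M%:R + 1 / (4 * M%:R) - 1 / 2.
Definition sM (M : nat) (j : C) : C := 2 * j / M%:R - 1.

End SuperconformalAlgebra.

Arguments cM R M : clear implicits.

(* Main.v *)
(* The algebra at c = -3 acts on the Fock space F of a pair of bosons b^+, b^-
   with integer modes and a pair of symplectic fermions a, x with half-integer
   modes: all currents are bilinear in them.  The only vectors killed by the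
   positive modes and by J^+_0 are the combinations of the vacuum and of
   b^-_0 vac, which have the two highest weights of the theorem.  With a
   contravariant form on F this shows that F is the sum of two sectors (the
   parity of charge plus fermion number), generated by these two vectors.  If
   V is irreducible of highest weight, the submodule of V (+) F generated by
   the pair of highest weight vectors matches the weight spaces of V with those
   of the sector, so that the characters are sums over occupation numbers.

   Such a sum is half the sum or the difference of two infinite products, which
   by the Jacobi triple product are products of the functions
   T(p, y) = sum_n p^(n^2) y^n.  The identities for
   T(p, a) T(p, b) +- T(p, -a) T(p, -b), obtained by splitting Z^2 according to
   the parity of m + n, then give the quotients of theta functions.  The terms
   of least degree come from the powers of b^-_0 and form a geometric series. *)

(* The central charge splits as $-3=-1-2$: the bosons, of weight $1/2$, contribute $-1$ and the
   fermions $-2$. Both pairs are twisted, so that the products of a boson with $a$ or $\partial x$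
   have modes in $\frac12+\mathbf Z$; each twist lowers the vacuum energy by $1/8$, whence $h=-1/4$.
   Normal ordering is avoided: only $J^\pm$, $G^\pm$, $\bar G^\pm$ are written as sums of products,
   of commuting modes, while $J^0$ and $L$ are defined as brackets of these. Schur's lemma gives
   each bracket of currents up to a central term, and the Jacobi identity reduces the central terms
   to that of $[J^+_1,J^-_{-1}]$ on the vacuum. The classification of singular vectors shows that
   every nonzero submodule of a sector contains its generator. That this vector generates the sector
   is the dual statement, and this is the role of the form: the orthogonal complement of a proper
   submodule would be a nonzero submodule, hence contain the generator, whose norm is not 0. The
   submodule of $V\oplus F$ is then the graph of an isomorphism, which replaces Verma modules and
   their maximal submodules. *)
Require Import Defs.
From HB Require Import structures.
From mathcomp Require Import all_boot all_order all_algebra.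
From mathcomp Require Import finmap multiset monalg.
From mathcomp Require Import complex.
From mathcomp Require Import all_classical all_reals all_analysis.
From mathcomp Require Import analysis.showcase.summability.
From mathcomp Require Import ring lra zify.

Set Implicit Arguments.
Unset Strict Implicit.
Unset Printing Implicit Defensive.

Import Order.TTheory GRing.Theory Num.Theory.
Import numFieldNormedType.Exports.

Local Open Scope ring_scope.

(* The slot (s, n) of the multiset is the bosonic creation mode b^-_{-n}
   (s = false) or b^+_{-n-1} (s = true); the slot (s, n) of the set is the
   fermionic creation mode x_{-n-1} (s = false) or a_{-n-1} (s = true). *)
Definition slot : Type := (bool * nat)%type.
HB.instance Definition _ := Countable.on slot.

HB.lock Definition madd (i : slot) (M : multiset slot) : multiset slot :=
  (i +` M)%mset.
HB.lock Definition mrem (i : slot) (M : multiset slot) : multiset slot :=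
  (M `\ i)%mset.
HB.lock Definition flip (i : slot) (A : {fset slot}) : {fset slot} :=
  if i \in A then (A `\ i)%fset else (i |` A)%fset.

Lemma maddE i M j : madd i M j = ((j == i) + M j)%N.
Proof. by rewrite madd.unlock mset1DE. Qed.

Lemma mremE i M j : mrem i M j = (M j - (j == i))%N.
Proof. by rewrite mrem.unlock msetB1E. Qed.

Definition occ : Type := (multiset slot * {fset slot})%type.
HB.instance Definition _ := Choice.on occ.

(* The space with basis occ, packed so that its operations do not unfold. *)
Record free_module (K : numFieldType) (B : choiceType) := FreeModule {
  free_sort : lmodType K;
  free_ket : B -> free_sort;
  free_coeff : B -> free_sort -> K;
  free_supp : free_sort -> {fset B};
  free_coeffP : forall b c u v,
    free_coeff b (c *: u + v) = c * free_coeff b u + free_coeff b v;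
  free_coeff_ket : forall b b', free_coeff b' (free_ket b) = (b == b')%:R;
  free_suppP : forall b v, (b \in free_supp v) = (free_coeff b v != 0);
  free_ext : forall u v, (forall b, free_coeff b u = free_coeff b v) -> u = v }.

Definition malg_free (K : numFieldType) (B : choiceType) : free_module K B.
Proof.
apply: (@FreeModule K B {malg K[B]} (fun b => mkmalgU b 1) (fun b v => mcoeff b v)
  (@msupp B K)) => [b c u v|b b'|b v|u v h].
- by rewrite mcoeffD mcoeffZ.
- by rewrite mcoeffU.
- by rewrite mcoeff_neq0.
- by apply/malgP => b; apply: h.
Qed.

(** * Fock space *)

Section FockSpace.
Variable K : numFieldType.

Definition fock : lmodType K := free_sort (malg_free K occ).
Definition ket (b : occ) : fock := free_ket _ b.
Definition coeff (b : occ) (v : fock) : K := free_coeff b v.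
Definition fsup (v : fock) : {fset occ} := free_supp v.

Lemma coeff_ket b b' : coeff b' (ket b) = (b == b')%:R.
Proof. exact: free_coeff_ket. Qed.

Lemma fsupP b v : (b \in fsup v) = (coeff b v != 0).
Proof. exact: free_suppP. Qed.

Lemma fockP u v : (forall b, coeff b u = coeff b v) -> u = v.
Proof. exact: free_ext. Qed.

Lemma coeff_is_linear b : linear (coeff b : fock -> K^o).
Proof. by move=> k u v; apply: free_coeffP. Qed.

HB.instance Definition _ b :=
  GRing.isLinear.Build K fock K^o *:%R (coeff b) (coeff_is_linear b).

Lemma coeffD b u v : coeff b (u + v) = coeff b u + coeff b v.
Proof. exact: linearD. Qed.

Lemma coeffZ b k v : coeff b (k *: v) = k * coeff b v.
Proof. exact: linearZ. Qed.

Lemma fockE (v : fock) : v = \sum_(b <- fsup v) coeff b v *: ket b.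
Proof.
apply: fockP => b'; rewrite raddf_sum /=.
rewrite (eq_bigr (fun b => if b == b' then coeff b v else 0)) => [|b _]; last first.
  by rewrite coeffZ coeff_ket; case: eqP => _; rewrite ?mulr1 ?mulr0.
rewrite -big_mkcond /= big_fset_condE /=; case: (boolP (b' \in fsup v)) => h.
  rewrite (_ : [fset _ | _ in _ & _]%fset = [fset b']%fset) ?big_seq_fset1 //.
  by apply/fsetP => b; rewrite !inE /= andbC; case: eqP => // ->.
rewrite (_ : [fset _ | _ in _ & _]%fset = fset0) ?big_seq_fset0.
  by apply/eqP; move: h; rewrite fsupP negbK.
by apply/fsetP => b; rewrite !inE /= andbC; case: eqP => // ->; rewrite (negPf h).
Qed.

Lemma fock_ind (P : fock -> Prop) :
  P 0 -> (forall k u v, P u -> P v -> P (k *: u + v)) ->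
  (forall b, P (ket b)) -> forall v, P v.
Proof.
move=> P0 PD Pk v; rewrite (fockE v); elim: (fsup v : seq _) => [|b s IHs].
  by rewrite big_nil.
by rewrite big_cons; apply: PD.
Qed.

Section LinearExtension.
Variables (V : lmodType K) (T : occ -> V).

Definition lext (v : fock) : V := \sum_(b <- fsup v) coeff b v *: T b.

Lemma lextEw v (A : {fset occ}) : {subset fsup v <= A} ->
  lext v = \sum_(b <- A) coeff b v *: T b.
Proof.
move=> sA; rewrite /lext; apply: big_fset_incl => [|b _ nb]; first exact/fsubsetP.
by move: nb; rewrite fsupP negbK => /eqP->; rewrite scale0r.
Qed.

Lemma lext_is_linear : linear lext.
Proof.
move=> k u v; pose A := (fsup u `|` fsup v `|` fsup (k *: u + v)%R)%fset.
have sA w : w \in [:: u; v; k *: u + v] -> {subset fsup w <= A}.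
  rewrite !inE => wE b bw; rewrite !in_fsetU.
  by case/or3P: wE bw => /eqP-> ->; rewrite ?orbT.
rewrite !(@lextEw _ A); try by apply: sA; rewrite !inE eqxx ?orbT.
rewrite scaler_sumr -big_split /=.
by apply: eq_bigr => b _; rewrite coeffD coeffZ scalerDl scalerA.
Qed.

HB.instance Definition _ := GRing.isLinear.Build K fock V *:%R lext lext_is_linear.

Lemma lext_ket b : lext (ket b) = T b.
Proof.
rewrite (@lextEw _ [fset b]%fset) => [|c].
  by rewrite big_seq_fset1 coeff_ket eqxx scale1r.
by rewrite fsupP coeff_ket in_fset1; case: (b =P c) => [->|_]; rewrite eqxx.
Qed.

End LinearExtension.

Lemma linear_ext (V : lmodType K) (f g : {linear fock -> V}) :
  (forall b, f (ket b) = g (ket b)) -> f =1 g.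
Proof.
move=> h; apply: fock_ind => [|k u v hu hv|//]; first by rewrite !linear0.
by rewrite !linearP hu hv.
Qed.

Definition bcr (i : slot) : fock -> fock :=
  lext (fun b => ket (madd i b.1, b.2)).
Definition ban (i : slot) : fock -> fock :=
  lext (fun b => (b.1 i)%:R *: ket (mrem i b.1, b.2)).

(** The Jordan-Wigner sign: the slots are ordered by their codes, and the occupied slots before [i]
    are counted modulo 2. It makes the operators of different slots anticommute. *)
Definition fsgn (i : slot) (A : {fset slot}) : K :=
  \prod_(j <- A) (-1) ^+ (choice.pickle j < choice.pickle i)%N.

(* creation for e = false, annihilation for e = true *)
Definition fop (i : slot) (e : bool) : fock -> fock :=
  lext (fun b => if (i \in b.2) == e then fsgn i b.2 *: ket (b.1, flip i b.2)
                 else 0).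

HB.instance Definition _ i := GRing.Linear.on (bcr i).
HB.instance Definition _ i := GRing.Linear.on (ban i).
HB.instance Definition _ i e := GRing.Linear.on (fop i e).

Lemma bcr_ket i M A : bcr i (ket (M, A)) = ket (madd i M, A).
Proof. exact: lext_ket. Qed.
Lemma ban_ket i M A : ban i (ket (M, A)) = (M i)%:R *: ket (mrem i M, A).
Proof. exact: lext_ket. Qed.
Lemma fop_ket i e M A : fop i e (ket (M, A)) =
  if (i \in A) == e then fsgn i A *: ket (M, flip i A) else 0.
Proof. exact: lext_ket. Qed.

Lemma eq_ketl M M' A : M = M' -> ket (M, A) = ket (M', A).
Proof. by move=> ->. Qed.

Lemma eq_ketZl k M M' A : M = M' -> k *: ket (M, A) = k *: ket (M', A).
Proof. by move=> ->. Qed.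

Lemma bcrC i j v : bcr i (bcr j v) = bcr j (bcr i v).
Proof.
move: v; apply: (linear_ext (f := bcr i \o bcr j) (g := bcr j \o bcr i)).
case=> M A /=; rewrite !bcr_ket; apply: eq_ketl.
by apply/msetP => x; rewrite !maddE addnCA.
Qed.

Lemma banC i j v : ban i (ban j v) = ban j (ban i v).
Proof.
move: v; apply: (linear_ext (f := ban i \o ban j) (g := ban j \o ban i)).
case=> M A /=; rewrite !(ban_ket, linearZ) /= !ban_ket !scalerA.
rewrite !mremE -!natrM.
have [->//|nij] := eqVneq i j.
rewrite !subn0 mulnC; apply: eq_ketZl.
by apply/msetP => x; rewrite !mremE subnAC.
Qed.

Lemma ban_bcr i j v : ban i (bcr j v) = bcr j (ban i v) + (i == j)%:R *: v.
Proof.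
move: v; apply: (linear_ext (f := ban i \o bcr j)
  (g := (bcr j \o ban i) \+ (GRing.scale (i == j)%:R))).
case=> M A /=; rewrite !(ban_ket, bcr_ket, linearZ) /= !bcr_ket maddE.
have [->|nij] /= := eqVneq i j.
  rewrite (_ : mrem j (madd j M) = M); last first.
    by apply/msetP => x; rewrite mremE maddE addKn.
  case E : (M j) => [|n]; first by rewrite !scale0r !scale1r add0r.
  rewrite (_ : madd j (mrem j M) = M); last first.
    apply/msetP => x; rewrite maddE mremE.
    by case: (eqVneq x j) => [->|_]; rewrite ?E ?add0n ?subn0 // add1n subn1.
  by rewrite -scalerDl -natrD addnC.
rewrite add0n scale0r addr0; case E : (M i) => [|n]; first by rewrite !scale0r.
apply: eq_ketZl; apply/msetP => x; rewrite maddE !mremE maddE.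
case: (eqVneq x i) => [->|_]; last by rewrite !subn0.
by rewrite (negPf nij).
Qed.

Lemma fsgn_sqr i A : fsgn i A * fsgn i A = 1.
Proof.
rewrite /fsgn -big_split big1 //= => j _.
by rewrite -signr_addb addbb.
Qed.

Lemma fsgn_flip i j A : i != j ->
  fsgn i (flip j A) = (-1) ^+ (choice.pickle j < choice.pickle i)%N * fsgn i A.
Proof.
move=> nij; rewrite flip.unlock /fsgn; case: ifPn => jA.
  by rewrite (big_fsetD1 j jA) /= mulrA -signr_addb addbb mul1r.
by rewrite big_fsetU1.
Qed.

Lemma fsgn_flip_id i A : fsgn i (flip i A) = fsgn i A.
Proof.
rewrite flip.unlock /fsgn; case: ifPn => iA; last by rewrite big_fsetU1 //= ltnn mul1r.
by rewrite [in RHS](big_fsetD1 i iA) /= ltnn mul1r.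
Qed.

Lemma in_flip i j A : (i \in flip j A) = (i == j) (+) (i \in A).
Proof.
rewrite flip.unlock; case: ifPn => jA; rewrite !inE.
  by case: (eqVneq i j) => [->|]; rewrite ?jA.
by case: (eqVneq i j) => [->|]; rewrite ?(negPf jA).
Qed.

Lemma flipK i A : flip i (flip i A) = A.
Proof. by apply/fsetP => x; rewrite !in_flip addbA addbb. Qed.

Lemma flipC i j A : flip i (flip j A) = flip j (flip i A).
Proof. by apply/fsetP => x; rewrite !in_flip addbCA. Qed.

Lemma fop_fop i e j e' v :
  fop i e (fop j e' v) = - fop j e' (fop i e v) + ((i == j) && (e != e'))%:R *: v.
Proof.
move: v; apply: (linear_ext (f := fop i e \o fop j e')
  (g := (\- (fop j e' \o fop i e)) \+ (GRing.scale ((i == j) && (e != e'))%:R))).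
case=> M A /=; rewrite !fop_ket.
have [->|nij] /= := eqVneq i j.
  by case jA : (j \in A); case: e; case: e' => /=;
    rewrite ?linear0 ?linearZ /= ?fop_ket ?in_flip ?eqxx ?jA /= ?fsgn_flip_id
      ?flipK ?scalerN ?scalerA ?fsgn_sqr
      ?(scaler0, oppr0, scale0r, add0r, addr0, addNr, scale1r).
rewrite scale0r addr0.
case: (boolP (_ == e')) => He'; case: (boolP (_ == e)) => He;
  rewrite ?linear0 ?linearZ /= ?fop_ket ?in_flip ?(negPf nij) ?(eq_sym j i) ?(negPf nij)
    /= ?He ?He' ?(negPf He) ?(negPf He') ?scalerN ?scaler0 ?oppr0 //.
rewrite flipC !scalerA -scaleNr fsgn_flip // fsgn_flip 1?eq_sym //.
(* One of two distinct slots precedes the other, so that exactly one of the two signs changes when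
   the operators are exchanged. *)
congr (_ *: _); move: nij; rewrite -(inj_eq (pcan_inj choice.pickleK)) neq_ltn.
by case: ltngtP => //= _ _; rewrite ?expr0 ?expr1; ring.
Qed.

Lemma fop_bcr i e j v : fop i e (bcr j v) = bcr j (fop i e v).
Proof.
move: v; apply: (linear_ext (f := fop i e \o bcr j) (g := bcr j \o fop i e)).
case=> M A /=; rewrite bcr_ket !fop_ket; case: ifP => _; last by rewrite linear0.
by rewrite linearZ /= bcr_ket.
Qed.

Lemma fop_ban i e j v : fop i e (ban j v) = ban j (fop i e v).
Proof.
move: v; apply: (linear_ext (f := fop i e \o ban j) (g := ban j \o fop i e)).
case=> M A /=; rewrite ban_ket linearZ /= !fop_ket.
case: ifP => _; last by rewrite !linear0.
by rewrite [RHS]linearZ /= ban_ket !scalerA mulrC.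
Qed.

Definition bop (i : slot) (e : bool) : fock -> fock := if e then ban i else bcr i.

Lemma bop_is_linear i e : linear (bop i e).
Proof. by case: e => k u v; rewrite /bop linearP. Qed.
HB.instance Definition _ i e :=
  GRing.isLinear.Build K fock fock *:%R (bop i e) (bop_is_linear i e).

Lemma bop_bop i e j e' v : bop i e (bop j e' v) =
  bop j e' (bop i e v) + (((i == j) && (e != e'))%:R * (-1) ^+ (~~ e)) *: v.
Proof.
case: e; case: e'; rewrite /bop /= ?andbF ?andbT ?mul0r ?scale0r ?addr0.
- exact: banC.
- by rewrite ban_bcr mulr1.
- by rewrite ban_bcr expr1 mulrN1 scaleNr eq_sym addrK.
- exact: bcrC.
Qed.

Lemma fop_bop i e j e' v : fop i e (bop j e' v) = bop j e' (fop i e v).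
Proof. by case: e'; [apply: fop_ban | apply: fop_bcr]. Qed.

(* [Bos true], [Bos false], [Fer true], [Fer false] are b^+, b^-, a, x, and
   [phi t k] is the mode of index k, resp. k + 1/2 for a fermion. *)
Inductive field := Bos of bool | Fer of bool.
Definition fpar (t : field) : bool := if t is Fer _ then true else false.

Definition bslot (s : bool) (k : int) : slot :=
  match k with
  | Posz n => if s then (false, n) else if n is n'.+1 then (true, n') else (false, 0%N)
  | Negz n => if s then (true, n) else (false, n.+1)
  end.
(** The zero modes form a Weyl pair, so that one of them has to create. The choice of [b^-_0] makes
    [J^+_0], which contains the square of [b^+_0], kill the vacuum. *)
Definition bann (s : bool) (k : int) : bool := (if s then 0 <= k else 0 < k)%R.
(** The sign is needed because [b^-_k] and [b^+_{-k}] have commutator -1, while [ban] and [bcr] have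
    commutator 1. *)
Definition bsgn (s : bool) (k : int) : K := if s then 1 else (-1) ^+ (0 < k)%R.
Definition fslot (s : bool) (k : int) : slot :=
  match k with Posz n => (~~ s, n) | Negz n => (s, n) end.

Definition phi_def (t : field) (k : int) (v : fock) : fock :=
  match t with
  | Bos s => bsgn s k *: bop (bslot s k) (bann s k) v
  | Fer s => fop (fslot s k) (0 <= k)%R v
  end.
(* sealed, as unification would otherwise unfold it *)
Fact phi_key : {p | p = phi_def}. Proof. by exists phi_def. Qed.
Definition phi : field -> int -> fock -> fock := sval phi_key.

Lemma phi_bos s k v : phi (Bos s) k v = bsgn s k *: bop (bslot s k) (bann s k) v.
Proof. by rewrite /phi (svalP phi_key). Qed.

Lemma phi_fer s k v : phi (Fer s) k v = fop (fslot s k) (0 <= k)%R v.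
Proof. by rewrite /phi (svalP phi_key). Qed.

Lemma phi_is_linear t k : linear (phi t k).
Proof.
case: t => s c u v; rewrite ?phi_bos ?phi_fer linearP // scalerDr !scalerA.
by rewrite mulrC.
Qed.
HB.instance Definition _ t k := GRing.isLinear.Build K fock fock *:%R (phi t k)
  (phi_is_linear t k).

(** The scalar supercommutator of two modes. The shift by 1 for fermions comes from the labels: the
    modes [m] and [n] have indices [m + 1/2] and [n + 1/2]. *)
Definition om (t u : field) (m n : int) : K :=
  match t, u with
  | Bos true, Bos false => (m + n == 0)%:R
  | Bos false, Bos true => - (m + n == 0)%:R
  | Fer s, Fer s' => ((s != s') && (m + n + 1 == 0))%:R
  | _, _ => 0
  end.

Lemma phi_comm t u m n v : phi t m (phi u n v) =
  (-1) ^+ (fpar t && fpar u) *: phi u n (phi t m v) + om t u m n *: v.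
Proof.
case: t u => s [] s'; rewrite ?phi_bos ?phi_fer /fpar ?expr0 ?expr1 ?scale1r ?linearZ /=.
- rewrite bop_bop !scalerDr !scalerA (mulrC (bsgn s' n)); congr (_ + _ *: _).
  have PN i j : (Posz i + Negz j == 0) = (i == j.+1) by lia.
  have NP i j : (Negz i + Posz j == 0) = (j == i.+1) by lia.
  have NN i j : (Negz i + Negz j == 0) = false by lia.
  have PP i j : (Posz i + Posz j == 0) = (i == 0)%N && (j == 0)%N by lia.
  case: s s' => [] []; case: m => [[|m]|m]; case: n => [[|n]|n];
    rewrite /bsgn /bslot /bann /om ?PN ?NP ?NN ?PP ?xpair_eqE /= ?andbF ?andbT
     ?eqSS ?(eq_sym n m) ?(expr0, expr1); by rewrite ?(mul0r, mulr0); ring.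
- by rewrite fop_bop if_same scale0r addr0.
- by rewrite fop_bop scale0r addr0.
rewrite fop_fop scaleN1r; congr (_ + _%:R *: _).
have PN i j : (Posz i + Negz j + 1 == 0) = (i == j) by lia.
have NP i j : (Negz i + Posz j + 1 == 0) = (i == j) by lia.
have PP i j : (Posz i + Posz j + 1 == 0) = false by lia.
have NN i j : (Negz i + Negz j + 1 == 0) = false by lia.
by case: m => m; case: n => n; case: s; case: s';
  rewrite ?PN ?NP ?PP ?NN /fslot ?xpair_eqE /= ?andbF ?andbT // eq_sym.
Qed.

End FockSpace.

Lemma perm_madd i M : perm_eq (madd i M) (i :: M).
Proof.
apply/allP => j _ /=; rewrite !count_mem_mset maddE; apply/eqP.
by rewrite (eq_sym j).
Qed.

Lemma madd_mrem i (M : multiset slot) : (0 < M i)%N -> madd i (mrem i M) = M.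
Proof.
move=> Mi; apply/msetP => j; rewrite maddE mremE.
by case: eqVneq => [->|_]; rewrite ?subn0 // add1n subn1 prednK.
Qed.

Lemma mrem_madd i M : mrem i (madd i M) = M.
Proof. by apply/msetP => j; rewrite mremE maddE addKn. Qed.

Lemma multiset_ind (Q : multiset slot -> Prop) :
  Q mset0 -> (forall i M, Q M -> Q (madd i M)) -> forall M, Q M.
Proof.
move=> Q0 QS M; have [n] := ubnP (size M); elim: n M => // n IHn M ltMn.
case: (boolP (M == mset0)) => [/eqP-> //|].
have [E|] := posnP (size M); first by rewrite -size_mset_eq0 E.
case E : (enum_mset M) => [|i s] // _ _.
have iM : (0 < M i)%N by rewrite mset_gt0 -[_ \in _]/(i \in enum_mset M) E inE eqxx.
rewrite -(madd_mrem iM); apply/QS/IHn.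
by move: ltMn; rewrite -{1}(madd_mrem iM) (perm_size (perm_madd _ _)).
Qed.

Definition occ0 : occ := (mset0, fset0).

Lemma occ_ind (Q : occ -> Prop) :
  Q occ0 -> (forall i M A, Q (M, A) -> Q (madd i M, A)) ->
  (forall i M A, i \notin A -> Q (M, A) -> Q (M, flip i A)) -> forall b, Q b.
Proof.
move=> Q0 QB QF [M A]; elim/multiset_ind: M => [|i M]; last exact: QB.
have [n] := ubnP #|` A|%fset; elim: n A => // n IHn A ltAn.
have [->//|[i iA]] := fset_0Vmem A.
rewrite -(flipK i A); apply: QF; first by rewrite in_flip eqxx iA.
apply: IHn; rewrite flip.unlock iA.
by move: ltAn; rewrite (cardfsD1 i) iA.
Qed.

(** * The grading of states and modes *)

Section Degrees.

(* twice the energy, the J_0-charge, and the number of a's minus that of x's *)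
Definition grade : Type := (int * int * int)%type.
HB.instance Definition _ := GRing.Zmodule.on grade.

Lemma gradeP (x y : grade) : x.1.1 = y.1.1 -> x.1.2 = y.1.2 -> x.2 = y.2 -> x = y.
Proof. by case: x y => [[? ?] ?] [[? ?] ?] /= -> -> ->. Qed.

Definition bdeg (i : slot) : grade :=
  (((i.2 + i.1).*2 : nat)%:Z, if i.1 then 1 else -1, 0).
Definition fdeg (i : slot) : grade :=
  ((i.2.*2.+1)%:Z, 0, if i.1 then 1 else -1).
Definition deg (b : occ) : grade := \sum_(i <- b.1) bdeg i + \sum_(i <- b.2) fdeg i.

Lemma deg0 : deg occ0 = 0.
Proof. by rewrite /deg /= big_mset0 big_seq_fset0 addr0. Qed.

Lemma deg_madd i M A : deg (madd i M, A) = bdeg i + deg (M, A).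
Proof. by rewrite /deg /= (perm_big _ (perm_madd i M)) big_cons addrA. Qed.

Lemma deg_mrem i (M : multiset slot) A : (0 < M i)%N -> deg (mrem i M, A) = deg (M, A) - bdeg i.
Proof. by move=> Mi; rewrite -{2}(madd_mrem Mi) deg_madd addrC addKr. Qed.

Lemma deg_flip i M A :
  deg (M, flip i A) = if i \in A then deg (M, A) - fdeg i else deg (M, A) + fdeg i.
Proof.
rewrite /deg /= flip.unlock; case: ifPn => iA.
  by rewrite [in RHS](big_fsetD1 i iA) /= -addrA; congr (_ + _); rewrite [fdeg i + _]addrC addrK.
by rewrite big_fsetU1 //= -addrA; congr (_ + _); rewrite addrC.
Qed.

Lemma deg_ge0 b : 0 <= (deg b).1.1.
Proof.
elim/occ_ind: b => [|i M A|i M A iA]; first by rewrite deg0.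
  by rewrite deg_madd; apply: addr_ge0.
by rewrite deg_flip (negPf iA) => h; apply: addr_ge0.
Qed.

Definition phideg (t : field) (k : int) : grade :=
  match t with
  | Bos s => (- (k *+ 2), if s then 1 else -1, 0)
  | Fer s => (- (k *+ 2 + 1), 0, if s then 1 else -1)
  end.

End Degrees.

(** * The vacuum, annihilation modes and homogeneous vectors *)

Section FockTheory.
Variable K : numFieldType.
Notation fock := (fock K).
Implicit Types (u v w : fock) (b : occ) (t x : field) (k : int).

Definition vac : fock := ket K occ0.

Definition ann t k : bool :=
  match t with Bos s => bann s k | Fer _ => (0 <= k)%R end.

Lemma phi_vac t k : ann t k -> phi t k vac = 0.
Proof.
case: t => s /= h; rewrite ?phi_bos ?phi_fer h /vac /occ0.
  by rewrite /bop ban_ket mset0E scale0r scaler0.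
by rewrite fop_ket in_fset0.
Qed.

Lemma phi_cr_bos s (n : nat) : exists k, phi (Bos s) k =1 @bcr K (s, n) /\ ~~ bann s k.
Proof.
case: s; first by exists (Negz n); split=> // v; rewrite phi_bos /bsgn /= scale1r.
case: n => [|n]; first by exists 0; split=> // v; rewrite phi_bos /bsgn /= scale1r.
by exists (Negz n); split=> // v; rewrite phi_bos /bsgn /= scale1r.
Qed.

Lemma phi_cr_fer s (n : nat) : phi (Fer s) (Negz n) =1 @fop K (s, n) false.
Proof. by move=> v; rewrite phi_fer. Qed.

(** Every basis vector is, up to sign, a word in creation modes applied to the vacuum. *)
Lemma fock_gen (P : fock -> Prop) :
  P 0 -> (forall c u v, P u -> P v -> P (c *: u + v)) -> P vac ->
  (forall t k v, P v -> P (phi t k v)) -> forall v, P v.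
Proof.
move=> P0 PD Pvac Pphi; apply: fock_ind => // b.
have PZ c v : P v -> P (c *: v) by move=> Pv; rewrite -[_ *: v]addr0; apply: PD.
elim/occ_ind: b => // [[s n] M A IH|[s n] M A iA IH].
  have [k [e _]] := phi_cr_bos s n.
  by rewrite -bcr_ket -e; apply: Pphi.
have := Pphi (Fer s) (Negz n) _ IH; rewrite phi_cr_fer fop_ket (negPf iA) eqxx.
move=> /(PZ (fsgn K (s, n) A)); by rewrite scalerA fsgn_sqr scale1r.
Qed.

Lemma coeff_ban i v M A :
  coeff (M, A) (ban i v) = (M i).+1%:R * coeff (madd i M, A) v.
Proof.
move: v; apply: fock_ind => [|c u w hu hw|[M' A']].
- by rewrite !raddf0 mulr0.
- by rewrite linearP !coeffD !coeffZ hu hw; ring.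
rewrite ban_ket coeffZ !coeff_ket.
have [->|nM] := eqVneq M' (madd i M).
  by rewrite mrem_madd maddE eqxx add1n /= /eq_op /= !eqxx.
rewrite [(M', A') == _]/eq_op /= (negPf nM) /= mulr0.
have [->|iM] := posnP (M' i); first by rewrite mul0r.
rewrite [(_, A') == _]/eq_op /=; case: eqP => [e|]; last by rewrite mulr0.
by rewrite -e madd_mrem ?eqxx in nM.
Qed.

Lemma coeff_fan i v M A : i \notin A ->
  coeff (M, A) (fop i true v) = fsgn K i A * coeff (M, flip i A) v.
Proof.
move=> iA; move: v; apply: fock_ind => [|c u w hu hw|[M' A']].
- by rewrite !raddf0 mulr0.
- by rewrite linearP !coeffD !coeffZ hu hw; ring.
rewrite fop_ket coeff_ket.
have [->|nA] := eqVneq A' (flip i A).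
  rewrite in_flip eqxx (negPf iA) /= coeffZ coeff_ket flipK fsgn_flip_id.
  by rewrite ![(_, _) == _]/eq_op /= !eqxx.
rewrite [(M', A') == _]/eq_op /= (negPf nA) andbF mulr0.
case: ifP => _; last by rewrite raddf0.
rewrite coeffZ coeff_ket [(_, _) == _]/eq_op /=.
have [e|] := eqVneq (flip i A') A; last by rewrite andbF mulr0.
by rewrite -e flipK eqxx in nA.
Qed.

Lemma phi_ann_bos i : exists s k, bann s k /\
  exists2 c : K, c != 0 & forall v, phi (Bos s) k v = c *: ban i v.
Proof.
case: i => [[] n]; [exists false, n.+1%:Z | exists true, n%:Z];
 split=> //; [exists (-1)|exists 1]; rewrite ?oppr_eq0 ?oner_eq0 // => v;
 by rewrite phi_bos.
Qed.

(** If a state has an occupied slot, its coefficient in [v] is, up to a nonzero factor, a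
    coefficient of the vector obtained by annihilating one quantum of that slot in [v]. *)
Lemma ann_all v : (forall t k, ann t k -> phi t k v = 0) ->
  v = coeff occ0 v *: vac.
Proof.
move=> h; apply: fockP => -[M A]; rewrite coeffZ coeff_ket.
have [<-|nb] := eqVneq occ0 (M, A); first by rewrite mulr1.
rewrite mulr0; have [eM|] := eqVneq M mset0.
  have [eA|[i iA]] := fset_0Vmem A; first by rewrite eM eA eqxx in nb.
  have nA : i \notin flip i A by rewrite in_flip eqxx iA.
  have /(congr1 (coeff (M, flip i A))) := h (Fer (~~ i.1)) i.2%:Z isT.
  rewrite phi_fer /= negbK -surjective_pairing coeff_fan // flipK raddf0 fsgn_flip_id.
  move=> /(congr1 ( *%R (fsgn K i A))); by rewrite mulrA fsgn_sqr mul1r mulr0.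
rewrite -size_mset_eq0; case E : (enum_mset M) => [|i s] // _.
have iM : (0 < M i)%N by rewrite mset_gt0 -[_ \in _]/(i \in enum_mset M) E inE eqxx.
have [s' [k [a [c c0 e]]]] := phi_ann_bos i.
have := h (Bos s') k a; rewrite e => /(congr1 (coeff (mrem i M, A))).
rewrite coeffZ coeff_ban madd_mrem // raddf0 => /eqP.
by rewrite !mulf_eq0 (negPf c0) pnatr_eq0 /= => /eqP.
Qed.

Definition homog (d : grade) v := forall b, coeff b v != 0 -> deg b = d.

Lemma homog0 d : homog d 0.
Proof. by move=> b; rewrite raddf0 eqxx. Qed.

Lemma homogP d c u v : homog d u -> homog d v -> homog d (c *: u + v).
Proof.
move=> hu hv b; rewrite coeffD coeffZ; have [->|/hu //] := eqVneq (coeff b u) 0.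
by rewrite mulr0 add0r => /hv.
Qed.

Lemma homogZ d c u : homog d u -> homog d (c *: u).
Proof. by move=> hu; rewrite -[_ *: u]addr0; apply: homogP (homog0 d). Qed.

Lemma homogD d u v : homog d u -> homog d v -> homog d (u + v).
Proof. by move=> hu hv; rewrite -[u]scale1r; apply: homogP. Qed.

Lemma homogB d u v : homog d u -> homog d v -> homog d (u - v).
Proof. by move=> hu hv; rewrite addrC -scaleN1r; apply: homogP. Qed.

Lemma homog_sum d (I : Type) (r : seq I) (F : I -> fock) :
  (forall i, homog d (F i)) -> homog d (\sum_(i <- r) F i).
Proof.
by move=> h; elim/big_ind: _ => // [|u v]; [apply: homog0 | apply: homogD].
Qed.

Lemma homog_ket b : homog (deg b) (ket K b).
Proof. by move=> b'; rewrite coeff_ket; case: (b =P b') => [->//|_]; rewrite eqxx. Qed.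

Lemma homog_phi d t k v : homog d v -> homog (d + phideg t k) (phi t k v).
Proof.
move=> hv; rewrite (fockE v) linear_sum big_seq; elim/big_ind: _ => [|u w|b].
- exact: homog0.
- exact: homogD.
rewrite linearZ /= fsupP => bv; apply: homogZ.
have -> : d = deg b by apply/esym/hv.
case: b {bv} => M A; case: t => s; rewrite ?phi_bos ?phi_fer.
  apply: homogZ; rewrite /bop; case: (boolP (bann s k)) => ha; last first.
    rewrite bcr_ket addrC.
    have -> : phideg (Bos s) k = bdeg (bslot s k).
      by case: s ha; case: k => [[|k]|k] //= _; apply: gradeP; rewrite /= ?oppr0 //; lia.
    by rewrite -deg_madd; apply: homog_ket.
  rewrite ban_ket; have [->|Mi] := posnP (M (bslot s k)).
    by rewrite scale0r; apply: homog0.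
  have -> : phideg (Bos s) k = - bdeg (bslot s k).
    by case: s ha {Mi}; case: k => [[|k]|k] //= _; apply: gradeP; rewrite /= ?oppr0 //; lia.
  by rewrite -deg_mrem //; apply/homogZ/homog_ket.
rewrite fop_ket.
case: eqP => [e|_]; last exact: homog0.
apply: homogZ; have -> : deg (M, A) + phideg (Fer s) k = deg (M, flip (fslot s k) A).
  rewrite deg_flip e; case: k {e} => k; congr (_ + _);
    case: s; apply: gradeP; rewrite /= ?oppr0 //; lia.
exact: homog_ket.
Qed.

(** The bound on twice the energy is strict, so that the bound 0 leaves only the zero vector and can
    start an induction. *)
Definition ebound (e : nat) v := forall b, coeff b v != 0 -> (deg b).1.1 < e%:Z.

Lemma ebound0 v : ebound 0 v -> v = 0.
Proof.
move=> h; apply: fockP => b; rewrite raddf0; apply/eqP; apply: contraT => /h.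
by rewrite ltNge deg_ge0.
Qed.

Lemma ebound_exists v : exists e, ebound e v.
Proof.
move: v; apply: fock_ind => [|c u v [e1 h1] [e2 h2]|b].
- by exists 0%N => b; rewrite raddf0 eqxx.
- exists (maxn e1 e2) => b; rewrite coeffD coeffZ.
  have [->|/h1 h _] := eqVneq (coeff b u) 0.
    by rewrite mulr0 add0r => /h2; lia.
  lia.
exists `|(deg b).1.1|.+1%N => b'; rewrite coeff_ket.
case: (b =P b') => [-> _|_]; last by rewrite eqxx.
by have := deg_ge0 b'; lia.
Qed.

Lemma ebound_phi e d t k v : (phideg t k).1.1 <= - d%:Z -> ebound e v ->
  ebound (e - d) (phi t k v).
Proof.
move=> hd hv; rewrite (fockE v) linear_sum big_seq.
pose P := fun u => ebound (e - d) u; rewrite -/(P _); elim/big_ind: _ => [|u w hu hw|b].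
- by move=> b; rewrite raddf0 eqxx.
- move=> b; rewrite coeffD; have [->|/hu //] := eqVneq (coeff b u) 0.
  by rewrite add0r => /hw.
rewrite fsupP => /hv hb b'; rewrite linearZ coeffZ mulf_eq0 negb_or.
case/andP=> _ /(@homog_phi _ t k _ (@homog_ket b)) e'.
have := deg_ge0 b'; rewrite e' /=; move: hb hd; move: (phideg t k) => [[p1 p2] p3] /=.
move: (deg b) => [[q1 q2] q3] /=; lia.
Qed.

(** A mode [k] lowers twice the energy by at least [2 k], so that one bound serves all fields. This
    makes the infinite sums of products of modes locally finite. *)
Lemma phi_eventually0 v : exists N : nat, forall t k, N%:Z < k -> phi t k v = 0.
Proof.
have [e he] := ebound_exists v; exists e => t k ltk.
apply: ebound0; rewrite -(subnn e); apply: ebound_phi => //.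
by case: t => s /=; lia.
Qed.

End FockTheory.

Lemma coeffN (K : numFieldType) b (v : fock K) : coeff b (- v) = - coeff b v.
Proof. exact: raddfN. Qed.

Lemma coeff0 (K : numFieldType) b : coeff b (0 : fock K) = 0.
Proof. exact: raddf0. Qed.

(** An identity between vectors is tested on each coefficient, where the coefficients of the vectors
    involved become free variables of a scalar identity. *)
Ltac to_coeff := apply: fockP => ?; rewrite ?(coeffD, coeffN, coeffZ, coeff0);
  repeat match goal with |- context [coeff ?b ?x] => generalize (coeff b x); intro end.
Ltac module := to_coeff; ring.

(** * Free field realisation at c = -3 *)

Section LocallyFiniteSums.
Variable V : zmodType.
Implicit Types f g : int -> V.

(** A sum over all integers that is meaningful for families satisfying [fsupp]; it allows shifts and
    reflections of the index without choosing bounds. *)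
Definition lsum f : V := \sum_(i \in (classical_sets.setT : set int)) f i.
Definition fsupp f := exists A : {fset int}, forall i, i \notin A -> f i = 0.

Lemma lsumE f (A : {fset int}) : (forall i, i \notin A -> f i = 0) ->
  lsum f = \sum_(i <- A) f i.
Proof. exact: fsbigTE. Qed.

Lemma eq_lsum f g : f =1 g -> lsum f = lsum g.
Proof. by move=> /funext ->. Qed.

Lemma lsum1 k f : (forall i, i != k -> f i = 0) -> lsum f = f k.
Proof.
move=> h; rewrite (@lsumE _ [fset k]%fset) ?big_seq_fset1 // => i.
by rewrite in_fset1 => /h.
Qed.

Lemma lsum0 f : (forall i, f i = 0) -> lsum f = 0.
Proof. by move=> h; rewrite (@lsum1 0) ?h. Qed.

Lemma lsumD f g : fsupp f -> fsupp g -> lsum (fun i => f i + g i) = lsum f + lsum g.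
Proof.
move=> [A hA] [B hB]; have h i : i \notin (A `|` B)%fset -> f i = 0 /\ g i = 0.
  by rewrite in_fsetU negb_or => /andP[/hA -> /hB ->].
by rewrite !(@lsumE _ (A `|` B)%fset) ?big_split //= => i /h[fi gi]; rewrite ?fi ?gi ?addr0.
Qed.

Lemma fsuppD f g : fsupp f -> fsupp g -> fsupp (fun i => f i + g i).
Proof.
move=> [A hA] [B hB]; exists (A `|` B)%fset => i.
by rewrite in_fsetU negb_or => /andP[/hA -> /hB ->]; rewrite addr0.
Qed.

Lemma lsum_shift c f : lsum (fun i => f (i + c)) = lsum f.
Proof.
symmetry; rewrite /lsum; apply: (reindex_fsbigT (fun i : int => i + c)).
by exists (fun i => i - c) => i; rewrite (addrK, subrK).
Qed.

Lemma lsum_refl c f : lsum (fun i => f (c - i)) = lsum f.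
Proof.
symmetry; rewrite /lsum; apply: (reindex_fsbigT (fun i : int => c - i)).
by exists (fun i => c - i) => i; rewrite subKr.
Qed.

Definition zwindow (m : int) (n : nat) : {fset int} :=
  seq_fset tt [seq m + j%:Z | j <- iota 0 n].

Lemma zwindowP (m i : int) (n : nat) : (i \in zwindow m n) = (m <= i < m + n%:Z).
Proof.
rewrite seq_fsetE; apply/mapP/idP => [[j]|/andP[h1 h2]].
  by rewrite mem_iota => hj ->; lia.
by exists `|i - m|%N; [rewrite mem_iota; lia | lia].
Qed.

Lemma fsupp_bounds f (m n : int) : (forall i, i < m -> f i = 0) ->
  (forall i, n < i -> f i = 0) -> fsupp f.
Proof.
move=> hm hn; exists (zwindow m `|n - m|.+1) => i; rewrite zwindowP => h.
by have [/hm //|mi] := ltP i m; apply: hn; lia.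
Qed.

Lemma lsum_window (m : int) (n : nat) f : (forall i, i < m -> f i = 0) ->
  (forall i, m + n%:Z <= i -> f i = 0) -> lsum f = \sum_(j < n) f (m + j%:Z).
Proof.
move=> hm hn; rewrite (@lsumE _ (zwindow m n)) => [|i]; last first.
  by rewrite zwindowP => h; have [/hm //|mi] := ltP i m; apply: hn; lia.
rewrite /zwindow (perm_big _ (seq_fset_perm tt _)) /= undup_id; last first.
  by rewrite map_inj_uniq ?iota_uniq // => i j /addrI [].
by rewrite big_map -[X in iota _ X]subn0 -/(index_iota 0 n) big_mkord.
Qed.

End LocallyFiniteSums.

Lemma raddf_lsum (U V : zmodType) (h : {additive U -> V}) (f : int -> U) :
  fsupp f -> h (lsum f) = lsum (fun i => h (f i)).
Proof.
move=> [A hA]; rewrite (lsumE hA) (@lsumE _ _ A) ?raddf_sum // => i /hA ->.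
exact: raddf0.
Qed.

(** * Sums of products of two commuting fields, and Schur's lemma *)

Section Bilinear.
Variable K : numFieldType.
Notation fock := (fock K).
Implicit Types (u v w : fock) (t x y : field) (k m n i : int) (p q : bool).

Definition om0 t x : K :=
  match t, x with
  | Bos true, Bos false => 1
  | Bos false, Bos true => -1
  | Fer s, Fer s' => (s != s')%:R
  | _, _ => 0
  end.
(** The only index at which a mode of [t] can have a nonzero bracket with a mode [k]. *)
Definition pole t k : int := - k - (fpar t)%:Z.

Lemma omE t x m k : om K t x m k = om0 t x * (m == pole t k)%:R.
Proof.
have eB : (m + k == 0) = (m == - k) by rewrite addr_eq0.
have eF : (m + k + 1 == 0) = (m == - k - 1) by lia.
by case: t x => [[]|s] [[]|s']; rewrite /om /om0 /pole /= ?subr0 ?mul0r ?mul1r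
  ?mulN1r ?eB ?eF // -natrM mulnb.
Qed.

Lemma lsum_om t x k (g : int -> K) (h : int -> fock) :
  lsum (fun i => (g i * om K t x i k) *: h i) =
  (g (pole t k) * om0 t x) *: h (pole t k).
Proof.
rewrite (@lsum1 _ (pole t k)) => [|i ni]; rewrite omE ?eqxx ?mulr1 //.
by rewrite (negPf ni) !mulr0 scale0r.
Qed.

Lemma fsupp_om t x k (g : int -> K) (h : int -> fock) :
  fsupp (fun i => (g i * om K t x i k) *: h i).
Proof.
exists [fset pole t k]%fset => i; rewrite in_fset1 => ni.
by rewrite omE (negPf ni) !mulr0 scale0r.
Qed.

Definition bil (c : int -> K) t y n v : fock :=
  lsum (fun i => c i *: phi t i (phi y (n - i) v)).

Section Commuting.
Variables (t y : field).
Hypothesis ty : om0 t y = 0.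

Lemma phi_swap m n v : phi t m (phi y n v) =
  (-1) ^+ (fpar t && fpar y) *: phi y n (phi t m v).
Proof. by rewrite phi_comm omE ty mul0r scale0r addr0. Qed.

(** For large [i] the left factor can be moved next to [v] and kills it; for very negative [i] the
    right factor does. This is why only fields with bracket 0 are multiplied. *)
Lemma fsupp_bil c n v : fsupp (fun i => c i *: phi t i (phi y (n - i) v)).
Proof.
have [N hN] := phi_eventually0 v.
apply: (@fsupp_bounds _ _ (n - N%:Z) N%:Z) => i hi.
  by rewrite (hN y) ?linear0 ?scaler0 //; lia.
by rewrite phi_swap (hN t) // !linear0.
Qed.

Lemma bil_is_linear c n : linear (bil c t y n).
Proof.
move=> a u v; rewrite /bil -[a *: lsum _]/(GRing.scale a _) (raddf_lsum _ (@fsupp_bil _ _ _)).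
rewrite -lsumD; last exact: fsupp_bil.
  apply: eq_lsum => i; rewrite (linearP (phi y (n - i))) (linearP (phi t i)).
  by rewrite scalerDr /= !scalerA (mulrC a).
have [A hA] := @fsupp_bil c n u; exists A => i /hA /= ->; exact: scaler0.
Qed.

End Commuting.

(** [f x k] is the supercommutator of [A], of parity [p], with the mode [k] of [x]. By Schur's lemma
    below, these supercommutators determine an even operator up to a scalar. *)
Definition derf p (A : fock -> fock) (f : field -> int -> fock -> fock) :=
  linear A /\ forall x k v,
    A (phi x k v) = (-1) ^+ (p && fpar x) *: phi x k (A v) + f x k v.

(** Leibniz rule: moving the mode past the two factors leaves two sums of brackets, each of which
    collapses to the single term at the pole. *)
Lemma bil_derf c t y n : om0 t y = 0 -> derf (fpar t (+) fpar y) (bil c t y n)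
  (fun x k v =>
    (c (pole t k) * (-1) ^+ (fpar y && fpar x) * om0 t x) *: phi y (n - pole t k) v
    + (c (n - pole y k) * om0 y x) *: phi t (n - pole y k) v).
Proof.
move=> ty; split=> [|x k v]; first exact: bil_is_linear.
rewrite {1}/bil.
rewrite (eq_lsum (g := fun i =>
   (-1) ^+ ((fpar t (+) fpar y) && fpar x) *:
      phi x k (c i *: phi t i (phi y (n - i) v))
   + ((c i * (-1) ^+ (fpar y && fpar x) * om K t x i k) *: phi y (n - i) v
     + (c i * om K y x (n - i) k) *: phi t i v))); last first.
  move=> i; rewrite (phi_comm y x) linearD !linearZ /= (phi_comm t x) /=.
  rewrite !(scalerDr, scalerA) -!addrA.
  suff -> : c i * (-1) ^+ (fpar y && fpar x) * (-1) ^+ (fpar t && fpar x) =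
    c i * (-1) ^+ ((fpar t (+) fpar y) && fpar x) by [].
  by case: t x y {ty} => ? [] ? [] ?; rewrite /= ?(expr0, expr1); ring.
have fF : fsupp (fun i => (c i * om K y x (n - i) k) *: phi t i v).
  exists [fset n - pole y k]%fset => i; rewrite in_fset1 omE => ni.
  suff /negPf-> : n - i != pole y k by rewrite !mulr0 scale0r.
  by apply: contraNneq ni => <-; rewrite subKr.
rewrite lsumD; first last.
- apply: fsuppD; last exact: fF; exact: fsupp_om.
- have [A hA] := @fsupp_bil _ _ ty c n v; exists A => i /hA ->; by rewrite !linear0.
rewrite lsumD //; last exact: fsupp_om.
rewrite lsum_om; congr (_ + (_ + _)).
  rewrite -(raddf_lsum ((-1) ^+ ((fpar t (+) fpar y) && fpar x) \*: phi x k)) //.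
  exact: fsupp_bil.
rewrite -(lsum_refl n) -(lsum_om y x k (fun i => c (n - i)) (fun i => phi t (n - i) v)).
by apply: eq_lsum => i; rewrite subKr.
Qed.

Lemma homog_lsum d (f : int -> fock) : fsupp f -> (forall i, homog d (f i)) ->
  homog d (lsum f).
Proof. by move=> [A hA] h; rewrite (lsumE hA); apply: homog_sum. Qed.

Definition ofdeg (d : grade) (A : fock -> fock) :=
  forall e v, homog e v -> homog (e + d) (A v).

Lemma bil_ofdeg c t y n d : om0 t y = 0 ->
  (forall i, phideg y (n - i) + phideg t i = d) -> ofdeg d (bil c t y n).
Proof.
move=> ty hd e v hv; apply: homog_lsum; first exact: fsupp_bil.
by move=> i; apply: homogZ; rewrite -(hd i) addrA; do 2![apply: homog_phi].
Qed.

(** The vector [D vac] is killed by every annihilation mode, hence is a multiple of the vacuum, and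
    [D] commutes with the modes that generate the space from it. *)
Lemma schur0 D : derf false D (fun _ _ _ => 0) ->
  forall v, D v = coeff occ0 (D (vac K)) *: v.
Proof.
move=> [lD hD]; set c := coeff _ _.
have l0 : D 0 = 0 by have := lD (-1) 0 0; rewrite scaler0 addr0 scaleN1r addNr.
have hv : D (vac K) = c *: vac K.
  apply: ann_all => t k a; have := hD t k (vac K).
  by rewrite phi_vac // l0 addr0 scale1r.
apply: fock_gen => //; first by rewrite l0 scaler0.
  by move=> a u v hu hv'; rewrite lD hu hv' scalerDr !scalerA mulrC.
by move=> t k v h; rewrite hD h addr0 scale1r linearZ.
Qed.

(** Again [D vac] is a multiple of the vacuum; as the vacuum has degree 0, a nonzero [d] forces this
    multiple to vanish. *)
Lemma schur p D d : derf p D (fun _ _ _ => 0) -> homog d (D (vac K)) -> d != 0 ->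
  forall v, D v = 0.
Proof.
move=> [lD hD] hd d0.
have l0 : D 0 = 0 by have := lD (-1) 0 0; rewrite scaler0 addr0 scaleN1r addNr.
have hv : D (vac K) = 0.
  have e : D (vac K) = coeff occ0 (D (vac K)) *: vac K.
    apply: ann_all => t k a; have := hD t k (vac K).
    rewrite phi_vac // l0 addr0 => /esym/eqP.
    by rewrite scaler_eq0 signr_eq0 /= => /eqP.
  rewrite e; have [->|/hd] := eqVneq (coeff occ0 (D (vac K))) 0; first by rewrite scale0r.
  by rewrite deg0 => /esym/eqP; rewrite (negPf d0).
apply: fock_gen => //.
  by move=> a u v hu hv'; rewrite lD hu hv' addr0 scaler0.
by move=> t k v h; rewrite hD h addr0 linear0 scaler0.
Qed.

End Bilinear.

(** * The currents and their brackets with the modes *)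

Section Currents.
Variable K : numFieldType.
Notation fock := (fock K).
Implicit Types (u v w : fock) (t x y : field) (k m n i : int) (p q s : bool).

Lemma phiD t k u v : phi t k (u + v) = phi t k u + phi t k v.
Proof. exact: linearD. Qed.

Lemma phiN t k v : phi t k (- v) = - phi t k v.
Proof. exact: linearN. Qed.

Lemma phiZ t k (c : K) v : phi t k (c *: v) = c *: phi t k v.
Proof. exact: linearZ. Qed.

Definition sg s : K := if s then 1 else -1.

Definition Jpm s n : fock -> fock :=
  bil (fun=> sg s / 2) (Bos s) (Bos s) n.
Definition Gpm s m : fock -> fock := bil (fun=> 1) (Bos s) (Fer true) (m - 1).
(** The factor [- (k + 1/2)], with [k = m - 1 - i], turns the modes of [x] into those of its
    derivative, a field of weight 1 like [a]. *)
Definition Gbpm s m : fock -> fock :=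
  bil (fun i => - sg s * ((m - 1 - i)%:~R + 2^-1)) (Bos s) (Fer false) (m - 1).

(** In the algebra [J^0_n] is the bracket of [J^+_0] and [J^-_n], without central term. Taking this
    as the definition avoids the normally ordered product of [b^+] and [b^-]. *)
Fact Jz_key : {f : int -> fock -> fock | forall n v,
  f n v = Jpm true 0 (Jpm false n v) - Jpm false n (Jpm true 0 v)}.
Proof. by eexists. Qed.
Definition Jz n : fock -> fock := sval Jz_key n.

(** In the algebra the bracket of [G^+_(0)] and [Gbar^-_(n)] is [L_(n) - n/2 J^0_(n-1)], without
    central term; this is solved for [L_(n)]. *)
Fact Lz_key : {f : int -> fock -> fock | forall n v,
  f n v = Gpm true 0 (Gbpm false n v) + Gbpm false n (Gpm true 0 v)
  + (n%:~R / 2) *: Jz (n - 1) v}.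
Proof. by eexists. Qed.
Definition Lz n : fock -> fock := sval Lz_key n.

Definition cur (A : gen) (m : int) : fock -> fock :=
  match A with
  | gL => Lz m | gJ0 => Jz m | gJ s => Jpm s m | gG s => Gpm s m
  | gGbar s => Gbpm s m
  end.

Definition mode : Type := (K * field * int)%type.

(* [cur A m, phi x k] is the multiple of a mode described by [tab A m x k] *)
Definition tab (A : gen) (m : int) (x : field) (k : int) : mode :=
  match A, x with
  | gL, Bos s => (- (m%:~R / 2 + k%:~R - 2^-1), Bos s, m + k - 1)
  | gL, Fer true => (- (k%:~R + 2^-1), Fer true, m + k - 1)
  | gL, Fer false => (- ((m + k - 1)%:~R + 2^-1), Fer false, m + k - 1)
  | gJ0, Bos s => (sg s, Bos s, m + k)
  | gJ s, Bos s' => if s' == s then (0, x, k) else (1, Bos s, m + k)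
  | gG s, Bos s' => if s' == s then (0, Fer true, k)
                    else (sg s, Fer true, m + k - 1)
  | gG s, Fer false => (1, Bos s, m + k)
  | gG s, Fer true => (0, Bos s, k)
  | gGbar s, Bos s' => if s' == s then (0, Fer true, k)
      else (- ((m + k - 1)%:~R + 2^-1), Fer false, m + k - 1)
  | gGbar s, Fer true => (sg s * (k%:~R + 2^-1), Bos s, m + k)
  | gGbar s, Fer false => (0, Bos s, k)
  | _, _ => (0, x, k)
  end.

Definition ev (T : field -> int -> mode) x k v : fock :=
  (T x k).1.1 *: phi (T x k).1.2 (T x k).2 v.

Definition wf p (T : field -> int -> mode) :=
  forall x k, fpar (T x k).1.2 = p (+) fpar x.

Lemma tab_wf A m : wf (parity A) (tab A m).
Proof. by case: A => [||s|s|s] [s'|[]] k //=; case: eqP. Qed.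

Definition scom p q (A B : fock -> fock) v : fock :=
  A (B v) - (-1) ^+ (p && q) *: B (A v).

Lemma lin0 (A : fock -> fock) : linear A -> A 0 = 0.
Proof. by move=> lA; have := lA (-1) 0 0; rewrite scaler0 addr0 scaleN1r addNr. Qed.

Lemma linZ (A : fock -> fock) c v : linear A -> A (c *: v) = c *: A v.
Proof. by move=> lA; have := lA c v 0; rewrite (lin0 lA) !addr0. Qed.

Lemma linD (A : fock -> fock) u v : linear A -> A (u + v) = A u + A v.
Proof. by move=> lA; have := lA 1 u v; rewrite !scale1r. Qed.

Lemma scom_linear p q A B : linear A -> linear B -> linear (scom p q A B).
Proof.
by move=> lA lB c u v; rewrite /scom !(lA, lB); module.
Qed.

Lemma linear_comb c (A B : fock -> fock) :
  linear A -> linear B -> linear (fun v => A v + c *: B v).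
Proof.
by move=> lA lB a u v; rewrite lA lB; module.
Qed.

Lemma eq_derf p A B f g : derf p A f -> (forall v, A v = B v) ->
  (forall x k v, f x k v = g x k v) -> derf p B g.
Proof.
move=> [lA hA] AB fg; split=> [c u v|x k v]; first by rewrite -!AB lA.
by rewrite -!AB hA fg.
Qed.

(** The Jacobi identity: the bracket of two operators acts on the modes as the bracket of their
    actions. The conditions [wf] give the parity of the field produced by the first action. *)
Lemma scom_derf p q A B T U : wf p T -> wf q U -> derf p A (ev T) -> derf q B (ev U) ->
  derf (p (+) q) (scom p q A B) (fun x k v =>
    (U x k).1.1 *: ev T (U x k).1.2 (U x k).2 v
    - (-1) ^+ (p && q) *: ((T x k).1.1 *: ev U (T x k).1.2 (T x k).2 v)).
Proof.
move=> wT wU [lA hA] [lB hB]; split=> [|x k v]; first exact: scom_linear.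
rewrite /scom hA hB !(linD _ _ lA, linD _ _ lB, linZ _ _ lA, linZ _ _ lB).
rewrite !hA !hB wT wU !(phiD, phiN, phiZ) /ev.
to_coeff; move: (T _ _).1.1 (U _ _).1.1 (T _ _).1.1 (U _ _).1.1 => *.
by case: p {wT hA}; case: q {wU hB}; case: (fpar x); rewrite /= ?expr0 ?expr1; ring.
Qed.

Lemma phi_idx t j i v : i = j -> phi t i v = phi t j v.
Proof. by move=> ->. Qed.

Ltac same_idx := repeat match goal with |- context [phi ?t ?j ?v] =>
  match goal with |- context [phi t ?i v] =>
    lazymatch i with j => fail | _ => rewrite (@phi_idx t j i v); [| by lia] end end end.

Lemma Jpm_derf s n : derf false (Jpm s n) (ev (tab (gJ s) n)).
Proof.
have e : om0 K (Bos s) (Bos s) = 0 by case: s.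
apply: eq_derf (bil_derf _ n e) _ _ => // {e}.
move=> [s'|s'] k v; case: s; case: s'; rewrite /ev /om0 /pole /sg /= ?expr0; same_idx;
  to_coeff; by field.
Qed.

Lemma Gpm_derf s n : derf true (Gpm s n) (ev (tab (gG s) n)).
Proof.
have e : om0 K (Bos s) (Fer true) = 0 by case: s.
apply: eq_derf (bil_derf _ (n - 1) e) _ _ => // {e}.
move=> [s'|s'] k v; case: s; case: s'; rewrite /ev /om0 /pole /sg /= ?expr0 ?expr1;
  same_idx; to_coeff; by field.
Qed.

Lemma Gbpm_derf s n : derf true (Gbpm s n) (ev (tab (gGbar s) n)).
Proof.
have e : om0 K (Bos s) (Fer false) = 0 by case: s.
apply: eq_derf (bil_derf _ (n - 1) e) _ _ => // {e}.
move=> [s'|s'] k v; case: s; case: s'; rewrite /ev /om0 /pole /sg /= ?expr0 ?expr1;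
  same_idx; to_coeff; by field.
Qed.

Lemma Jz_derf n : derf false (Jz n) (ev (tab gJ0 n)).
Proof.
apply: eq_derf (scom_derf (tab_wf (gJ true) 0) (tab_wf (gJ false) n)
  (Jpm_derf true 0) (Jpm_derf false n)) _ _ => [v|[s|s] k v].
- by rewrite /scom /Jz (svalP Jz_key) /= expr0 scale1r.
- by case: s; rewrite /ev /sg /= ?expr0; same_idx; to_coeff; ring.
- by rewrite /ev /=; to_coeff; ring.
Qed.

Lemma derf_comb p c A B f g : derf p A f -> derf p B g ->
  derf p (fun v => A v + c *: B v) (fun x k v => f x k v + c *: g x k v).
Proof.
move=> [lA hA] [lB hB]; split=> [|x k v]; first exact: linear_comb.
by rewrite hA hB phiD phiZ; module.
Qed.

Lemma Lz_derf n : derf false (Lz n) (ev (tab gL n)).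
Proof.
apply: eq_derf (derf_comb (n%:~R / 2) (scom_derf (tab_wf (gG true) 0)
  (tab_wf (gGbar false) n) (Gpm_derf true 0) (Gbpm_derf false n)) (Jz_derf (n - 1))) _ _
  => [v|[s|s] k v].
- by rewrite /scom /Lz (svalP Lz_key) /= expr1 scaleN1r opprK.
- by case: s; rewrite /ev /sg /= ?expr1; same_idx; to_coeff; by field.
- by case: s; rewrite /ev /sg /= ?expr1; same_idx; to_coeff; by field.
Qed.

Lemma cur_derf A m : derf (parity A) (cur A m) (ev (tab A m)).
Proof.
case: A => [||s|s|s]; [exact: Lz_derf|exact: Jz_derf|exact: Jpm_derf
 |exact: Gpm_derf|exact: Gbpm_derf].
Qed.

Lemma cur_linear A m : linear (cur A m).
Proof. by case: (cur_derf A m). Qed.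

HB.instance Definition _ A m :=
  GRing.isLinear.Build K fock fock *:%R (cur A m) (cur_linear A m).

Definition curdeg (A : gen) (m : int) : grade :=
  match A with
  | gL => (- ((m - 1) *+ 2), 0, 0)
  | gJ0 => (- (m *+ 2), 0, 0)
  | gJ s => (- (m *+ 2), if s then 2 else - 2, 0)
  | gG s => (- (m *+ 2 - 1), if s then 1 else -1, 1)
  | gGbar s => (- (m *+ 2 - 1), if s then 1 else -1, -1)
  end.

Lemma ofdeg_comp d d' e (A B : fock -> fock) :
  ofdeg d A -> ofdeg d' B -> d' + d = e -> ofdeg e (fun v => A (B v)).
Proof. by move=> hA hB <- f v hv; rewrite addrA; apply/hA/hB. Qed.

Lemma cur_ofdeg A m : ofdeg (curdeg A m) (cur A m).
Proof.
have hJ s n : ofdeg (curdeg (gJ s) n) (Jpm s n).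
  apply: bil_ofdeg => [|i]; first by case: s.
  by case: s; apply: gradeP => //=; lia.
have hG s n : ofdeg (curdeg (gG s) n) (Gpm s n).
  apply: bil_ofdeg => [|i]; first by case: s.
  by case: s; apply: gradeP => //=; lia.
have hGb s n : ofdeg (curdeg (gGbar s) n) (Gbpm s n).
  apply: bil_ofdeg => [|i]; first by case: s.
  by case: s; apply: gradeP => //=; lia.
have hJ0 n : ofdeg (curdeg gJ0 n) (Jz n).
  move=> e v hv; rewrite /Jz (svalP Jz_key); apply: homogB.
    by apply: (ofdeg_comp (hJ true 0) (hJ false n)) hv; apply: gradeP => //=; lia.
  by apply: (ofdeg_comp (hJ false n) (hJ true 0)) hv; apply: gradeP => //=; lia.
case: A => [||s|s|s]; [|exact: hJ0|exact: hJ|exact: hG|exact: hGb].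
move=> e v hv; rewrite /cur /Lz (svalP Lz_key); apply: homogD; first apply: homogD.
- by apply: (ofdeg_comp (hG true 0) (hGb false m)) hv; apply: gradeP => //=; lia.
- by apply: (ofdeg_comp (hGb false m) (hG true 0)) hv; apply: gradeP => //=; lia.
- by apply: homogZ; rewrite (_ : curdeg gL m = curdeg gJ0 (m - 1)) //; apply: hJ0.
Qed.

(* The non-central part of the bracket of the modes m of A and n of B. *)
Definition rhs (A B : gen) (m n : int) : option (seq (K * gen * int)) :=
  match A, B with
  | gL, gL => Some [:: ((m - n)%:~R, gL, m + n - 1)]
  | gL, gJ0 => Some [:: (- n%:~R, gJ0, m + n - 1)]
  | gL, gJ s => Some [:: (- n%:~R, gJ s, m + n - 1)]
  | gL, gG s => Some [:: (m%:~R / 2 - n%:~R, gG s, m + n - 1)]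
  | gL, gGbar s => Some [:: (m%:~R / 2 - n%:~R, gGbar s, m + n - 1)]
  | gJ0, gJ0 => Some [::]
  | gJ0, gJ s => Some [:: (sg s * 2, gJ s, m + n)]
  | gJ0, gG s => Some [:: (sg s, gG s, m + n)]
  | gJ0, gGbar s => Some [:: (sg s, gGbar s, m + n)]
  | gJ true, gJ false => Some [:: (1, gJ0, m + n)]
  | gJ false, gJ true => None
  | gJ _, gJ _ => Some [::]
  | gJ s, gG s' => if s == s' then Some [::] else Some [:: (1, gG s, m + n)]
  | gJ s, gGbar s' => if s == s' then Some [::] else Some [:: (-1, gGbar s, m + n)]
  | gG _, gG _ => Some [::]
  | gGbar _, gGbar _ => Some [::]
  | gG s, gGbar s' =>
      if s == s' then Some [:: ((m - n)%:~R, gJ s, m + n - 1)]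
      else Some [:: (1, gL, m + n); (sg s * (m - n)%:~R / 2, gJ0, m + n - 1)]
  | _, _ => None
  end.

Definition rhsv (r : seq (K * gen * int)) v : fock :=
  \sum_(t <- r) t.1.1 *: cur t.1.2 t.2 v.

(** The right-hand side acts on the modes exactly as [scom_derf] says that the bracket of the two
    currents does. Both sides therefore differ by an operator to which Schur's lemma applies. *)
Lemma rhs_derf A B m n r : rhs A B m n = Some r ->
  derf (parity A (+) parity B) (rhsv r) (fun x k v =>
    (tab B n x k).1.1 *: ev (tab A m) (tab B n x k).1.2 (tab B n x k).2 v
    - (-1) ^+ (parity A && parity B) *:
      ((tab A m x k).1.1 *: ev (tab B n) (tab A m x k).1.2 (tab A m x k).2 v)).
Proof.
have d0 p : derf p (fun _ : fock => 0 : fock) (fun _ _ _ => 0).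
  by split=> [c u v|x k v]; [rewrite scaler0 addr0 | rewrite linear0 scaler0 addr0].
have dS p a C j r' f : parity C = p -> derf p (rhsv r') f ->
    derf p (rhsv ((a, C, j) :: r')) (fun x k v => f x k v + a *: ev (tab C j) x k v).
  move=> <- h; apply: eq_derf (derf_comb a h (cur_derf C j)) _ _ => // v.
  by rewrite /rhsv big_cons addrC.
have dnil p : derf p (rhsv [::]) (fun _ _ _ => 0).
  by apply: eq_derf (d0 p) _ _ => // v; rewrite /rhsv big_nil.
by case: A => [||s|s|s]; case: B => [||s'|s'|s'];
  try case: s; try case: s'; rewrite /rhs //= => -[<-];
  (match goal with |- derf ?p ?D _ => eapply (@eq_derf p D D) end;
     [first [exact: dnil | eapply dS; [reflexivity | exact: dnil]
           | eapply dS; [reflexivity | eapply dS; [reflexivity | exact: dnil]]] | by [] | ]);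
  move=> [[]|[]] k v; rewrite /ev /sg /= ?expr0 ?expr1; same_idx; to_coeff; by field.
Qed.

Lemma JzE n v :
  Jz n v = cur (gJ true) 0 (cur (gJ false) n v) - cur (gJ false) n (cur (gJ true) 0 v).
Proof. exact: (svalP Jz_key). Qed.

Lemma LzE n v : Lz n v = cur (gG true) 0 (cur (gGbar false) n v)
  + cur (gGbar false) n (cur (gG true) 0 v) + (n%:~R / 2) *: cur gJ0 (n - 1) v.
Proof. exact: (svalP Lz_key). Qed.

Lemma JpmE s n v : cur (gJ s) n v =
  lsum (fun i => (sg s / 2) *: phi (Bos s) i (phi (Bos s) (n - i) v)).
Proof. by []. Qed.

End Currents.

Arguments cur : simpl never.

(** * Central terms from the Jacobi identity *)

Section CentralTerms.
Variable K : numFieldType.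
Notation fock := (fock K).
Implicit Types (u v w : fock) (k m n i : int) (p q s : bool) (A B : gen).

Lemma curD A m u v : cur A m (u + v) = cur A m u + cur A m v.
Proof. exact: linearD. Qed.

Lemma curZ A m (c : K) v : cur A m (c *: v) = c *: cur A m v.
Proof. exact: linearZ. Qed.

Lemma grade_neq0 (d : grade) :
  [|| d.1.1 != 0, d.1.2 != 0 | d.2 != 0] -> d != 0.
Proof. by apply: contraTneq => ->. Qed.

Lemma rhsv0 v : rhsv [::] v = 0.
Proof. by rewrite /rhsv big_nil. Qed.

Lemma rhsv1 (c : K) A m v : rhsv [:: (c, A, m)] v = c *: cur A m v.
Proof. by rewrite /rhsv big_cons big_nil addr0. Qed.

Lemma rhsv2 (c d : K) A B m n v :
  rhsv [:: (c, A, m); (d, B, n)] v = c *: cur A m v + d *: cur B n v.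
Proof. by rewrite /rhsv !big_cons big_nil addr0. Qed.

Lemma rhsv_ofdeg A B m n r : rhs K A B m n = Some r ->
  ofdeg (curdeg B n + curdeg A m) (rhsv r).
Proof.
have dS d a C j r' : curdeg C j = d -> ofdeg d (@rhsv K r') ->
    ofdeg d (rhsv ((a, C, j) :: r')).
  move=> <- h e v hv; rewrite /rhsv big_cons; apply: homogD (h _ _ hv).
  exact/homogZ/cur_ofdeg.
have dnil d : ofdeg d (@rhsv K [::]) by move=> e v hv; rewrite rhsv0; apply: homog0.
by case: A => [||s|s|s]; case: B => [||s'|s'|s']; try case: s; try case: s';
  rewrite /rhs //= => -[<-]; repeat (apply: (dS); [by apply: gradeP => //=; lia|]);
  exact: dnil.
Qed.

Definition br A B m n v : fock :=
  scom (parity A) (parity B) (cur A m) (cur B n) v.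

Lemma br_even A B m n v : parity A = false ->
  br A B m n v = cur A m (cur B n v) - cur B n (cur A m v).
Proof. by rewrite /br /scom => ->; rewrite /= expr0 scale1r. Qed.

Lemma br_odd A B m n v : parity A -> parity B ->
  br A B m n v = cur A m (cur B n v) + cur B n (cur A m v).
Proof. by rewrite /br /scom => -> ->; rewrite expr1 scaleN1r opprK. Qed.

Definition kap A B m n : K :=
  coeff occ0 (br A B m n (vac K) - rhsv (odflt [::] (rhs K A B m n)) (vac K)).

(** The bracket minus its non-central part supercommutes with all modes. Schur's lemma makes it the
    scalar [kap], which is 0 unless the total degree is 0. *)
Lemma brE A B m n r : rhs K A B m n = Some r ->
  (forall v, br A B m n v = rhsv r v + kap A B m n *: v) /\
  (curdeg B n + curdeg A m != 0 -> kap A B m n = 0).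
Proof.
move=> e; set d := curdeg B n + _.
pose D v := br A B m n v + (-1) *: rhsv r v.
have hD : derf (parity A (+) parity B) D (fun _ _ _ => 0).
  apply: eq_derf (derf_comb (-1) (scom_derf (tab_wf K A m) (tab_wf K B n)
    (cur_derf K A m) (cur_derf K B n)) (rhs_derf e)) _ _ => //.
  by move=> x k v; rewrite scaleN1r addrN.
have hdeg : homog d (D (vac K)).
  have hv : homog (0 : grade) (vac K) by rewrite -deg0; apply: homog_ket.
  apply: homogD; last by apply: homogZ; rewrite -[d]add0r; apply: (rhsv_ofdeg e).
  apply: homogB; first by rewrite /d -[_ + _]add0r addrA; apply/cur_ofdeg/cur_ofdeg.
  apply: homogZ; rewrite /d [_ + curdeg A m]addrC -[_ + _]add0r addrA.
  exact/cur_ofdeg/cur_ofdeg.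
have kE : kap A B m n = coeff occ0 (D (vac K)) by rewrite /kap e /D scaleN1r.
have brD v : br A B m n v = rhsv r v + D v by rewrite /D scaleN1r addrC subrK.
have [d0|d0] := eqVneq d 0; last first.
  have D0 := schur hD hdeg d0.
  rewrite kE D0 coeff0; split=> // v; by rewrite brD D0 scale0r.
split=> // v; rewrite brD kE; congr (_ + _).
(* An odd bracket changes the fermion number by an odd amount, so that its degree cannot be 0. *)
suff pE : parity A (+) parity B = false by rewrite pE in hD; apply: schur0.
by move: d0; rewrite /d {D hD hdeg kE brD d e r}; case: A => [||s|s|s]; case: B => [||s'|s'|s'] //=.
Qed.

Lemma brE0 A B m n r v : rhs K A B m n = Some r -> curdeg B n + curdeg A m != 0 ->
  br A B m n v = rhsv r v.
Proof. by move=> /brE[h h0] /h0 e; rewrite h e scale0r addr0. Qed.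

Lemma scom_jac p q (X A B : fock -> fock) v : linear X -> linear A -> linear B ->
  X (scom p q A B v) - scom p q A B (X v) =
  scom p q (scom false p X A) B v + scom p q A (scom false q X B) v.
Proof.
move=> lX lA lB; rewrite /scom /= expr0 !scale1r.
have lN (Y : fock -> fock) u : linear Y -> Y (- u) = - Y u.
  by move=> lY; rewrite -scaleN1r linZ // scaleN1r.
rewrite !(linD _ _ lX, linD _ _ lA, linD _ _ lB, lN _ _ lX, lN _ _ lA, lN _ _ lB,
  linZ _ _ lX).
module.
Qed.

Lemma scomZl p q (c : K) (A B : fock -> fock) v : linear B ->
  scom p q (fun v => c *: A v) B v = c *: scom p q A B v.
Proof. by move=> lB; rewrite /scom (linZ _ _ lB); module. Qed.

Lemma scomZr p q (c : K) (A B : fock -> fock) v : linear A ->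
  scom p q A (fun v => c *: B v) v = c *: scom p q A B v.
Proof. by move=> lB; rewrite /scom (linZ _ _ lB); module. Qed.

Lemma eq_scom p q (A A' B B' : fock -> fock) v : A =1 A' -> B =1 B' ->
  scom p q A B v = scom p q A' B' v.
Proof. by move=> hA hB; rewrite /scom !hA !hB. Qed.

(** The Jacobi identity with an even [C], in the form that carries central terms from one pair of
    currents to another. *)
Lemma br_jac C A B k m n a b A' B' m' n' v : parity C = false ->
  parity A' = parity A -> parity B' = parity B ->
  (forall v, br C A k m v = a *: cur A' m' v) ->
  (forall v, br C B k n v = b *: cur B' n' v) ->
  cur C k (br A B m n v) - br A B m n (cur C k v) =
  a *: br A' B m' n v + b *: br A B' m n' v.
Proof.
move=> pC pA pB hA hB; rewrite /br scom_jac; try exact: cur_linear.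
rewrite pA pB -scomZl; last exact: cur_linear.
rewrite -scomZr; last exact: cur_linear.
congr (_ + _); apply: eq_scom => // u.
  by rewrite -hA /br pC.
by rewrite -hB /br pC.
Qed.

Lemma vac_scale_inj (a b : K) : a *: vac K = b *: vac K -> a = b.
Proof. by move/(congr1 (coeff occ0)); rewrite !coeffZ coeff_ket eqxx !mulr1. Qed.

Lemma brJ0J s k m v : br gJ0 (gJ s) k m v = (sg K s * 2) *: cur (gJ s) (k + m) v.
Proof.
rewrite (@brE0 gJ0 (gJ s) k m _ _ erefl) ?rhsv1 //.
by apply: grade_neq0; case: s; rewrite /= orbT.
Qed.

Let kJ m := kap (gJ true) (gJ false) m (- m).

Lemma brJJ m n v : br (gJ true) (gJ false) m n v =
  cur gJ0 (m + n) v + kap (gJ true) (gJ false) m n *: v.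
Proof. by have [-> _] := @brE (gJ true) (gJ false) m n _ erefl; rewrite rhsv1 scale1r. Qed.

(** There is no central term here, since [J^0_n] is defined as this very bracket. *)
Lemma kJ0 n : kap (gJ true) (gJ false) 0 n = 0.
Proof.
apply: vac_scale_inj; have := brJJ 0 n (vac K).
rewrite br_even // -JzE add0r -[LHS]addr0 => /addrI <-.
by rewrite scale0r.
Qed.

Lemma brJ0J0 k m v : br gJ0 gJ0 k m v = kap gJ0 gJ0 k m *: v.
Proof. by have [-> _] := @brE gJ0 gJ0 k m _ erefl; rewrite rhsv0 add0r. Qed.

(** The scalar part of the Jacobi identity for [J^0_k], [J^+_m] and [J^-_{-m-k}]; all other terms
    are modes of [J^0] and cancel. *)
Lemma kJ_step m k : kJ (m + k) = kJ m + kap gJ0 gJ0 k (- k) / 2.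
Proof.
have := @br_jac gJ0 (gJ true) (gJ false) k m (- (m + k)) _ _ (gJ true) (gJ false)
  _ _ (vac K) erefl erefl erefl (brJ0J true k m) (brJ0J false k (- (m + k))).
rewrite !brJJ curD curZ.
rewrite (_ : m - (m + k) = - k); last by lia.
rewrite (_ : k - (m + k) = - m); last by lia.
rewrite (_ : m - m = 0); last by lia.
rewrite (_ : k + m - (m + k) = 0); last by lia.
have := brJ0J0 k (- k) (vac K); rewrite br_even // => e e'.
have {e e'} : kap gJ0 gJ0 k (- k) *: vac K = (2 * kJ (m + k) - 2 * kJ m) *: vac K.
  rewrite -e /kJ; move: e'; rewrite /sg (addrC k m).
  move: (kap _ _ m (- m)) (kap _ _ (m + k) _) (kap _ _ m _) => y z x e'.
  transitivity (cur gJ0 k (cur gJ0 (- k) (vac K)) + x *: cur gJ0 k (vac K) -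
    (cur gJ0 (- k) (cur gJ0 k (vac K)) + x *: cur gJ0 k (vac K))); first by module.
  by rewrite e'; module.
by move/vac_scale_inj => ->; field.
Qed.

Lemma phi_phi_vac_ann t x k m : om0 K t x = 0 -> ann t k ->
  phi t k (phi x m (vac K)) = 0.
Proof. by move=> e a; rewrite phi_swap // phi_vac // linear0 scaler0. Qed.

Lemma Jp_vac n : 0 <= n -> cur (gJ true) n (vac K) = 0.
Proof.
move=> n0; rewrite JpmE; apply: lsum0 => i; have [i0|i0] := leP 0 i.
  by rewrite phi_phi_vac_ann ?scaler0.
by rewrite [phi _ (n - i) _]phi_vac ?linear0 ?scaler0 //= /bann; lia.
Qed.

Lemma Jm_vac n (N : nat) : n = - N%:Z -> cur (gJ false) n (vac K) =
  - 2^-1 *: \sum_(j < N.+1) phi (Bos false) (- j%:Z) (phi (Bos false) (j%:Z - N%:Z) (vac K)).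
Proof.
move=> ->; rewrite JpmE -(lsum_refl 0) (@lsum_window _ 0 N.+1) => [|i i0|i iN].
- rewrite scaler_sumr; apply: eq_bigr => j _.
  rewrite (_ : 0 - (0 + j%:Z) = - j%:Z); last by lia.
  rewrite (_ : - N%:Z - - j%:Z = j%:Z - N%:Z); last by lia.
  by rewrite /sg mulN1r.
- by rewrite phi_phi_vac_ann ?scaler0 //= /bann; lia.
- by rewrite [phi _ (_ - (0 - i)) _]phi_vac ?linear0 ?scaler0 //= /bann; lia.
Qed.

Lemma Jp_bm n k v : cur (gJ true) n (phi (Bos false) k v) =
  phi (Bos false) k (cur (gJ true) n v) + phi (Bos true) (n + k) v.
Proof. by have [_ ->] := cur_derf K (gJ true) n; rewrite /= expr0 /ev /= !scale1r. Qed.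

Lemma bp_bm m n v : phi (Bos true) m (phi (Bos false) n v) =
  phi (Bos false) n (phi (Bos true) m v) + (m + n == 0)%:R *: v.
Proof. by rewrite phi_comm /= expr0 scale1r. Qed.

Lemma bp_vac n : 0 <= n -> phi (Bos true) n (vac K) = 0.
Proof. by move=> h; apply: phi_vac. Qed.

Lemma Jz0_vac : Jz 0 (vac K) = - 2^-1 *: vac K.
Proof.
rewrite JzE Jp_vac // linear0 subr0.
rewrite (@Jm_vac 0 0) // big_ord_recr big_ord0 curZ /= add0r oppr0.
by rewrite !Jp_bm Jp_vac // linear0 !add0r bp_bm bp_vac // linear0 !add0r eqxx scale1r.
Qed.

(** The one central term that is computed directly: [J^+_1 J^-_{-1} vac] is minus the vacuum, while
    [J^0_0] has eigenvalue -1/2 there. *)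
Lemma kJ1 : kJ 1 = - 2^-1.
Proof.
apply: vac_scale_inj; have := brJJ 1 (-1) (vac K).
rewrite br_even // Jp_vac // linear0 subr0 addrN.
rewrite [cur gJ0 0 _]Jz0_vac (@Jm_vac (-1) 1) // !big_ord_recr big_ord0 curZ /= add0r curD.
rewrite !Jp_bm Jp_vac // !linear0 !add0r !bp_bm !bp_vac // !linear0 !add0r /=.
rewrite ?scale0r ?scale1r ?linear0 ?add0r ?addr0 /kJ => e.
transitivity (- 2^-1 *: (vac K + vac K) - (- 2^-1 *: vac K)); last by module.
by rewrite e; module.
Qed.

(** By [kJ_step] the function [kJ] is additive, hence fixed by its value at 1, which is c/6 for c =
    -3. *)
Lemma kJE m n : m + n = 0 -> kap (gJ true) (gJ false) m n = - (m%:~R / 2).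
Proof.
move=> mn; have -> : n = - m by lia.
rewrite -/(kJ m); have kJ0' : kJ 0 = 0 by apply: kJ0.
have kD a b : kJ (a + b) = kJ a + kJ b.
  have := kJ_step 0 b; rewrite add0r kJ0' add0r => e.
  by rewrite kJ_step -e.
have kN a : kJ (- a) = - kJ a.
  by apply/eqP; rewrite -addr_eq0 -kD addNr kJ0'.
have kn (a : nat) : kJ a%:Z = - (a%:R / 2).
  elim: a => [|a IH]; first by rewrite kJ0' mul0r oppr0.
  by rewrite -[a.+1]addn1 PoszD kD IH kJ1 natrD; field.
by case: m {mn} => a; rewrite ?NegzE ?kN kn // intrN mulNr.
Qed.

Lemma kJ0E m n : m + n = 0 -> kap gJ0 gJ0 m n = - m%:~R.
Proof.
move=> mn; have -> : n = - m by lia.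
have := kJ_step 0 m; rewrite add0r [kJ 0]kJ0 add0r /kJ kJE ?addrN // => e.
by rewrite -[LHS](mulfVK (x := 2)) ?pnatr_eq0 // -e; field.
Qed.

Lemma brJ0Jz k m v : br gJ0 gJ0 k m v = (- (k%:~R * (k + m == 0)%:R)) *: v.
Proof.
rewrite brJ0J0; congr (_ *: _); case: eqP => [/kJ0E ->|h]; first by rewrite mulr1.
have [_ ->] := @brE gJ0 gJ0 k m _ erefl; first by rewrite mulr0 oppr0.
by apply/eqP => /= -[]; lia.
Qed.

Lemma brJ0G k (s : bool) m v : br gJ0 (gG s) k m v = sg K s *: cur (gG s) (k + m) v.
Proof.
rewrite (@brE0 gJ0 (gG s) k m _ _ erefl) ?rhsv1 //.
by apply: grade_neq0; rewrite /= !orbT.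
Qed.

Lemma brJ0Gb k (s : bool) m v :
  br gJ0 (gGbar s) k m v = sg K s *: cur (gGbar s) (k + m) v.
Proof.
rewrite (@brE0 gJ0 (gGbar s) k m _ _ erefl) ?rhsv1 //.
by apply: grade_neq0; rewrite /= !orbT.
Qed.

Lemma brLJ s k m v : br gL (gJ s) k m v = (- m%:~R) *: cur (gJ s) (k + m - 1) v.
Proof.
rewrite (@brE0 gL (gJ s) k m _ _ erefl) ?rhsv1 //.
by apply: grade_neq0; case: s; rewrite /= orbT.
Qed.

Lemma brLG s k m v :
  br gL (gG s) k m v = (k%:~R / 2 - m%:~R) *: cur (gG s) (k + m - 1) v.
Proof.
rewrite (@brE0 gL (gG s) k m _ _ erefl) ?rhsv1 //.
by apply: grade_neq0; rewrite /= !orbT.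
Qed.

Lemma brLGb s k m v :
  br gL (gGbar s) k m v = (k%:~R / 2 - m%:~R) *: cur (gGbar s) (k + m - 1) v.
Proof.
rewrite (@brE0 gL (gGbar s) k m _ _ erefl) ?rhsv1 //.
by apply: grade_neq0; rewrite /= !orbT.
Qed.

Lemma brJ_G k m v : br (gJ false) (gG true) k m v = 1 *: cur (gG false) (k + m) v.
Proof.
rewrite (@brE0 (gJ false) (gG true) k m _ _ erefl) ?rhsv1 //.
by apply: grade_neq0; rewrite /= !orbT.
Qed.

Lemma brJ_Gb k m v : br (gJ false) (gGbar true) k m v = -1 *: cur (gGbar false) (k + m) v.
Proof.
rewrite (@brE0 (gJ false) (gGbar true) k m _ _ erefl) ?rhsv1 //.
by apply: grade_neq0; rewrite /= !orbT.
Qed.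

Lemma brGGb s m n v :
  br (gG s) (gGbar s) m n v = (m - n)%:~R *: cur (gJ s) (m + n - 1) v.
Proof.
rewrite (@brE0 (gG s) (gGbar s) m n [:: ((m - n)%:~R, gJ s, m + n - 1)]) ?rhsv1 //.
  by case: s.
by apply: grade_neq0; case: s; rewrite /= orbT.
Qed.

Lemma brJJE m n v : br (gJ true) (gJ false) m n v =
  cur gJ0 (m + n) v - (m%:~R / 2 * (m + n == 0)%:R) *: v.
Proof.
rewrite brJJ -scaleNr; congr (_ + _ *: _); case: eqP => [/kJE ->|h].
  by rewrite mulr1.
have [_ ->] := @brE (gJ true) (gJ false) m n _ erefl; first by rewrite mulr0 oppr0.
by apply: grade_neq0; rewrite /=; lia.
Qed.

(** [J^0_m] is the bracket of [J^+_0] and [J^-_m], and [L_(k)] commutes with the first of these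
    two. *)
Lemma brLJ0 k m v : br gL gJ0 k m v = (- m%:~R) *: cur gJ0 (k + m - 1) v.
Proof.
rewrite br_even //; have eJ j u : cur gJ0 j u = br (gJ true) (gJ false) 0 j u.
  by rewrite brJJE mul0r mul0r scale0r subr0 add0r.
rewrite !eJ (br_jac (A' := gJ true) (B' := gJ false) _ _ _ _
  (brLJ true k 0) (brLJ false k m)) // oppr0 scale0r add0r; congr (_ *: br _ _ _ _ _).
Qed.

Let kG m n : K := kap (gG true) (gGbar false) m n.

Lemma brGGb0 m n v : br (gG true) (gGbar false) m n v = cur gL (m + n) v
  + ((m - n)%:~R / 2) *: cur gJ0 (m + n - 1) v + kG m n *: v.
Proof.
by have [-> _] := @brE (gG true) (gGbar false) m n _ erefl;
  rewrite rhsv2 scale1r /sg mul1r.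
Qed.

Lemma kG0 n : kG 0 n = 0.
Proof.
apply: vac_scale_inj; have := brGGb0 0 n (vac K); rewrite br_odd // [cur gL _ _]LzE !add0r.
set a := cur (gG true) 0 _; set b := cur (gGbar false) _ _; set c := cur gJ0 _ _.
move=> e; transitivity (a + b - (a + b + (n%:~R / 2) *: c) + (n%:~R / 2) *: c); last by module.
by rewrite [X in X - _]e rmorphN /=; module.
Qed.

(** Bracketing [J^0_m] with the pair [G^+_(0)], [Gbar^-_(n)] expresses the wanted bracket by one
    with first index 0, which has no central term, and by the known brackets of [J^0] with [L] and
    with itself. *)
Lemma kGE m n : m + n = 1 -> kG m n = - (m%:~R * (m%:~R - 1) / 2).
Proof.
move=> mn; pose v := vac K.
have := @br_jac gJ0 (gG true) (gGbar false) m 0 n _ _ (gG true) (gGbar false)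
  _ _ v erefl erefl erefl (brJ0G m true 0) (brJ0Gb m false n).
rewrite !brGGb0 !curD !curZ !kG0 !addr0 !add0r.
have := brLJ0 (n : int) m v; have := brJ0Jz m (n - 1) v; rewrite !br_even // => e1 e2.
rewrite (_ : n + m - 1 = 0) in e2; last by lia.
rewrite (_ : (m + (n - 1) == 0) = true) ?mulr1 in e1; last by lia.
rewrite (_ : m + n - 1 = 0); last by lia.
rewrite mn; move: e1 e2 => /(canRL (subrK _)) e1 /(canRL (subrK _)) e2.
rewrite e1 e2 => e; apply: vac_scale_inj.
move: e; have -> : n = 1 - m by lia.
rewrite -/v /sg.
set k := kG _ _; set X := (X in X = _ -> _); set Y := (X in _ = X -> _) => XY.
transitivity (X - (Y - k *: v)); first by rewrite XY; module.
rewrite /X /Y !(rmorphN, rmorphB, rmorph1) /=; to_coeff; by field.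
Qed.

Lemma brGGbE m n v : br (gG true) (gGbar false) m n v = cur gL (m + n) v
  + ((m - n)%:~R / 2) *: cur gJ0 (m + n - 1) v
  - (m%:~R * (m%:~R - 1) / 2 * (m + n == 1)%:R) *: v.
Proof.
rewrite brGGb0 -scaleNr; congr (_ + _ *: _); case: eqP => [/kGE ->|h].
  by rewrite mulr1.
rewrite /kG; have [_ ->] := @brE (gG true) (gGbar false) m n _ erefl; first by rewrite mulr0 oppr0.
by apply: grade_neq0; rewrite /=; lia.
Qed.

(** Obtained by applying [J^-_0] to the bracket of [G^+] and [Gbar^+], which has no central term. *)
Lemma brGbGE m n v : br (gG false) (gGbar true) m n v = cur gL (m + n) v
  - ((m - n)%:~R / 2) *: cur gJ0 (m + n - 1) v
  - (m%:~R * (m%:~R - 1) / 2 * (m + n == 1)%:R) *: v.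
Proof.
have := @br_jac (gJ false) (gG true) (gGbar true) 0 m n _ _ (gG false) (gGbar false)
  _ _ v erefl erefl erefl (brJ_G 0 m) (brJ_Gb 0 n).
rewrite !brGGb curZ -scalerBr !add0r.
have := brJJE (m + n - 1) 0 v; rewrite addr0 br_even // => e.
have -> : cur (gJ false) 0 (cur (gJ true) (m + n - 1) v) -
    cur (gJ true) (m + n - 1) (cur (gJ false) 0 v) = - cur gJ0 (m + n - 1) v.
  have e0 : ((m + n - 1)%:~R / 2 * (m + n - 1 == 0)%:R) = 0 :> K.
    by case: eqP => [->|_]; rewrite ?mul0r ?mulr0.
  by rewrite -opprB e e0 scale0r subr0.
rewrite scale1r => e1.
have -> : br (gG false) (gGbar true) m n v =
  (m - n)%:~R *: - cur gJ0 (m + n - 1) v + br (gG true) (gGbar false) m n v.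
  by rewrite e1; module.
by rewrite brGGbE; to_coeff; field.
Qed.

(** The second factor is replaced by its expression through [G^+_(0)], [Gbar^-_(n)] and [J^0], whose
    brackets with [L_(m)] are known. *)
Lemma brLL m n v : br gL gL m n v = (m - n)%:~R *: cur gL (m + n - 1) v
  - (m%:~R * (m%:~R - 1) * (m%:~R - 2) / 4 * (m + n == 2)%:R) *: v.
Proof.
have eL u : cur gL n u = br (gG true) (gGbar false) 0 n u + (n%:~R / 2) *: cur gJ0 (n - 1) u.
  rewrite brGGbE !(mul0r, scale0r) subr0 !add0r rmorphN /=; to_coeff; ring.
rewrite br_even // eL [in X in _ - X]eL curD curZ.
have := brLJ0 m (n - 1) v; rewrite br_even // => e1.
have := @br_jac gL (gG true) (gGbar false) m 0 n _ _ (gG true) (gGbar false)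
  _ _ v erefl erefl erefl (brLG true m 0) (brLGb false m n).
rewrite addr0 => e2.
set x := cur gL m (br _ _ _ _ _) in e2 *; set y := br _ _ _ _ _ in e2 *.
set z := cur gL m (cur gJ0 _ _) in e1 *; set w := cur gJ0 _ (cur gL m _) in e1 *.
transitivity ((x - y) + (n%:~R / 2) *: (z - w)); first by module.
rewrite e1 e2 !brGGbE !(rmorphN, rmorphB, rmorphD, rmorph1) /=.
rewrite (_ : m + n - 1 = m - 1 + n); last by lia.
rewrite (_ : m + (n - 1) - 1 = m - 1 + n - 1); last by lia.
rewrite (_ : (m - 1 + n == 1) = (m + n == 2)); last by lia.
rewrite !add0r; to_coeff; by field.
Qed.

End CentralTerms.

(** * Comparison with the table of brackets, and the parity of states *)

Section TableOfBrackets.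
Variable K : numFieldType.
Notation fock := (fock K).
Implicit Types (u v w : fock) (m n k : int).

Definition kfact n (j : nat) : K := \prod_(i < j) (n - i%:Z)%:~R.

Lemma kfact0 n : kfact n 0 = 1.
Proof. by rewrite /kfact big_ord0. Qed.

Lemma kfact1 n : kfact n 1 = n%:~R.
Proof. by rewrite /kfact big_ord_recr big_ord0 /= mul1r subr0. Qed.

Lemma kfact2 n : kfact n 2 = n%:~R * (n%:~R - 1).
Proof. by rewrite /kfact !big_ord_recr big_ord0 /= mul1r subr0 rmorphB. Qed.

Lemma kfact3 n : kfact n 3 = n%:~R * (n%:~R - 1) * (n%:~R - 2).
Proof. by rewrite /kfact !big_ord_recr big_ord0 /= mul1r subr0 !rmorphB. Qed.

Definition kterm : Type := (K * nat * nat * option gen)%type.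

Definition kfield (o : option gen) n v : fock :=
  if o is Some a then cur a n v else if n == -1 then v else 0.

Definition kder (l : nat) o n v : fock :=
  ((-1) ^+ l * kfact n l) *: kfield o (n - l%:Z) v.

Definition kbracket_mode (ts : seq kterm) m n v : fock :=
  \sum_(t <- ts) (t.1.1.1 * kfact m t.1.1.2) *:
    kder t.1.2 t.2 (m + n - t.1.1.2%:Z) v.

(* The bracket table at c = -3, over an arbitrary field. *)
Definition kbracket (a b : gen) : option (seq kterm) :=
  match a, b with
  | gL, gL => Some [:: (1, 0%N, 1%N, Some gL); (2, 1%N, 0%N, Some gL);
                       (- 3 / 12, 3%N, 0%N, None)]
  | gL, _ => Some [:: (1, 0%N, 1%N, Some b);
      (match b with gL => 2 | gJ0 | gJ _ => 1 | _ => 3 / 2 end, 1%N, 0%N, Some b)]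
  | gJ0, gJ0 => Some [:: (- 3 / 3, 1%N, 0%N, None)]
  | gJ0, gJ s => Some [:: (sg K s * 2, 0%N, 0%N, Some (gJ s))]
  | gJ0, gG s => Some [:: (sg K s, 0%N, 0%N, Some (gG s))]
  | gJ0, gGbar s => Some [:: (sg K s, 0%N, 0%N, Some (gGbar s))]
  | gJ true, gJ false => Some [:: (1, 0%N, 0%N, Some gJ0);
                                  (- 3 / 6, 1%N, 0%N, None)]
  | gJ true, gG false => Some [:: (1, 0%N, 0%N, Some (gG true))]
  | gJ false, gG true => Some [:: (1, 0%N, 0%N, Some (gG false))]
  | gJ true, gGbar false => Some [:: (-1, 0%N, 0%N, Some (gGbar true))]
  | gJ false, gGbar true => Some [:: (-1, 0%N, 0%N, Some (gGbar false))]
  | gG s, gGbar t =>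
      if s == t then Some [:: (1, 0%N, 1%N, Some (gJ s));
                              (2, 1%N, 0%N, Some (gJ s))]
      else Some [:: (1, 0%N, 0%N, Some gL); (sg K s / 2, 0%N, 1%N, Some gJ0);
                    (sg K s, 1%N, 0%N, Some gJ0); (- 3 / 6, 2%N, 0%N, None)]
  | _, _ => None
  end.

Lemma kder0 o n v : kder 0 o n v = kfield o n v.
Proof. by rewrite /kder kfact0 expr0 mulr1 scale1r subr0. Qed.

Lemma kder1 o n v : kder 1 o n v = (- n%:~R) *: kfield o (n - 1) v.
Proof. by rewrite /kder kfact1 expr1 mulN1r. Qed.

Lemma if_scale (b : bool) v : (if b then v else 0) = b%:R *: v.
Proof. by case: b; rewrite ?scale1r ?scale0r. Qed.

Lemma cur_idx (A : gen) i j v : i = j -> cur A i v = cur A j v.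
Proof. by move=> ->. Qed.

Ltac same_cur := repeat match goal with |- context [cur ?A ?j ?v] =>
  match goal with |- context [cur A ?i v] =>
    lazymatch i with j => fail | _ => rewrite (@cur_idx A i j v); [| by lia] end end end.

Lemma brJG s m n v : br (gJ s) (gG (~~ s)) m n v = cur (gG s) (m + n) v.
Proof.
rewrite (@brE0 K (gJ s) (gG (~~ s)) m n [:: (1, gG s, m + n)]) ?rhsv1 ?scale1r //.
  by case: s.
by apply: grade_neq0; rewrite /= !orbT.
Qed.

Lemma brJGb s m n v : br (gJ s) (gGbar (~~ s)) m n v = - cur (gGbar s) (m + n) v.
Proof.
rewrite (@brE0 K (gJ s) (gGbar (~~ s)) m n [:: (-1, gGbar s, m + n)]) ?rhsv1 ?scaleN1r //.
  by case: s.
by apply: grade_neq0; rewrite /= !orbT.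
Qed.

Lemma br_kbracket a b ts m n v : kbracket a b = Some ts ->
  br a b m n v = kbracket_mode ts m n v.
Proof.
have e2 : (m + n - 3%:Z == -1) = (m + n == 2) by lia.
have e1 : (m + n - 2%:Z == -1) = (m + n == 1) by lia.
have e0 : (m + n - 1%:Z == -1) = (m + n == 0) by lia.
rewrite /kbracket_mode.
by case: a => [||s|s|s]; case: b => [||s'|s'|s']; try case: s; try case: s';
  rewrite /kbracket //= => -[<-]; rewrite ?big_cons ?big_nil /=
    ?(kder0, kder1, kfact0, kfact1, kfact2, kfact3) /= ?if_scale
    ?(e0, e1, e2, brLL, brLJ0, brLJ, brLG, brLGb, brJ0Jz, brJ0J, brJ0G, brJ0Gb, brJJE,
      brGGb, brGGbE, brGbGE)
  ?(brJG true, brJG false, brJGb true, brJGb false); same_cur;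
  rewrite /sg ?rmorphB ?rmorphD /=; to_coeff; field.
Qed.

Lemma br_nil a b m n v : rhs K a b m n = Some [::] ->
  curdeg b n + curdeg a m != 0 -> br a b m n v = 0.
Proof. by move=> e d; rewrite (brE0 v e d) rhsv0. Qed.

Lemma br_none a b m n v : kbracket a b = None -> kbracket b a = None ->
  br a b m n v = 0.
Proof.
have swap a' b' m' n' : parity a' = false -> br a' b' m' n' v = 0 -> br b' a' n' m' v = 0.
  move=> pa; rewrite br_even // /br /scom pa andbF expr0 scale1r => e.
  by rewrite -opprB e oppr0.
by case: a => [||[]|[]|[]]; case: b => [||[]|[]|[]] //= _ _;
  first [apply: br_nil; [reflexivity|]; apply: grade_neq0; rewrite /= ?orbT //
  | apply: swap => //; apply: br_nil; [reflexivity|]; apply: grade_neq0; rewrite /= ?orbT //].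
Qed.

(** The parity of the number of fermions, which is also that of the difference recorded in the
    degree. *)
Definition fpodd (b : occ) : bool := odd `|(deg b).2|.

Definition fsector p : set fock := [set v | forall b, coeff b v != 0 -> fpodd b = p].

Lemma fsector0 p : fsector p 0.
Proof. by move=> b; rewrite raddf0 eqxx. Qed.

Lemma fsectorP p c u v : fsector p u -> fsector p v -> fsector p (c *: u + v).
Proof.
move=> hu hv b.
rewrite coeffD coeffZ; have [->|/hu //] := eqVneq (coeff b u) 0.
by rewrite mulr0 add0r => /hv.
Qed.

Lemma fsector_homog d v : homog d v -> fsector (odd `|d.2|) v.
Proof. by move=> h b /h <-. Qed.

Lemma fsector_cur A m p v : fsector p v -> fsector (p (+) parity A) (cur A m v : fock).
Proof.
move=> hv; rewrite (fockE v) (raddf_sum (@cur K A m)) big_seq.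
pose Q := fsector (p (+) parity A); rewrite -/(Q _).
elim/big_ind: _ => // [|u w hu hw|b]; [exact: fsector0|by rewrite -[u]scale1r; apply: fsectorP|].
rewrite fsupP /= => /hv e; rewrite curZ -[_ *: _]addr0; apply: fsectorP; last exact: fsector0.
rewrite -e /fpodd.
suff -> : odd `|(deg b).2| (+) parity A = odd `|(deg b + curdeg A m).2|.
  by apply: fsector_homog; apply: cur_ofdeg; apply: homog_ket.
by move: (deg b) => [[d1 d2] d3]; case: A @Q => [||s|s|s] _ /=; lia.
Qed.

Definition fproj p (v : fock) : fock :=
  \sum_(b <- fsup v | fpodd b == p) coeff b v *: ket K b.

Lemma fproj_sector p v : fsector p (fproj p v).
Proof.
rewrite /fproj; pose Q := fsector p; rewrite -/(Q _).
elim/big_ind: _ => // [|u w hu hw|b /eqP e]; [exact: fsector0|by rewrite -[u]scale1r; apply: fsectorP|].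
rewrite -[_ *: _]addr0; apply: fsectorP; last exact: fsector0; move=> b'; rewrite coeff_ket.
by case: (b =P b') => [<- //|]; rewrite eqxx.
Qed.

Lemma fproj_sum v : v = fproj false v + fproj true v.
Proof.
rewrite {1}(fockE v) (bigID (fun b => fpodd b == false)) /=; congr (_ + _).
by apply: eq_bigl => b; case: (fpodd b).
Qed.

End TableOfBrackets.

Lemma ratr_weight (R : realType) (a : gen) : ratr (conf_weight a) =
  match a with gL => 2 | gJ0 | gJ _ => 1 | _ => 3 / 2 end :> R[i].
Proof.
by case: a => [||s|s|s] /=; rewrite ?fmorph_div /= ?rmorph1 ?ratr_nat // ratr_nat.
Qed.

(** * The Fock space as a Neveu-Schwarz module *)

Section FockModule.
Variable R : realType.
Notation C := (R[i] : numFieldType).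
Notation fock := (fock C).
Implicit Types (u v w : fock) (m n k : int).

Definition kterm_lterm (t : kterm C) : lterm R := LTerm t.1.1.1 t.1.1.2 t.1.2 t.2.

Lemma lbracket_kbracket a b :
  lbracket (-3 : R[i]) a b = omap (map kterm_lterm) (kbracket C a b).
Proof.
case: a => [||s|s|s]; case: b => [||s'|s'|s']; rewrite /lbracket /kbracket ?ratr_weight //;
 try (by case: s; case: s'); by case: s.
Qed.

Lemma bracket_mode_kterm ts m n v :
  bracket_mode (@cur C) (map kterm_lterm ts) m n v = kbracket_mode ts m n v.
Proof. by rewrite /bracket_mode big_map. Qed.

Lemma cM2 : cM R 2 = -3.
Proof. by rewrite /cM; field. Qed.

Lemma cur_bracket (a b : gen) m n v :
  match lbracket (cM R 2) a b, lbracket (cM R 2) b a with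
  | Some ts, _ => supercomm (@cur C) a m b n v = bracket_mode (@cur C) ts m n v
  | None, None => supercomm (@cur C) a m b n v = 0
  | None, Some _ => True
  end.
Proof.
rewrite cM2 !lbracket_kbracket.
case E : (kbracket C a b) => [ts|] /=; first by rewrite bracket_mode_kterm -(br_kbracket _ _ _ E).
by case E' : (kbracket C b a) => [ts|] //=; apply: (br_none _ _ _ E E').
Qed.

Definition fock_module : n4_module (cM R 2).
Proof.
refine (@N4Module R (cM R 2) fock (@fsector C) (@cur C) _ _ _ _ _ _).
- by move=> p; split; [exact: fsector0 | move=> k u v; exact: fsectorP].
- by move=> v; exists (fproj false v), (fproj true v); split;
    [exact: fproj_sector|exact: fproj_sector|exact: fproj_sum].
- move=> v h0 h1; apply: fockP => b; rewrite raddf0; apply/eqP; apply: contraT => hb.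
  by have := h0 _ hb; rewrite (h1 _ hb).
- by move=> a m k u v; apply: cur_linear.
- by move=> a m p v; apply: fsector_cur.
- exact: cur_bracket.
Defined.

End FockModule.

(** * Singular vectors and generation *)

Section SingularVectors.
Variable K : numFieldType.
Notation fock := (fock K).
Notation vac := (vac K).
Implicit Types (u v w : fock) (m n k i : int) (s : bool).

Lemma bosC s s' m n v : m + n != 0 ->
  phi (Bos s) m (phi (Bos s') n v) = phi (Bos s') n (phi (Bos s) m v).
Proof.
move=> h; rewrite phi_comm /= expr0 scale1r.
by case: s; case: s'; rewrite /om ?(negPf h) ?oppr0 scale0r addr0.
Qed.

Lemma bosC_same s m n v :
  phi (Bos s) m (phi (Bos s) n v) = phi (Bos s) n (phi (Bos s) m v).
Proof. by rewrite phi_comm /= expr0 scale1r; case: s; rewrite /om scale0r addr0. Qed.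

Lemma bos_comm s m n v : phi (Bos s) m (phi (Bos (~~ s)) n v) =
  phi (Bos (~~ s)) n (phi (Bos s) m v) + (sg K s * (m + n == 0)%:R) *: v.
Proof.
by rewrite phi_comm /= expr0 scale1r; case: s; rewrite /om /sg /= ?mul1r ?mulN1r.
Qed.

(** For [n != 0] the factors of each product commute, so that no normal ordering is needed. The
    formula expands the definition of [J^0_n]: bracketing with [J^+_0] turns one factor [b^-] of
    [J^-_n] into [b^+]. *)
Lemma Jz_bil n v : n != 0 -> cur gJ0 n v =
  - lsum (fun i => phi (Bos true) i (phi (Bos false) (n - i) v)).
Proof.
move=> n0; have fF s s' : fsupp (fun i => (- 2^-1) *: phi (Bos s) i (phi (Bos s') (n - i) v)).
  have [N hN] := phi_eventually0 v; apply: (@fsupp_bounds _ _ (n - N%:Z) N%:Z) => i hi.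
    by rewrite (hN (Bos s')) ?linear0 ?scaler0 //; lia.
  by rewrite bosC ?(hN (Bos s)) ?linear0 ?scaler0 //; lia.
have fB u : fsupp (fun i => (- 2^-1) *: phi (Bos false) i (phi (Bos false) (n - i) u)).
  by have := @fsupp_bil K (Bos false) (Bos false) erefl (fun=> - 2^-1) n u.
have eJ u : cur (gJ false) n u =
    lsum (fun i => (- 2^-1) *: phi (Bos false) i (phi (Bos false) (n - i) u)).
  by rewrite JpmE; apply: eq_lsum => i; rewrite /sg mulN1r.
rewrite -[cur gJ0 n v]/(Jz n v) JzE (eJ v) (raddf_lsum (cur (gJ true) 0)) //=.
rewrite (@eq_lsum _ _ (fun i => (- 2^-1) *: phi (Bos false) i
    (phi (Bos false) (n - i) (cur (gJ true) 0 v)) +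
   ((- 2^-1) *: phi (Bos false) i (phi (Bos true) (n - i) v) +
    (- 2^-1) *: phi (Bos true) i (phi (Bos false) (n - i) v)))); last first.
  by move=> i; rewrite curZ !Jp_bm !phiD !add0r; module.
rewrite lsumD //; last exact: fsuppD.
rewrite lsumD // (eJ (cur (gJ true) 0 v)).
have -> : lsum (fun i => (- 2^-1) *: phi (Bos false) i (phi (Bos true) (n - i) v)) =
    lsum (fun i => (- 2^-1) *: phi (Bos true) i (phi (Bos false) (n - i) v)).
  by rewrite -(lsum_refl n); apply: eq_lsum => i; rewrite subKr bosC //; lia.
have -> : lsum (fun i => (- 2^-1) *: phi (Bos true) i (phi (Bos false) (n - i) v)) =
   (- 2^-1) *: lsum (fun i => phi (Bos true) i (phi (Bos false) (n - i) v)).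
  rewrite -[RHS]/(GRing.scale _ _) raddf_lsum //=.
  have [A hA] := fF true false; exists A => i /hA/eqP.
  by rewrite scaler_eq0 oppr_eq0 invr_eq0 pnatr_eq0 /= => /eqP.
by rewrite addrAC subrr add0r; move: (lsum _) => x; to_coeff; field.
Qed.

Lemma bb_sum0 s s' n w : 0 < n -> cur (gJ s) n w = 0 -> cur gJ0 n w = 0 ->
  lsum (fun i => phi (Bos s) i (phi (Bos s') (n - i) w)) = 0.
Proof.
move=> n0; have n0' : n != 0 by lia.
have [<- | ne] := eqVneq s s'.
  rewrite JpmE => + _.
  have -> : lsum (fun i => (sg K s / 2) *: phi (Bos s) i (phi (Bos s) (n - i) w)) =
     (sg K s / 2) *: lsum (fun i => phi (Bos s) i (phi (Bos s) (n - i) w)).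
    rewrite -[RHS]/(GRing.scale _ _) raddf_lsum //=.
    have := @fsupp_bil K (Bos s) (Bos s) _ (fun=> 1) n w; case.
      by case: (s).
    by move=> A hA; exists A => i /hA; rewrite scale1r.
  move/eqP; rewrite scaler_eq0 mulf_eq0 invr_eq0 pnatr_eq0 orbF.
  by case: (s); rewrite /sg ?oppr_eq0 oner_eq0 /= => /eqP.
move=> _; rewrite Jz_bil // => /eqP; rewrite oppr_eq0 => /eqP.
case: s s' ne => [] [] // _ e.
rewrite -(lsum_refl n) -[RHS]e; apply: eq_lsum => i; rewrite subKr bosC //; lia.
Qed.

(** Outside the window one of the two commuting factors has index larger than [N] and kills [w], so
    that the vanishing infinite sum is a finite one. *)
Lemma bb_window s s' (N : nat) k w : - N%:Z <= k < N%:Z ->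
  (forall s i, N%:Z < i -> phi (Bos s) i w = 0) ->
  cur (gJ s) (N%:Z - k) w = 0 -> cur gJ0 (N%:Z - k) w = 0 ->
  \sum_(j < N.*2.+1) phi (Bos s) (j%:Z - N%:Z) (phi (Bos s') (N%:Z - k - (j%:Z - N%:Z)) w) = 0.
Proof.
move=> hk hN h1 h0; have := @bb_sum0 s s' (N%:Z - k) w _ h1 h0.
rewrite (@lsum_window _ (- N%:Z) N.*2.+1) => [e|i hi|i hi].
- rewrite -[RHS]e; last by lia.
  by apply: eq_bigr => j _; rewrite (addrC (j%:Z)).
- by rewrite (hN s') ?linear0 //; lia.
- by rewrite bosC ?(hN s) ?linear0 //; lia.
Qed.

Lemma sum_middle (V : zmodType) (N : nat) (f : nat -> V) (a : V) : (0 < N)%N ->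
  (forall j, (j < N)%N -> f j = 0) -> (forall j, (N < j)%N -> f j = a) ->
  \sum_(j < N.*2) f j = f N + a *+ N.-1.
Proof.
move=> N0 h1 h2; rewrite -(big_mkord xpredT) (@big_cat_nat _ _ _ N) //=; last by lia.
rewrite big_nat big1 ?add0r => [|j /andP[_ /h1 //]].
rewrite big_ltn; last by lia.
congr (_ + _); rewrite big_nat (eq_bigr (fun=> a)) => [|j /andP[/h2 //]].
by rewrite -big_nat sumr_const_nat; congr (_ *+ _); lia.
Qed.

Lemma sum_antidiagonal (N : nat) (u : fock) : (0 < N)%N ->
  \sum_(p < N.*2) \sum_(q < N.*2)
    ((p%:Z - N%:Z) + (q%:Z - N%:Z) == 0 :> int)%:R *: u = u *+ N.*2.-1.
Proof.
move=> N0; case: N N0 => // N _; rewrite doubleS big_ord_recl /= big1 ?add0r; last first.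
  by move=> q _; rewrite (_ : (_ == 0) = false) ?scale0r //; have := ltn_ord q; lia.
rewrite (eq_bigr (fun=> u)) => [|p _]; first by rewrite sumr_const card_ord.
have hp : ((N.+1).*2 - (p.+1) < (N.*2).+2)%N by have := ltn_ord p; lia.
rewrite (bigD1 (Ordinal hp)) //= big1 ?addr0 => [|q nq].
  rewrite (_ : (_ == 0) = true) ?scale1r //; have := ltn_ord p; rewrite /bump /=; lia.
rewrite (_ : (_ == 0) = false) ?scale0r //; move: nq; rewrite -val_eqE /= /bump /=; lia.
Qed.

(** Consider [b^s_i b^(~s)_j b^(~s)_r w] with [i + j + r = N] and indices from [-N] to [N]. Summing
    over [j] for fixed [i < N], or over [i] for fixed [j < N] with the first two factors exchanged,
    gives 0. On the square [i, j < N] the two double sums differ by commutators at [i + j = 0], of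
    which there are [2 N - 1]; the terms with [j = N], resp. [i = N], remain. *)
Lemma bb_identity s (N : nat) w : (0 < N)%N ->
  (forall s i, N%:Z < i -> phi (Bos s) i w = 0) ->
  (forall s n, 0 < n -> cur (gJ s) n w = 0) -> (forall n, 0 < n -> cur gJ0 n w = 0) ->
  \sum_(p < N.*2) phi (Bos s) (p%:Z - N%:Z)
     (phi (Bos (~~ s)) (- (p%:Z - N%:Z)) (phi (Bos (~~ s)) N%:Z w))
  - \sum_(q < N.*2) phi (Bos (~~ s)) (q%:Z - N%:Z)
     (phi (Bos (~~ s)) (- (q%:Z - N%:Z)) (phi (Bos s) N%:Z w))
  + (sg K s * N.*2.-1%:R) *: phi (Bos (~~ s)) N%:Z w = 0.
Proof.
move=> N0 hN hJ hJ0.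
pose B t (i : nat) := @phi K (Bos t) (i%:Z - N%:Z).
pose c (i j : nat) : int := N%:Z - (i%:Z - N%:Z) - (j%:Z - N%:Z).
have e1 : \sum_(p < N.*2) B s p
    (\sum_(q < N.*2.+1) B (~~ s) q (phi (Bos (~~ s)) (c p q) w)) = 0.
  apply: big1 => p _; rewrite /B /c bb_window ?linear0 //; have := ltn_ord p; first lia.
    by move=> _; apply: hJ; have := ltn_ord p; lia.
  by move=> _; apply: hJ0; have := ltn_ord p; lia.
have e2 : \sum_(q < N.*2) B (~~ s) q
    (\sum_(p < N.*2.+1) B s p (phi (Bos (~~ s)) (c q p) w)) = 0.
  apply: big1 => p _; rewrite /B /c bb_window ?linear0 //; have := ltn_ord p; first lia.
    by move=> _; apply: hJ; have := ltn_ord p; lia.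
  by move=> _; apply: hJ0; have := ltn_ord p; lia.
have split t (i : nat) (F : nat -> fock) : B t i (\sum_(q < N.*2.+1) F q) =
    \sum_(q < N.*2) B t i (F q) + B t i (F N.*2).
  by rewrite big_ord_recr /= /B phiD linear_sum.
move: e1; rewrite (eq_bigr _ (fun (p : 'I_N.*2) _ => split s p
  (fun q : nat => B (~~ s) q (phi (Bos (~~ s)) (c p q) w)))) big_split /= => e1.
move: e2; rewrite (eq_bigr _ (fun (q : 'I_N.*2) _ => split (~~ s) q
  (fun p : nat => B s p (phi (Bos (~~ s)) (c q p) w)))) big_split /= => e2.
have d2 : (N.*2)%:Z - N%:Z = N%:Z by lia.
have e3 : \sum_(p < N.*2) \sum_(q < N.*2) B s p (B (~~ s) q (phi (Bos (~~ s)) (c p q) w))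
  = \sum_(q < N.*2) \sum_(p < N.*2) B (~~ s) q (B s p (phi (Bos (~~ s)) (c q p) w))
   + (sg K s * N.*2.-1%:R) *: phi (Bos (~~ s)) N%:Z w.
  rewrite -scalerA scaler_nat -sum_antidiagonal // exchange_big /=.
  rewrite [X in _ *: X]exchange_big scaler_sumr -big_split /=.
  apply: eq_bigr => q _; rewrite scaler_sumr -big_split /=; apply: eq_bigr => p _.
  rewrite /B bos_comm scalerA.
  have -> : c p q = c q p by rewrite /c; lia.
  case: eqP => [e|_]; last by rewrite mulr0 !scale0r.
  by rewrite (_ : c q p = N%:Z) //; rewrite /c; lia.
have e4 : \sum_(p < N.*2) B s p (B (~~ s) N.*2 (phi (Bos (~~ s)) (c p N.*2) w)) =
  \sum_(p < N.*2) phi (Bos s) (p%:Z - N%:Z)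
     (phi (Bos (~~ s)) (- (p%:Z - N%:Z)) (phi (Bos (~~ s)) N%:Z w)).
  apply: eq_bigr => p _; rewrite /B /c d2 [in LHS]bosC_same.
  by rewrite (_ : N%:Z - _ - N%:Z = - (p%:Z - N%:Z)) //; lia.
have e5 : \sum_(q < N.*2) B (~~ s) q (B s N.*2 (phi (Bos (~~ s)) (c q N.*2) w)) =
  \sum_(q < N.*2) phi (Bos (~~ s)) (q%:Z - N%:Z)
     (phi (Bos (~~ s)) (- (q%:Z - N%:Z)) (phi (Bos s) N%:Z w)).
  apply: eq_bigr => q _; rewrite /B /c d2 (@bosC s (~~ s) N%:Z); last by have := ltn_ord q; lia.
  by rewrite (_ : N%:Z - _ - N%:Z = - (q%:Z - N%:Z)) //; lia.
rewrite -e4 -e5; move: e1 e2; rewrite e3.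
move: (\sum_(q < N.*2) \sum_(p < N.*2) _) (\sum_(p < N.*2) B s p _)
  (\sum_(q < N.*2) B (~~ s) q _) (_ *: _) => x y z t e1 e2.
have -> : y - z + t = x + t + y - (x + z) by module.
by rewrite e1 e2 subrr.
Qed.

(** Think of [d] and [x] as differentiation and multiplication by a variable. Applying [d] twice to
    the first relation and eliminating [d (d u)] by the second gives [(c + 1) (c + 2) v = 0]; the
    relations with [v = 0] then force [u = 0]. *)
Lemma weyl_trivial (d x : {linear fock -> fock}) (c : K) u v :
  (forall w, d (x w) = x (d w) + w) -> 0 < c ->
  d (x u) + c *: u = x (x v) -> x (d v) - c *: v = d (d u) -> u = 0 /\ v = 0.
Proof.
move=> h c0 e1 e2.
have dD w w' : d (w + w') = d w + d w' by exact: linearD.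
have xD w w' : x (w + w') = x w + x w' by exact: linearD.
have dN w : d (- w) = - d w by exact: linearN.
have xN w : x (- w) = - x w by exact: linearN.
have dZ a w : d (a *: w) = a *: d w by exact: linearZ.
have xZ a w : x (a *: w) = a *: x w by exact: linearZ.
have v0 : v = 0.
  have : ((c + 1) * (c + 2)) *: v = 0.
    have := congr1 (fun w => d (d w)) e1.
    rewrite !(dD, dZ, h, xD) -e2 !(dD, dZ, h, dN, xD, xN, xZ).
    by move/esym/eqP; rewrite -subr_eq0 => /eqP e; rewrite -[RHS]e; module.
  by move/eqP; rewrite scaler_eq0 mulf_eq0 !gt_eqF ?addr_gt0 //= => /eqP.
rewrite v0 !(linear0 d, linear0 x) scaler0 subr0 in e1 e2; split=> //.
have du : d u = 0.
  have := congr1 d e1; rewrite (linear0 d) dD dZ !h dD h -e2 (linear0 x) add0r => e.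
  have : (c + 2) *: d u = 0 by rewrite -[RHS]e; module.
  by move/eqP; rewrite scaler_eq0 gt_eqF ?addr_gt0 //= => /eqP.
move: e1; rewrite h du (linear0 x) add0r => e1.
have : (c + 1) *: u = 0 by rewrite -[RHS]e1; module.
by move/eqP; rewrite scaler_eq0 gt_eqF ?addr_gt0 //= => /eqP.
Qed.

Lemma J_bos s s' n k v : cur (gJ s) n (phi (Bos s') k v) =
  phi (Bos s') k (cur (gJ s) n v) + (s' != s)%:R *: phi (Bos s) (n + k) v.
Proof.
have [_ ->] := cur_derf K (gJ s) n; rewrite /= expr0 scale1r /ev /=.
by case: eqP => [_|_] /=; rewrite ?scale0r.
Qed.

Lemma J0_bos s n k v : cur gJ0 n (phi (Bos s) k v) =
  phi (Bos s) k (cur gJ0 n v) + sg K s *: phi (Bos s) (n + k) v.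
Proof. by have [_ ->] := cur_derf K gJ0 n; rewrite /= expr0 scale1r. Qed.

(** Induction on the energy and, inside it, on the largest index [N + 1] of a bosonic mode that may
    not kill [w]. What [bb_identity] says about the two vectors [b^+_{N+1} w] and [b^-_{N+1} w]
    involves only the zero modes, and [weyl_trivial] makes both vanish. *)
Lemma J_singular w : (forall s n, 0 < n -> cur (gJ s) n w = 0) ->
  (forall n, 0 < n -> cur gJ0 n w = 0) -> forall s k, 0 < k -> phi (Bos s) k w = 0.
Proof.
have [e he] := ebound_exists w; elim: e w he => [w /ebound0 -> *|e IHe w he hJ hJ0].
  by rewrite linear0.
have [N0 hN0] := phi_eventually0 w.
have {hN0} : forall s i, N0%:Z < i -> phi (Bos s) i w = 0 by move=> s i /hN0.
elim: N0 => [//|N IHN hN]; apply: IHN => s i hi.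
have [hi2|hi2] := ltP N.+1%:Z i; first exact: hN.
have -> : i = N.+1%:Z by lia.
(* The vector [b^t_{N+1} w] satisfies the same hypotheses: moving a positive mode of a current past
   [b^t_{N+1}] produces only a boson of larger index, which kills [w]. Its energy is smaller. *)
have h1 t r k : 0 < k -> phi (Bos r) k (phi (Bos t) N.+1 w) = 0.
  apply: (IHe (phi (Bos t) N.+1 w)) => {r k} [|r n n0|n n0].
  - have := @ebound_phi K e.+1 1 (Bos t) N.+1 w _ he; rewrite subSS subn0; apply; rewrite /=; lia.
  - by rewrite J_bos hJ // hN ?linear0 ?scaler0 ?addr0 //; lia.
  - by rewrite J0_bos hJ0 // hN ?linear0 ?scaler0 ?addr0 //; lia.
(* By [h1] the terms of negative index vanish. In the first sum each of the [N] positive indices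
   leaves a commutator, which raises the coefficient from [2 N + 1] to [3 N + 1]; the zero index
   gives the remaining products. *)
have key t : phi (Bos t) 0 (phi (Bos (~~ t)) 0 (phi (Bos (~~ t)) N.+1 w)) +
    (sg K t * (N.*2.+1 + N)%:R) *: phi (Bos (~~ t)) N.+1 w =
    phi (Bos (~~ t)) 0 (phi (Bos (~~ t)) 0 (phi (Bos t) N.+1 w)).
  have := @bb_identity t N.+1 w isT hN hJ hJ0.
  rewrite (@sum_middle _ N.+1 (fun p => phi (Bos t) (p%:Z - N.+1%:Z) (phi (Bos (~~ t))
    (- (p%:Z - N.+1%:Z)) (phi (Bos (~~ t)) N.+1 w))) (sg K t *: phi (Bos (~~ t)) N.+1 w))
    //; first last.
  - move=> j hj; rewrite bos_comm (h1 _ t) ?linear0 ?add0r; last by lia.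
    by rewrite (_ : (_ == 0) = true) ?mulr1 //; lia.
  - by move=> j hj; rewrite h1 ?linear0 //; lia.
  rewrite (@sum_middle _ N.+1 (fun p => phi (Bos (~~ t)) (p%:Z - N.+1%:Z) (phi (Bos (~~ t))
    (- (p%:Z - N.+1%:Z)) (phi (Bos t) N.+1 w))) 0) //; first last.
  - by move=> j hj; rewrite bosC_same h1 ?linear0 //; lia.
  - by move=> j hj; rewrite h1 ?linear0 //; lia.
  rewrite !subrr oppr0 mul0rn addr0 /= -scaler_nat natrD mulrDr.
  move: (phi (Bos t) 0 (phi _ 0 _)) => x.
  move: (phi (Bos (~~ t)) 0 (phi _ 0 _)) => y; move: (phi _ _ w) => z e0.
  by rewrite -[y]addr0 -[in RHS]e0; module.
have := key true; have := key false; rewrite /sg /= mulN1r mul1r scaleNr => e2 e1.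
have c0 : 0 < (N.*2.+1 + N)%:R :> K by rewrite ltr0n.
have hd v : phi (Bos true) 0 (phi (Bos false) 0 v) = phi (Bos false) 0 (phi (Bos true) 0 v) + v.
  by rewrite bp_bm addr0 eqxx scale1r.
by have [] := @weyl_trivial (phi (Bos true) 0) (phi (Bos false) 0) _ _ _ hd c0 e1 e2; case: s.
Qed.

Lemma bos_fer s f m n v :
  phi (Bos s) m (phi (Fer f) n v) = phi (Fer f) n (phi (Bos s) m v).
Proof. by rewrite phi_comm /= expr0 scale1r; case: s; rewrite /om scale0r addr0. Qed.

(** In the mode [M + 1] of the odd current only the product of [b^s_0] with the top fermion mode
    survives. Hence both bosonic zero modes kill that vector, and their commutator is 1. *)
Lemma fer_top f (c : bool -> int -> int -> K) (M : int) w : 0 <= M ->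
  (forall s k, 0 < k -> phi (Bos s) k w = 0) ->
  (forall s m, 0 < m ->
    lsum (fun i => c s m i *: phi (Bos s) i (phi (Fer f) (m - 1 - i) w)) = 0) ->
  (forall s m, 0 < m -> c s m 0 != 0) ->
  (forall i, M < i -> phi (Fer f) i w = 0) -> phi (Fer f) M w = 0.
Proof.
move=> M0 hB hS hc hM.
have h s : phi (Bos s) 0 (phi (Fer f) M w) = 0.
  have := hS s (M + 1); rewrite (@lsum1 _ 0) => [|i ni]; last first.
    have [i0|i0] := ltP i 0; first by rewrite hM ?linear0 ?scaler0 //; lia.
    by rewrite bos_fer hB ?linear0 ?scaler0 //; lia.
  rewrite subr0 addrK => /(_ _)/eqP; rewrite scaler_eq0 (negPf (hc _ _ _)) /=; last by lia.
  by move=> e; apply/eqP/e; lia.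
have := bp_bm 0 0 (phi (Fer f) M w); rewrite !h !linear0 add0r addr0 eqxx scale1r.
by move=> <-.
Qed.

Lemma fer_singular f (c : bool -> int -> int -> K) w :
  (forall s k, 0 < k -> phi (Bos s) k w = 0) ->
  (forall s m, 0 < m ->
    lsum (fun i => c s m i *: phi (Bos s) i (phi (Fer f) (m - 1 - i) w)) = 0) ->
  (forall s m, 0 < m -> c s m 0 != 0) ->
  forall k, 0 <= k -> phi (Fer f) k w = 0.
Proof.
move=> hB hS hc; have [N0 hN0] := phi_eventually0 w.
have {hN0} : forall i, N0%:Z <= i -> i != N0%:Z -> phi (Fer f) i w = 0.
  by move=> i h1 h2; apply: hN0; lia.
elim: N0 => [|N IHN] hN.
  move=> k k0; have [->|nk] := eqVneq k 0; last by apply: hN; lia.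
  by apply: (fer_top _ hB hS hc) => // i hi; apply: hN; lia.
apply: IHN => i h1 h2; have [->|ni] := eqVneq i N.+1%:Z; last by apply: hN; lia.
by apply: (fer_top _ hB hS hc) => // j hj; apply: hN; lia.
Qed.

Lemma GE s m v : cur (gG s) m v =
  lsum (fun i => (1 : K) *: phi (Bos s) i (phi (Fer true) (m - 1 - i) v)).
Proof. by []. Qed.

Lemma GbE s m v : cur (gGbar s) m v = lsum (fun i =>
  (- sg K s * ((m - 1 - i)%:~R + 2^-1)) *: phi (Bos s) i (phi (Fer false) (m - 1 - i) v)).
Proof. by []. Qed.

Lemma singular_vector w : (forall A m, 0 < mode_index A m -> cur A m w = 0) ->
  cur (gJ true) 0 w = 0 -> exists a c, w = a *: vac + c *: phi (Bos false) 0 vac.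
Proof.
move=> hpos hJp.
have pJ s n : 0 < n -> 0 < mode_index (gJ s) n by rewrite /mode_index /= subrK ltr0z.
have pJ0 n : 0 < n -> 0 < mode_index gJ0 n by rewrite /mode_index /= subrK ltr0z.
have pG (n : int) : 0 < n -> 0 < n%:~R - 3%:Q / 2 + 1 :> rat.
  move=> n0; have : 1%:~R <= n%:~R :> rat by rewrite ler_int; lia.
  by move: (n%:~R : rat) => x; lra.
have hB s k : 0 < k -> phi (Bos s) k w = 0.
  by apply: J_singular => [t n n0|n n0]; apply: hpos; [apply: pJ | apply: pJ0].
have hF f k : 0 <= k -> phi (Fer f) k w = 0.
  case: f; [apply: (@fer_singular true (fun _ _ _ => 1)) => // s m m0
    | apply: (@fer_singular false (fun s m i => - sg K s * ((m - 1 - i)%:~R + 2^-1)))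
        => // s m m0].
  - by rewrite -GE hpos // /mode_index pG.
  - by rewrite -GbE hpos // /mode_index pG.
  rewrite subr0 mulf_neq0 //; first by rewrite oppr_eq0; case: s; rewrite /sg ?oppr_eq0 oner_eq0.
  rewrite gt_eqF // ltr_wpDl ?invr_gt0 ?ltr0n // ler0z; lia.
have hbb : phi (Bos true) 0 (phi (Bos true) 0 w) = 0.
  have := hJp; rewrite JpmE (@lsum1 _ 0) => [|i ni].
    rewrite subr0 => /eqP; rewrite scaler_eq0 mulf_eq0 invr_eq0 pnatr_eq0 /sg oner_eq0 /=.
    by move/eqP.
  have [i0|i0] := ltP 0 i; first by rewrite bosC_same hB ?linear0 ?scaler0.
  by rewrite hB ?linear0 ?scaler0 //; lia.
(* Since [(b^+_0)^2 w = 0], the vector [b^+_0 w] is killed by all annihilation modes. Subtracting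
   the corresponding multiple of [b^-_0 vac] from [w] leaves a vector that [b^+_0] kills as well. *)
have eq1 : phi (Bos true) 0 w = coeff occ0 (phi (Bos true) 0 w) *: vac.
  apply: ann_all => -[s|f] k ak; last by rewrite -bos_fer hF ?linear0.
  have [k0|nk] := eqVneq k 0; first by case: s ak; rewrite k0 ?hbb.
  by rewrite bosC ?addr0 // hB ?linear0 //; case: s ak; rewrite /ann /bann; lia.
move: eq1; set c := coeff _ _ => eq1.
exists (coeff occ0 (w - c *: phi (Bos false) 0 vac)), c.
rewrite -ann_all ?subrK // => -[s|f] k ak; rewrite phiD phiN phiZ.
  have [k0|nk] := eqVneq k 0.
    case: s ak; rewrite k0 // => _.
    by rewrite eq1 bp_bm bp_vac // linear0 add0r addr0 eqxx scale1r subrr.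
  have k0 : 0 < k by case: s ak; rewrite /ann /bann; lia.
  by rewrite hB // bosC ?addr0 // phi_vac // linear0 scaler0 subrr.
by rewrite hF // -bos_fer phi_vac // linear0 scaler0 subrr.
Qed.

End SingularVectors.

(** * Finite boxes of occupation numbers *)

Section Enumeration.

Fixpoint msets (N : nat) (S : seq slot) : seq (multiset slot) :=
  if S is i :: S' then [seq iter k (madd i) M | k <- iota 0 N, M <- msets N S']
  else [:: mset0].

Fixpoint fsets (S : seq slot) : seq {fset slot} :=
  if S is i :: S' then fsets S' ++ map (flip i) (fsets S') else [:: fset0].

Definition slots (N : nat) : seq slot := [seq (s, n) | s <- [:: true; false], n <- iota 0 N].

(** Boxes in which the number of slots and the occupation numbers are bounded by [N]. They exhaust
    all states, and a multiplicative weight summed over a box is a finite product over the slots. *)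
Definition occs (N : nat) : seq occ :=
  [seq (M, A) | M <- msets N (slots N), A <- fsets (slots N)].

Lemma iter_maddE i k M j : iter k (madd i) M j = (k * (j == i) + M j)%N.
Proof. by elim: k => //= k IH; rewrite maddE IH mulSn addnA. Qed.

Lemma finsupp_gt0 (M : multiset slot) i : (i \in finsupp M) = (0 < M i)%N.
Proof. by rewrite mem_finsupp lt0n. Qed.

Lemma mem_msets N S M : uniq S ->
  (M \in msets N S) = (all (fun i => M i < N)%N S && all (fun i => i \in S) (finsupp M)).
Proof.
elim: S M => [|i S IH] M /=.
  move=> _; rewrite inE; apply/eqP/allP => [-> j|h]; first by rewrite finsupp_gt0 mset0E.
  apply/msetP => j; rewrite mset0E; apply/eqP; rewrite eqn0Ngt -finsupp_gt0.
  by apply/negP => /h.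
case/andP=> iS uS; apply/allpairsP/andP => [[[k M'] /= [hk hM ->]]|[/andP[hi hS] /allP hsup]].
  move: hk hM; rewrite mem_iota IH // => hk /andP[/allP h1 /allP h2].
  have Mi : M' i = 0%N.
    by apply/eqP; rewrite eqn0Ngt -finsupp_gt0; apply: contra iS => /h2.
  split; last first.
    apply/allP => j; rewrite finsupp_gt0 iter_maddE /= inE.
    have [//|_] := eqVneq j i; rewrite muln0 add0n => hj.
    by apply: h2; rewrite finsupp_gt0.
  rewrite iter_maddE eqxx muln1 Mi addn0; apply/andP; split; first by case/andP: hk.
  apply/allP => j jS; rewrite iter_maddE (negPf (memPn iS j jS)) muln0 add0n.
  exact: h1.
exists (M i, iter (M i) (mrem i) M) => /=.
have hr k : iter k (mrem i) M =1 (fun j => M j - k * (j == i))%N.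
  by elim: k => [|k IHk] j /=; rewrite ?subn0 // mremE IHk mulSn addnC subnDA.
split; first by rewrite mem_iota.
  rewrite IH //; apply/andP; split; apply/allP => j.
    by move=> jS; rewrite hr; apply: leq_ltn_trans (leq_subr _ _) _; apply: (allP hS).
  rewrite finsupp_gt0 hr => hj.
  have ji : j != i by apply: contraTneq hj => ->; rewrite eqxx muln1 subnn.
  have := hsup j; rewrite finsupp_gt0 /= inE (negPf ji); apply.
  by apply: leq_trans hj (leq_subr _ _).
apply/msetP => j; rewrite iter_maddE hr; have [->|_] := eqVneq j i.
  by rewrite muln1 subnn addn0.
by rewrite !muln0 subn0.
Qed.

Lemma msets_uniq N S : uniq S -> uniq (msets N S).
Proof.
elim: S => //= i S IH /andP[iS uS]; apply: allpairs_uniq => //; first exact: iota_uniq.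
  exact: IH.
have h M : M \in msets N S -> M i = 0%N.
  rewrite mem_msets // => /andP[_ /allP h]; apply/eqP; rewrite eqn0Ngt -finsupp_gt0.
  by apply: contra iS => /h.
move=> [k M] [k' M'] /allpairsP[[a b] /= [_ hM [-> ->]]] /allpairsP[[a' b'] /= [_ hM' [-> ->]]] e.
have ek : a = a'.
  by have := congr1 (fun L : multiset slot => L i) e; rewrite !iter_maddE eqxx !muln1 (h _ hM) (h _ hM') !addn0.
rewrite -ek in e *; congr (_, _); apply/msetP => j.
by have := congr1 (fun L : multiset slot => L j) e; rewrite !iter_maddE => /addnI.
Qed.

Lemma mem_fsets S A : uniq S -> (A \in fsets S) = all (fun i => i \in S) A.
Proof.
elim: S A => [|i S IH] A /=.
  move=> _; rewrite inE; apply/eqP/allP => [-> //|h].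
  by apply/fsetP => j; rewrite in_fset0; apply/negP => /h.
case/andP=> iS uS; rewrite mem_cat IH //; apply/orP/allP => [[/allP h j /h hj|/mapP[B]]|h].
- by rewrite inE hj orbT.
- rewrite IH // => /allP hB -> j; rewrite in_flip !inE.
  by case: eqVneq => //= _ /hB.
have [iA|iA] := boolP (i \in A); [right|left].
  apply/mapP; exists (flip i A); last by rewrite flipK.
  rewrite IH //; apply/allP => j; rewrite in_flip; have [->|ji] := eqVneq j i.
    by rewrite iA.
  by move=> /h; rewrite !inE (negPf ji).
apply/allP => j jA; have := h j jA; rewrite !inE; case: eqVneq => //= e.
by rewrite -e jA in iA.
Qed.

Lemma fsets_uniq S : uniq S -> uniq (fsets S).
Proof.
elim: S => //= i S IH /andP[iS uS]; rewrite cat_uniq IH // map_inj_uniq ?IH ?andbT //=; last first.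
  by move=> A B e; rewrite -(flipK i A) e flipK.
apply/hasPn => A /mapP[B hB ->]; rewrite mem_fsets //; apply/allPn.
exists i; last by [].
rewrite in_flip eqxx /=; apply/negP => iB; move: hB; rewrite mem_fsets // => /allP/(_ _ iB).
by rewrite (negPf iS).
Qed.

Lemma slots_uniq N : uniq (slots N).
Proof.
by apply: allpairs_uniq => //; [exact: iota_uniq | move=> [s n] [s' n'] /= _ _ [-> ->]].
Qed.

Lemma mem_slots N i : (i \in slots N) = (i.2 < N)%N.
Proof.
case: i => s n; apply/allpairsP/idP => [[[s' n'] /= [_ hn [_ ->]]]|h].
  by move: hn; rewrite mem_iota.
by exists (s, n); rewrite /= mem_iota h; case: (s).
Qed.

Lemma occs_uniq N : uniq (occs N).
Proof.
apply: allpairs_uniq; [exact/msets_uniq/slots_uniq | exact/fsets_uniq/slots_uniq |].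
by move=> [M A] [M' A'] /= _ _ [-> ->].
Qed.

Lemma mem_occs N b : (b \in occs N) =
  [&& all (fun i => b.1 i < N)%N (slots N), all (fun i => i.2 < N)%N (finsupp b.1)
    & all (fun i => i.2 < N)%N b.2].
Proof.
have -> : (b \in occs N) = (b.1 \in msets N (slots N)) && (b.2 \in fsets (slots N)).
  apply/allpairsP/andP => [[[M A] [h1 h2 ->]]//|[h1 h2]].
  by exists b; split=> //; case: b {h1 h2}.
rewrite mem_msets ?mem_fsets ?slots_uniq // -andbA; congr [&& _, _ & _];
  by apply: eq_all => i; rewrite /= mem_slots.
Qed.

Lemma occs_exhaust b : exists N0, forall N, (N0 <= N)%N -> b \in occs N.
Proof.
case: b => M A.
have [k1 h1] : exists k, forall i, (M i < k)%N.
  exists (\sum_(i <- finsupp M) M i).+1 => i; rewrite ltnS.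
  have [->//|] := posnP (M i).
  by rewrite -finsupp_gt0 => iM; rewrite (big_fsetD1 i iM) /= leq_addr.
have [k2 h2] : exists k, forall i, i \in finsupp M -> (i.2 < k)%N.
  by exists (\sum_(i <- finsupp M) i.2).+1 => i iM; rewrite ltnS (big_fsetD1 i iM) /= leq_addr.
have [k3 h3] : exists k, forall i, i \in A -> (i.2 < k)%N.
  by exists (\sum_(i <- A) i.2).+1 => i iM; rewrite ltnS (big_fsetD1 i iM) /= leq_addr.
exists (k1 + k2 + k3)%N => N hN; rewrite mem_occs; apply/and3P; split; apply/allP => i /=.
- by move=> _; apply: leq_trans (h1 i) _; apply: leq_trans hN; lia.
- by move=> /h2 h; apply: leq_trans h _; apply: leq_trans hN; lia.
- by move=> /h3 h; apply: leq_trans h _; apply: leq_trans hN; lia.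
Qed.

End Enumeration.

(** * The contravariant form *)

Section ContravariantForm.
Variable K : numFieldType.
Notation fock := (fock K).
Implicit Types (u v w : fock) (t x y : field) (k m n i : int) (j : slot) (s : bool).

(** The sign compensates that the mode annihilating a quantum of [b^+] is minus [ban]; with it,
    [b^s_k] and [b^(~s)_{-k}] are adjoint. *)
Definition eps j : K := if j.1 then -1 else 1.
(** The factor [n + 1/2] is the one between the modes of [x] and those of its derivative; with it
    the adjoint of a mode of [G] is, up to sign, a mode of [Gbar]. *)
Definition nu j : K := if j.1 then - (j.2%:R + 2^-1) else (j.2%:R + 2^-1)^-1.

Lemma eps_sqr j : eps j * eps j = 1.
Proof. by rewrite /eps; case: j.1; rewrite ?mulrNN mulr1. Qed.

Lemma half_neq0 (n : nat) : n%:R + 2^-1 != 0 :> K.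
Proof. by rewrite gt_eqF // ltr_wpDl ?ler0n ?invr_gt0 ?ltr0n. Qed.

Lemma nu_neq0 j : nu j != 0.
Proof. by rewrite /nu; case: j.1; rewrite ?oppr_eq0 ?invr_eq0 half_neq0. Qed.

(* the squared norm of [ket b] *)
Definition knorm (b : occ) : K :=
  (\prod_(j <- finsupp b.1) (eps j ^+ b.1 j * (b.1 j)`!%:R)) * \prod_(j <- b.2) nu j.

Lemma knorm0 : knorm occ0 = 1.
Proof. by rewrite /knorm /= finsupp0 !big_seq_fset0 mulr1. Qed.

Lemma knorm_madd j M A : knorm (madd j M, A) = eps j * (M j).+1%:R * knorm (M, A).
Proof.
rewrite /knorm /= mulrA; congr (_ * _).
have ext (L : multiset slot) : (finsupp L `<=` (j |` finsupp M))%fset ->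
    \prod_(i <- finsupp L) (eps i ^+ L i * (L i)`!%:R) =
    \prod_(i <- (j |` finsupp M)%fset) (eps i ^+ L i * (L i)`!%:R).
  move=> sub; rewrite (big_fset_incl _ sub) // => i _.
  by rewrite finsupp_gt0 -eqn0Ngt => /eqP ->; rewrite expr0 mulr1.
rewrite !ext ?fsubsetUr //; last first.
  apply/fsubsetP => i; rewrite in_fset1U !finsupp_gt0 maddE.
  by case: eqP.
have jD := fset1U1 j (finsupp M).
rewrite (big_fsetD1 j jD) [in RHS](big_fsetD1 j jD) /= !mulrA; congr (_ * _).
  rewrite maddE eqxx add1n factS natrM exprS.
  by move: (_`!%:R) (_.+1%:R) (_ ^+ _) => x y z; ring.
rewrite big_seq_cond [RHS]big_seq_cond; apply: eq_bigr => i /andP[].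
by rewrite in_fsetD1 maddE => /andP[/negPf -> _].
Qed.

Lemma knorm_flip j M A : j \notin A -> knorm (M, flip j A) = nu j * knorm (M, A).
Proof.
by move=> jA; rewrite /knorm /= flip.unlock (negPf jA) big_fsetU1 //= mulrCA.
Qed.

Lemma knorm_neq0 b : knorm b != 0.
Proof.
elim/occ_ind: b => [|j M A h|j M A jA h].
- by rewrite knorm0 oner_eq0.
- rewrite knorm_madd mulf_neq0 // mulf_neq0 ?pnatr_eq0 //.
  by rewrite /eps; case: j.1; rewrite ?oppr_eq0 oner_eq0.
- by rewrite knorm_flip // mulf_neq0 // nu_neq0.
Qed.

(** A bilinear form, diagonal on the states and, with these norms, contravariant: the adjoints of
    the modes of [J^+], [J^-], [G] and [Gbar] are such modes up to sign, so that the orthogonal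
    complement of a stable subspace is stable. *)
Definition form u v : K := lext (fun b => knorm b * coeff b v : K^o) u.

Lemma form_ketl b v : form (ket K b) v = knorm b * coeff b v.
Proof. by rewrite /form lext_ket. Qed.

Lemma formPl c u u' v : form (c *: u + u') v = c * form u v + form u' v.
Proof. by rewrite /form linearP. Qed.

Lemma form_sym u v : form u v = form v u.
Proof.
have h0 w : form 0 w = 0 by rewrite /form raddf0.
move: u v; apply: fock_ind => [v|c u u' hu hu' v|b v].
- rewrite h0; move: v; apply: fock_ind => [|c u v hu hv|b]; first by rewrite h0.
    by rewrite formPl -hu -hv mulr0 addr0.
  by rewrite form_ketl raddf0 mulr0.
- rewrite formPl hu hu'; move: v; apply: fock_ind => [|d v v' hv hv'|b].
  + by rewrite !h0 mulr0 addr0.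
  + by rewrite !formPl -hv -hv'; ring.
  + by rewrite !form_ketl coeffD coeffZ; ring.
rewrite form_ketl; move: v; apply: fock_ind => [|d v v' hv hv'|b'].
- by rewrite h0 raddf0 mulr0.
- by rewrite formPl -hv -hv' coeffD coeffZ; ring.
rewrite form_ketl !coeff_ket eq_sym; case: (b =P b') => [->//|_]; by rewrite !mulr0.
Qed.

Lemma formPr c u v v' : form u (c *: v + v') = c * form u v + form u v'.
Proof. by rewrite !(form_sym u) formPl. Qed.

Lemma form0l v : form 0 v = 0.
Proof. by rewrite /form raddf0. Qed.

Lemma form0r u : form u 0 = 0.
Proof. by rewrite form_sym form0l. Qed.

Lemma formZl c u v : form (c *: u) v = c * form u v.
Proof. by have := formPl c u 0 v; rewrite form0l !addr0. Qed.

Lemma formZr c u v : form u (c *: v) = c * form u v.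
Proof. by rewrite !(form_sym u) formZl. Qed.

HB.instance Definition _ u :=
  GRing.isLinear.Build K fock K^o *:%R (form u) (fun c v v' => formPr c u v v').

Lemma form_linearP (f g : fock -> K) : (forall c u v, f (c *: u + v) = c * f u + f v) ->
  (forall c u v, g (c *: u + v) = c * g u + g v) -> f 0 = 0 -> g 0 = 0 ->
  (forall b, f (ket K b) = g (ket K b)) -> forall u, f u = g u.
Proof. by move=> hf hg f0 g0 h; apply: fock_ind => [|c u v e1 e2|//]; rewrite ?hf ?hg ?f0 ?g0 ?e1 ?e2. Qed.

Lemma form_bcr j u v : form (bcr j u) v = eps j * form u (ban j v).
Proof.
move: u; apply: form_linearP => [c u w|c u w|||[M A]]; rewrite ?raddf0 ?form0l ?mulr0 //.
- by rewrite linearP formPl.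
- by rewrite formPl; ring.
rewrite bcr_ket !form_ketl coeff_ban knorm_madd.
by move: (_.+1%:R) (eps _) (coeff _ _) (knorm _) => *; ring.
Qed.

Lemma form_ban j u v : form (ban j u) v = eps j * form u (bcr j v).
Proof. by rewrite form_sym [form u _]form_sym form_bcr mulrA eps_sqr mul1r. Qed.

Lemma coeff_fan0 j v M (A : {fset slot}) : j \in A -> coeff (M, A) (fop j true v) = 0.
Proof.
move=> jA; move: v; apply: fock_ind => [|c u w hu hw|[M' A']].
- by rewrite !raddf0.
- by rewrite linearP coeffD coeffZ hu hw; ring.
rewrite fop_ket; case: eqP => [jA'|_]; last by rewrite raddf0.
rewrite coeffZ coeff_ket; case: eqP => [[_ e]|_]; last by rewrite mulr0.
by move: jA; rewrite -e in_flip eqxx jA'.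
Qed.

Lemma form_fcr j u v : form (fop j false u) v = nu j * form u (fop j true v).
Proof.
move: u; apply: form_linearP => [c u w|c u w|||[M A]]; rewrite ?raddf0 ?form0l ?mulr0 //.
- by rewrite linearP formPl.
- by rewrite formPl; ring.
rewrite fop_ket form_ketl; case: (boolP (j \in A)) => jA /=.
  by rewrite coeff_fan0 // form0l !mulr0.
rewrite formZl form_ketl coeff_fan // knorm_flip //.
by move: (fsgn _ _ _) (nu _) (coeff _ _) (knorm _) => *; ring.
Qed.

Lemma form_fan j u v : form (fop j true u) v = (nu j)^-1 * form u (fop j false v).
Proof. by rewrite form_sym [form u _]form_sym form_fcr mulrA mulVf ?mul1r ?nu_neq0. Qed.

Definition dualf t : field := match t with Bos s => Bos (~~ s) | Fer s => Fer (~~ s) end.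
Definition dualk t k : int := match t with Bos _ => - k | Fer _ => - k - 1 end.
Definition dualc t k : K :=
  match t with Bos _ => 1 | Fer true => k%:~R + 2^-1 | Fer false => - (k%:~R + 2^-1)^-1 end.

Lemma form_phi t k u v :
  form (phi t k u) v = dualc t k * form u (phi (dualf t) (dualk t k) v).
Proof.
case: t => s /=; rewrite ?phi_bos ?phi_fer.
  rewrite formZl formZr mul1r /bop.
  by case: s; case: k => [[|k]|k]; rewrite /bslot /bann /bsgn /= ?expr1 ?expr0
    ?oppr0 ?form_ban ?form_bcr /eps /=; ring.
have e (n : nat) : - (Negz n) - 1 = n%:Z by lia.
have eN (n : nat) : - n%:Z - 1 = Negz n by lia.
have eZ (n : nat) : (Negz n)%:~R + 2^-1 = - (n%:R + 2^-1) :> K.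
  by rewrite NegzE rmorphN /= -[_%:~R]/(n.+1%:R) -natr1; field.
case: s; case: k => k; rewrite ?e ?eN ?eZ /fslot /= ?form_fcr ?form_fan /nu /= ?invrN ?invrK //.
by rewrite opprK.
Qed.

Lemma form_lsum (F : int -> fock) v : fsupp F -> form (lsum F) v = lsum (fun i => form (F i) v).
Proof.
move=> hF; rewrite form_sym (raddf_lsum (form v)) //; apply: eq_lsum => i.
by rewrite /= form_sym.
Qed.

Lemma form_bil t y n (c : int -> K) u v : om0 K t y = 0 ->
  form (bil c t y n u) v = lsum (fun i => c i * dualc t i * dualc y (n - i) *
    form u (phi (dualf y) (dualk y (n - i)) (phi (dualf t) (dualk t i) v))).
Proof.
move=> ty; rewrite form_lsum; last exact: fsupp_bil.
by apply: eq_lsum => i; rewrite formZl !form_phi; ring.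
Qed.

Lemma form_bil_r t y n (c : int -> K) u v : om0 K t y = 0 ->
  form u (bil c t y n v) = lsum (fun i => c i * form u (phi t i (phi y (n - i) v))).
Proof.
move=> ty; rewrite (raddf_lsum (form u)); last exact: fsupp_bil.
by apply: eq_lsum => i; rewrite /= formZr.
Qed.

Lemma form_J s n u v : form (cur (gJ s) n u) v = - form u (cur (gJ (~~ s)) (- n) v).
Proof.
have e r : om0 K (Bos r) (Bos r) = 0 by case: r.
rewrite -[cur _ _ u]/(bil _ _ _ _ _) -[cur _ _ v]/(bil _ _ _ _ _).
rewrite form_bil // form_bil_r //.
have -> : - lsum (fun i => sg K (~~ s) / 2 * form u (phi (Bos (~~ s)) i
     (phi (Bos (~~ s)) (- n - i) v))) = lsum (fun i => - (sg K (~~ s) / 2 * form u (phi (Bos (~~ s)) i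
     (phi (Bos (~~ s)) (- n - i) v)))).
  rewrite -[LHS]/(GRing.opp _) raddf_lsum //.
  have [A hA] := @fsupp_bil K (Bos (~~ s)) (Bos (~~ s)) (e _) (fun=> sg K (~~ s) / 2) (- n) v.
  by exists A => i /hA h; rewrite -formZr h form0r.
rewrite -[RHS](lsum_refl 0); apply: eq_lsum => i /=.
rewrite !mulr1 sub0r opprK (_ : - n + i = - (n - i)); last by lia.
rewrite [in RHS]bosC_same.
by case: s; rewrite /sg /=; field.
Qed.

Lemma form_G s m u v : form (cur (gG s) m u) v = sg K (~~ s) * form u (cur (gGbar (~~ s)) (1 - m) v).
Proof.
have e r f : om0 K (Bos r) (Fer f) = 0 by case: r.
rewrite -[cur _ _ u]/(bil _ _ _ _ _) -[cur _ _ v]/(bil _ _ _ _ _).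
rewrite form_bil // form_bil_r //.
set F := fun i => _; set G := fun i => _.
have -> : sg K (~~ s) * lsum G = lsum (fun i => sg K (~~ s) * G i).
  have [A hA] := @fsupp_bil K (Bos (~~ s)) (Fer false) (e _ _)
    (fun i => - sg K (~~ s) * ((1 - m - 1 - i)%:~R + 2^-1)) (1 - m - 1) v.
  have hG i : i \notin A -> G i = 0 by move=> /hA h; rewrite /G -formZr h form0r.
  by rewrite (lsumE hG) (@lsumE _ _ A) ?mulr_sumr // => i /hG ->; rewrite mulr0.
rewrite -[RHS](lsum_refl 0); apply: eq_lsum => i; rewrite /F /G /=.
rewrite sub0r -bos_fer opprK (_ : 1 - m - 1 + i = - (m - 1 - i) - 1); last by lia.
move: (m - 1 - i) => k; rewrite rmorphB rmorphN /=; move: (form _ _) (_%:~R) => a b.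
by case: (s); rewrite /sg /=; field.
Qed.

Lemma form_Gb s m u v : form (cur (gGbar s) m u) v = sg K s * form u (cur (gG (~~ s)) (1 - m) v).
Proof.
have := form_G (~~ s) (1 - m) v u; rewrite !negbK form_sym => ->.
rewrite mulrA (_ : sg K s * sg K s = 1) ?mul1r; last by case: s; rewrite /sg ?mulrNN mulr1.
by rewrite form_sym (_ : 1 - (1 - m) = m) //; lia.
Qed.

End ContravariantForm.

(** * Each sector is generated by its singular vector *)

Section Generation.
Variable K : numFieldType.
Notation fock := (fock K).
Notation vac := (vac K).
Implicit Types (u v w : fock) (b : occ) (m n k i : int) (s : bool) (d : grade).

(* a weight with finitely many states below each bound, lowered by all
   positive modes and by J^+_0 *)
Definition wt d : int := d.1.1 *+ 2 - d.1.2.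

Lemma wtD d d' : wt (d + d') = wt d + wt d'.
Proof. by rewrite /wt /=; lia. Qed.

Lemma wt_bounds b : [/\ 0 <= wt (deg b), forall i : slot, (b.1 i)%:Z <= wt (deg b),
  forall i : slot, (0 < b.1 i)%N -> i.2%:Z < wt (deg b)
  & forall i : slot, i \in b.2 -> i.2%:Z < wt (deg b)].
Proof.
elim/occ_ind: b => [|j M A [h0 h1 h2 h3]|j M A jA [h0 h1 h2 h3]].
- by rewrite deg0; split=> // i; rewrite ?mset0E ?in_fset0.
- have hj : wt (bdeg j) >= (j.2.*2).*2%:Z + 1 by rewrite /wt /bdeg; case: j => [[] n] /=; lia.
  rewrite deg_madd wtD; move: (wt (bdeg j)) (wt (deg (M, A))) hj h0 h1 h2 h3 => x y hj h0 h1 h2 h3.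
  split=> [|i|i|i] /=; rewrite ?maddE.
  + by clear -hj h0; lia.
  + by have /= := h1 i; case: (i == j) => /=; clear -hj; lia.
  + have /= := h2 i; have [->|_] := eqVneq i j; first by clear -hj h0; lia.
    by rewrite add0n => h /h; clear -hj h0; lia.
  + by move=> /h3; clear -hj h0; lia.
have hj : wt (fdeg j) >= j.2%:Z + 1 by rewrite /wt /fdeg; case: j {jA} => [[] n] /=; lia.
rewrite deg_flip (negPf jA) wtD; move: (wt (fdeg j)) (wt (deg (M, A))) hj h0 h1 h2 h3 => x y hj h0 h1 h2 h3.
split=> [|i|i|i] /=.
- by clear -hj h0; lia.
- by have /= := h1 i; clear -hj; lia.
- by move=> /h2 /=; clear -hj h0; lia.
rewrite in_flip; have [->|_ /=] := eqVneq i j; first by clear -hj h0; lia.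
by move=> /h3; clear -hj h0; lia.
Qed.

Lemma wt_occs N b : wt (deg b) < N%:Z -> b \in occs N.
Proof.
have [h0 h1 h2 h3] := wt_bounds b => hN; rewrite mem_occs; apply/and3P.
move: (wt (deg b)) h0 h1 h2 h3 hN => x h0 h1 h2 h3 hN; split; apply/allP => i /=.
- by move=> _; rewrite -ltz_nat; apply: le_lt_trans (h1 i) hN.
- by rewrite finsupp_gt0 => /h2 h; rewrite -ltz_nat; apply: lt_trans h hN.
- by move=> /h3 h; rewrite -ltz_nat; apply: lt_trans h hN.
Qed.

Lemma ofdeg_supp d (A : {linear fock -> fock}) b' v : ofdeg d A ->
  coeff b' (A v) != 0 -> exists2 b, coeff b v != 0 & deg b' = deg b + d.
Proof.
move=> hA; apply: contraPP => h; apply/negP; rewrite negbK; apply/eqP.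
rewrite (fockE v) linear_sum /= (raddf_sum (coeff b')) big_seq big1 // => b.
rewrite fsupP => hb; rewrite linearZ /= coeffZ; apply/eqP; rewrite mulf_eq0 orbC.
apply/orP; left; apply: contraT => hb'; exfalso; apply: h; exists b => //.
by apply: (hA _ _ (@homog_ket K b)).
Qed.

Definition closed (P : fock -> Prop) := [/\ P 0, forall c u v, P u -> P v -> P (c *: u + v)
  & forall A m v, P v -> P (cur A m v)].

Definition wbound (N : nat) v := forall b, coeff b v != 0 -> wt (deg b) < N%:Z.

Lemma wbound_exists v : exists N, wbound N v.
Proof.
exists (\sum_(b <- fsup v) `|wt (deg b)|).+1%N => b; rewrite -fsupP => bv.
by rewrite (big_fsetD1 b bv) /=; lia.
Qed.

Lemma wbound_cur N A m v : wt (curdeg A m) < 0 -> wbound N.+1 v -> wbound N (cur A m v).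
Proof.
move=> hA hv b' /(@ofdeg_supp (curdeg A m) (@cur K A m)) [|b /hv hb ->]; first exact: cur_ofdeg.
by rewrite wtD; lia.
Qed.

Lemma mode_index_gt0 A m : 0 < mode_index A m ->
  match A with gL => (2 <= m)%R | _ => (1 <= m)%R end.
Proof.
have e (x y : int) : x%:~R < y%:~R :> rat -> (x < y)%R by rewrite ltr_int.
rewrite /mode_index; case: A => [||s|s|s] /= h.
- by suff /e : 1%:~R < m%:~R :> rat; [lia | move: h; move: (m%:~R : rat) => x; lra].
- by suff /e : 0%:~R < m%:~R :> rat; [lia | move: h; move: (m%:~R : rat) => x; lra].
- by suff /e : 0%:~R < m%:~R :> rat; [lia | move: h; move: (m%:~R : rat) => x; lra].
- by suff /e : 0%:~R < m%:~R :> rat; [lia | move: h; move: (m%:~R : rat) => x; lra].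
- by suff /e : 0%:~R < m%:~R :> rat; [lia | move: h; move: (m%:~R : rat) => x; lra].
Qed.

Lemma wt_positive A m : 0 < mode_index A m -> wt (curdeg A m) < 0.
Proof. by move=> /mode_index_gt0; case: A => [||[]|[]|[]]; rewrite /wt /=; lia. Qed.

(** As long as some mode of negative [wt] does not kill the vector, apply it. This stays in [P] and
    stops, because the weights of states are nonnegative. *)
Lemma singular_exists P w : closed P -> P w -> w != 0 ->
  exists y, [/\ P y, y != 0 & exists a c, y = a *: vac + c *: phi (Bos false) 0 vac].
Proof.
move=> [P0 PD Pcur]; have [N hN] := wbound_exists w.
elim: N w hN => [|N IH] w hN Pw w0.
  case/eqP: w0; apply: fockP => b; rewrite raddf0; apply/eqP; apply: contraT => /hN.
  by have [] := wt_bounds b; lia.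
have [/asboolP hs|/asboolPn hs] := boolP `[< (forall A m, 0 < mode_index A m -> cur A m w = 0)
    /\ cur (gJ true) 0 w = 0 >].
  by exists w; split=> //; case: hs => h1 h2; apply: singular_vector.
have [A [m [hA hw]]] : exists A m, wt (curdeg A m) < 0 /\ cur A m w != 0.
  apply/not_existsP => h; apply: hs.
  have h' A m : wt (curdeg A m) < 0 -> cur A m w = 0.
    move=> hA; apply/eqP; apply: contraT => hw; exfalso; apply: (h A); by exists m.
  by split=> [A m /wt_positive /h'|]; last exact: h'.
by apply: IH hw; [exact: wbound_cur | exact: Pcur].
Qed.

(** The parity of the number of all quanta, which the currents preserve because they are
    bilinear. *)
Definition bodd b : bool := odd `|(deg b).1.2 + (deg b).2|.
Definition bsector (o : bool) v := forall b, coeff b v != 0 -> bodd b = o.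

Lemma bsector_cur o A m v : bsector o v -> bsector o (cur A m v).
Proof.
move=> hv b' /(@ofdeg_supp (curdeg A m) (@cur K A m)) [|b /hv hb e]; first exact: cur_ofdeg.
rewrite -hb /bodd e; move: (deg b) => [[d1 d2] d3].
by case: A {e} => [||[]|[]|[]] /=; lia.
Qed.

Lemma bsectorP o c u v : bsector o u -> bsector o v -> bsector o (c *: u + v).
Proof.
move=> hu hv b; rewrite coeffD coeffZ; have [->|/hu //] := eqVneq (coeff b u) 0.
by rewrite mulr0 add0r => /hv.
Qed.

Definition occ1 : occ := (madd (false, 0%N) mset0, fset0).
Definition occt (o : bool) : occ := if o then occ1 else occ0.

Lemma deg1 : deg occ1 = (0, -1, 0).
Proof. by rewrite deg_madd -[(mset0, fset0)]/occ0 deg0 addr0. Qed.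

Lemma bodd_occt o : bodd (occt o) = o.
Proof. by case: o; rewrite /bodd /occt ?deg0 ?deg1. Qed.

Lemma ket1 : ket K occ1 = phi (Bos false) 0 vac.
Proof. by rewrite phi_bos /bop /bsgn /= expr0 scale1r bcr_ket. Qed.

(** The singular vector found inside [P] is a combination of [vac] and [b^-_0 vac]. These lie in
    different sectors, so that only the generator of the sector of [w] can occur. *)
Lemma sector_generator o P w : closed P -> bsector o w -> P w -> w != 0 -> P (ket K (occt o)).
Proof.
move=> [P0 PD Pcur] hw Pw w0.
have cQ : closed (fun v => P v /\ bsector o v).
  split=> [|c u v [h1 h2] [h3 h4]|A m v [h1 h2]].
  - by split=> // b; rewrite raddf0 eqxx.
  - by split; [exact: PD | exact: bsectorP].
  - by split; [exact: Pcur | exact: bsector_cur].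
have [y [[Py hy] y0 [a [c e]]]] := singular_exists cQ (conj Pw hw) w0.
have ne : occ0 != occ1 by apply/eqP => h; have := deg1; rewrite -h deg0.
have ca : coeff occ0 y = a.
  by rewrite e -ket1 coeffD !coeffZ !coeff_ket eqxx (eq_sym occ1) (negPf ne) mulr0 addr0 mulr1.
have cc : coeff occ1 y = c.
  by rewrite e -ket1 coeffD !coeffZ !coeff_ket eqxx (negPf ne) mulr0 add0r mulr1.
have PZ x v : P v -> P (x *: v) by move=> Pv; rewrite -[_ *: v]addr0; apply: PD.
case: o hw hy {cQ} => hw hy /=.
  have a0 : a = 0.
    by apply/eqP; apply: contraT; rewrite -ca => /hy; rewrite -[occ0]/(occt false) bodd_occt.
  have c0 : c != 0 by apply: contra_neq y0 => c0; rewrite e a0 c0 !scale0r addr0.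
  rewrite -[ket K _]scale1r -(mulVf c0) -scalerA; apply: PZ.
  by rewrite ket1; move: Py; rewrite e a0 scale0r add0r.
have c0 : c = 0.
  by apply/eqP; apply: contraT; rewrite -cc => /hy; rewrite -[occ1]/(occt true) bodd_occt.
have a0 : a != 0 by apply: contra_neq y0 => a0; rewrite e a0 c0 !scale0r addr0.
rewrite -[ket K _]scale1r -(mulVf a0) -scalerA; apply: PZ.
by move: Py; rewrite e c0 scale0r addr0.
Qed.

Definition proj d : fock -> fock := lext (fun b => if deg b == d then ket K b else 0).

Lemma proj_ket d b : proj d (ket K b) = if deg b == d then ket K b else 0.
Proof. exact: lext_ket. Qed.

Lemma proj_linear d c u v : proj d (c *: u + v) = c *: proj d u + proj d v.
Proof. exact: linearP. Qed.

Lemma coeff_proj d b v : coeff b (proj d v) = if deg b == d then coeff b v else 0.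
Proof.
move: v; apply: fock_ind => [|c u v hu hv|b'].
- by rewrite /proj !raddf0 if_same.
- by rewrite proj_linear !coeffD !coeffZ hu hv; case: ifP => // _; rewrite mulr0 addr0.
rewrite proj_ket; case: (eqVneq b' b) => [->|nb].
  by case: ifP => _; rewrite ?coeff_ket ?raddf0.
by rewrite !coeff_ket (negPf nb) if_same; case: ifP => _; rewrite ?coeff_ket ?raddf0 ?(negPf nb).
Qed.

Lemma proj_cur d A m v : proj d (cur A m v) = cur A m (proj (d - curdeg A m) v).
Proof.
move: v; apply: fock_ind => [|c u v hu hv|b].
- by rewrite /proj !raddf0.
- by rewrite cur_linear !proj_linear cur_linear hu hv.
have hb : homog (deg b + curdeg A m) (cur A m (ket K b)).
  by apply: cur_ofdeg; apply: homog_ket.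
rewrite proj_ket -(inj_eq (addIr (curdeg A m))) subrK.
apply: fockP => b'; rewrite coeff_proj; case: eqP => [e|ne]; case: eqP => [e'|ne'] //.
- by rewrite raddf0 raddf0; apply/eqP; apply: contraT => /hb h; rewrite -h e in ne'.
- by apply/esym/eqP; apply: contraT => /hb h; rewrite h e' in ne.
by rewrite !raddf0.
Qed.

(** Among the matrices whose row space lies in [P] one of maximal rank has row space [P]. As [P] is
    proper its rank is not full, and any nonzero column of its cokernel annihilates [P]. *)
Lemma rV_annihilator (n : nat) (P : 'rV[K]_n -> Prop) r : P 0 ->
  (forall c x y, P x -> P y -> P (c *: x + y)) -> ~ P r ->
  exists2 c : 'cV[K]_n, c != 0 & forall x, P x -> x *m c = 0.
Proof.
move=> P0 PD nPr; have PZ c x : P x -> P (c *: x).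
  by move=> h; rewrite -[_ *: x]addr0; apply: PD.
pose good (k : nat) := `[< exists A : 'M[K]_n, (forall x, P (x *m A)) /\ \rank A = k >].
have g0 : exists k : nat, good k.
  by exists 0%N; apply/asboolP; exists 0; rewrite mxrank0; split=> // x; rewrite mulmx0.
have gb (k : nat) : good k -> (k <= n)%N by move=> /asboolP[A [_ <-]]; apply: rank_leq_row.
case: (ex_maxnP g0 gb) => k /asboolP[A [hA rA]] kmax.
have sub x : P x -> (x <= A)%MS.
  move=> Px; apply: contraT => nx.
  have : good (\rank (A + x)%MS).
    apply/asboolP; exists (A + x)%MS; split=> // y.
    have /sub_addsmxP[[y1 y2] /= ->] : (y *m (A + x)%MS <= A + x)%MS by apply: submxMl.
    rewrite -[y1 *m A]scale1r; apply: PD => //.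
    by rewrite (mx11_scalar y2) mul_scalar_mx; apply: PZ.
  move/kmax; rewrite leqNgt -rA => /negP[]; apply: rank_ltmx.
  by rewrite /ltmx addsmxSl /=; apply: contra nx => /(submx_trans (addsmxSr A x)).
have cA : cokermx A != 0.
  apply: contra_notN nPr => /eqP e; have : row_full A.
    by rewrite -sub1mx submxE e mulmx0.
  by move=> /(submx_full r) /submxP[D ->].
have [j hj] : exists j, col j (cokermx A) != 0.
  apply/not_existsP => h; case/eqP: cA; apply/matrixP => i j.
  have /negP := h j; rewrite negbK => /eqP /matrixP/(_ i 0); by rewrite !mxE.
exists (col j (cokermx A)) => // x /sub; rewrite submxE => /eqP e.
by rewrite colE mulmxA e mul0mx.
Qed.

(** Otherwise the form yields a nonzero vector of the sector orthogonal to the homogeneous parts of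
    [U]. The orthogonal complement is stable, so that it contains the generator by
    [sector_generator]; but the generator also lies in [U] and has nonzero norm. *)
Lemma fock_generated o U v : closed U -> U (ket K (occt o)) -> bsector o v -> U v.
Proof.
move=> cU Uo; have [U0 UD Ucur] := cU.
have UZ c x : U x -> U (c *: x) by move=> Ux; rewrite -[_ *: x]addr0; apply: UD.
suff H b : bodd b = o -> U (ket K b).
  move=> hv; rewrite (fockE v) big_seq; elim/big_ind: _ => //.
    by move=> x y hx hy; rewrite -[x]scale1r; apply: UD.
  by move=> b; rewrite fsupP => /hv hb; apply/UZ/H.
move=> ob; apply: contrapT => nU.
(* The graded part of [U]. It is needed because the functional below is controlled only on the
   component of degree [d]. *)
pose U' x := forall d, U (proj d x).
have [U'0 U'D U'cur] : closed U'.
  split=> [d|c x y hx hy d|A m x hx d]; first by rewrite /proj raddf0.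
    by rewrite proj_linear; apply: UD.
  by rewrite proj_cur; apply: Ucur.
have U'o : U' (ket K (occt o)) by move=> d; rewrite proj_ket; case: ifP.
pose d := deg b; pose N := `|wt d|.+1.
pose B := [seq b' <- occs N | deg b' == d]; pose n := size B.
have uB : uniq B by rewrite filter_uniq // occs_uniq.
have memB b' : (b' \in B) = (deg b' == d).
  rewrite mem_filter; case: eqP => //= e; rewrite wt_occs // e /N; lia.
pose nb (j : 'I_n) := nth occ0 B j.
have nbI : injective nb.
  move=> j j' h; apply: ord_inj; rewrite -(index_uniq occ0 (ltn_ord j) uB).
  by rewrite -/(nb j) h /nb index_uniq.
pose vec (x : 'rV[K]_n) : fock := \sum_j x 0 j *: ket K (nb j).
have vecD c x y : vec (c *: x + y) = c *: vec x + vec y.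
  rewrite scaler_sumr -big_split; apply: eq_bigr => j _ /=.
  by rewrite !mxE scalerDl scalerA.
have expand x : proj d x = vec (\row_j coeff (nb j) x).
  apply: fockP => b'; rewrite coeff_proj raddf_sum -memB.
  under eq_bigr => j _ do rewrite /= coeffZ coeff_ket mxE.
  case: ifP => hb'.
    have hi : (index b' B < n)%N by rewrite index_mem.
    rewrite (bigD1 (Ordinal hi)) //= /nb nth_index // eqxx mulr1 big1 ?addr0 // => j nj.
    case: eqP => [e|_]; last by rewrite mulr0.
    by case/eqP: nj; apply: val_inj => /=; rewrite -e index_uniq.
  rewrite big1 // => j _; case: eqP => [e|_]; last by rewrite mulr0.
  by rewrite -e mem_nth in hb'.
have [|||c c0 hc] := @rV_annihilator n (fun x => U (vec x)) (\row_j coeff (nb j) (ket K b)).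
- by rewrite /vec big1 // => j _; rewrite mxE scale0r.
- by move=> a x y hx hy; rewrite vecD; apply: UD.
- by rewrite -expand proj_ket eqxx.
(* The vector that represents the functional [c]: the form is diagonal, so that dividing by the
   norms suffices. *)
pose w := vec (\row_j (c j 0 / knorm K (nb j))).
have formw x : form w x = \sum_j c j 0 * coeff (nb j) x.
  rewrite form_sym raddf_sum; apply: eq_bigr => j _.
  by rewrite /= formZr form_sym form_ketl mxE mulrA divfK ?knorm_neq0.
pose W x := forall u, U' u -> form x u = 0.
have Ww : W w.
  move=> u /(_ d); rewrite expand formw => /hc /matrixP/(_ 0 0); rewrite !mxE => e.
  by rewrite -[RHS]e; apply: eq_bigr => j _; rewrite mxE mulrC.
have w0 : w != 0.
  apply: contra_neq c0 => e; apply/matrixP => j j0; rewrite ord1 [RHS]mxE.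
  have := formw (ket K (nb j)); rewrite e form0l (bigD1 j) //= coeff_ket eqxx mulr1.
  rewrite big1 ?addr0 // => j' nj; rewrite coeff_ket; case: eqP => [h|_]; last by rewrite mulr0.
  by case/eqP: nj; apply/nbI.
have cW : closed W.
  have WD a x y : W x -> W y -> W (a *: x + y).
    by move=> hx hy u Uu; rewrite formPl hx // hy // mulr0 addr0.
  have WJ s m x : W x -> W (cur (gJ s) m x).
    by move=> hx u Uu; rewrite form_J hx ?oppr0 //; apply: U'cur.
  have WG s m x : W x -> W (cur (gG s) m x).
    by move=> hx u Uu; rewrite form_G hx ?mulr0 //; apply: U'cur.
  have WGb s m x : W x -> W (cur (gGbar s) m x).
    by move=> hx u Uu; rewrite form_Gb hx ?mulr0 //; apply: U'cur.
  have WJ0 m x : W x -> W (cur gJ0 m x).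
    move=> hx; rewrite -[cur gJ0 m x]/(Jz m x) JzE addrC -scaleN1r.
    by apply: (WD); apply: (WJ); apply: (WJ).
  split=> //; first by move=> u _; exact: form0l.
  case=> [||s|s|s] m x hx; [|exact: WJ0|exact: WJ|exact: WG|exact: WGb].
  rewrite -[cur gL m x]/(Lz m x) LzE addrC; apply: (WD); first exact: WJ0.
  by rewrite -[X in X + _]scale1r; apply: (WD); [apply: (WG); apply: (WGb) | apply: (WGb); apply: (WG)].
have sw : bsector o w.
  move=> b'; rewrite /w /vec raddf_sum => h.
  suff e : deg b' = d by rewrite -ob /bodd e.
  apply: contra_neqP h => nd; apply: big1 => j _ /=.
  rewrite coeffZ coeff_ket; case: eqP => [e|_]; last by rewrite mulr0.
  by case: nd; apply/eqP; rewrite -memB -e mem_nth.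
have Wo : W (ket K (occt o)) := sector_generator cW sw Ww w0.
have := Wo _ U'o.
by rewrite form_ketl coeff_ket eqxx mulr1; apply/eqP/knorm_neq0.
Qed.

End Generation.

(** * Comparison with an irreducible module *)

Section HighestWeight.
Variables (R : realType) (c : R[i]).
Notation C := R[i].

Lemma ffact0 n : int_ffact R n 0 = 1.
Proof. by rewrite /int_ffact big_ord0. Qed.

Lemma ffact1 n : int_ffact R n 1 = n%:~R.
Proof. by rewrite /int_ffact big_ord_recr big_ord0 /= mul1r subr0. Qed.

Lemma der_mode0 (V : lmodType C) (act : gen -> int -> V -> V) o n (v : V) :
  der_mode act 0 o n v = field_mode act o n v.
Proof. by rewrite /der_mode ffact0 expr0 mulr1 scale1r subr0. Qed.

Lemma der_mode1 (V : lmodType C) (act : gen -> int -> V -> V) o n (v : V) :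
  der_mode act 1 o n v = (- n%:~R) *: field_mode act o (n - 1) v.
Proof. by rewrite /der_mode ffact1 expr1 mulN1r. Qed.

Definition bracket_law (M : lmodType C) (act : gen -> int -> M -> M) :=
  forall a b m n v,
    match lbracket c a b, lbracket c b a with
    | Some ts, _ => supercomm act a m b n v = bracket_mode act ts m n v
    | None, None => supercomm act a m b n v = 0
    | None, Some _ => True
    end.

Definition act_linear (M : lmodType C) (act : gen -> int -> M -> M) :=
  forall a m (k : C) u v, act a m (k *: u + v) = k *: act a m u + act a m v.

Definition modes_weight (a : gen) (m : int) : int := wt (curdeg a m).

Variables (M : lmodType C) (act : gen -> int -> M -> M).
Hypotheses (actP : act_linear act) (actB : bracket_law act).
Implicit Types (u v : M).

Lemma act0 a m : act a m 0 = 0.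
Proof. by have := actP a m (-1) 0 0; rewrite scaler0 addr0 scaleN1r addNr. Qed.

Lemma actD a m u v : act a m (u + v) = act a m u + act a m v.
Proof. by have := actP a m 1 u v; rewrite !scale1r. Qed.

Lemma actZ a m k u : act a m (k *: u) = k *: act a m u.
Proof. by have := actP a m k u 0; rewrite act0 !addr0. Qed.

Lemma actN a m u : act a m (- u) = - act a m u.
Proof. by rewrite -scaleN1r actZ scaleN1r. Qed.

Lemma supercomm_in (Q : M -> Prop) a m b n u :
  Q 0 -> (forall k x y, Q x -> Q y -> Q (k *: x + y)) ->
  Q u -> (forall d j, Q (act d j u)) -> Q (supercomm act a m b n u).
Proof.
move=> Q0 QD Qu Qact; have QZ k x : Q x -> Q (k *: x).
  by move=> h; rewrite -[_ *: x]addr0; apply: QD.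
have QB ts i j : Q (bracket_mode act ts i j u).
  rewrite /bracket_mode; elim/big_ind: _ => // [x y hx hy|t _].
    by rewrite -[x]scale1r; apply: QD.
  apply/QZ/QZ; case: (lfield t) => [d|] /=; first exact: Qact.
  by case: ifP.
have := actB a b m n u; have := actB b a n m u.
case: (lbracket c a b) => [ts _ -> //|]; case: (lbracket c b a) => [ts e _|_ -> //].
(* The table lists only one order of each pair; skew-symmetry gives the other one. *)
have -> : supercomm act a m b n u =
    - ((-1) ^+ (parity a && parity b)) *: supercomm act b n a m u.
  rewrite /supercomm (andbC (parity b)).
  case: (_ && _); rewrite ?expr0 ?expr1 ?scale1r ?scaleN1r ?opprK ?scale1r ?opprK.
    by rewrite addrC.
  by rewrite opprB.
by apply: QZ; rewrite e.
Qed.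

Lemma supercommE a m b n u : act a m (act b n u) =
  (-1) ^+ (parity a && parity b) *: act b n (act a m u) + supercomm act a m b n u.
Proof. by rewrite /supercomm addrC subrK. Qed.

Variables (h s : C) (x0 : M).
Hypothesis x0pos : forall a m, 0 < mode_index a m -> act a m x0 = 0.
Hypothesis x0J : act (gJ true) 0 x0 = 0.
Hypothesis x0L : act gL 1 x0 = h *: x0.
Hypothesis x0J0 : act gJ0 0 x0 = s *: x0.

(** The span of the words of at most [n] lowering modes applied to [x0], where lowering means
    raising the eigenvalue of [4 L_0 - J^0_0]. No ordering of the words is imposed, since only
    spanning is needed. *)
Inductive fil : nat -> M -> Prop :=
| fil0 n : fil n 0
| filx n : fil n x0
| filP n k u v : fil n u -> fil n v -> fil n (k *: u + v)
| filS n a m u : 0 < modes_weight a m -> fil n u -> fil n.+1 (act a m u)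
| filW n u : fil n u -> fil n.+1 u.

Lemma filZ n k u : fil n u -> fil n (k *: u).
Proof. by move=> hu; rewrite -[_ *: u]addr0; apply: filP => //; apply: fil0. Qed.

Lemma nonlowering_x0 a m : ~~ (0 < modes_weight a m) -> exists k, act a m x0 = k *: x0.
Proof.
rewrite -leNgt => hw; have [/x0pos ->|hn] := boolP (0 < mode_index a m).
  by exists 0; rewrite scale0r.
have e (x y : int) : x%:~R <= y%:~R :> rat -> (x <= y)%R by rewrite ler_int.
move: hw hn; rewrite /modes_weight /wt -leNgt /mode_index.
case: a => [||s'|s'|s'] /= hw hn.
- exists h; rewrite (_ : m = 1) //; suff /e : m%:~R <= 1%:~R :> rat; first lia.
  by move: hn; move: (m%:~R : rat) => x; lra.
- exists s; rewrite (_ : m = 0) //; suff /e : m%:~R <= 0%:~R :> rat; first lia.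
  by move: hn; move: (m%:~R : rat) => x; lra.
- have /e hm : m%:~R <= 0%:~R :> rat by move: hn; move: (m%:~R : rat) => x; lra.
  case: s' hw => hw; last by exfalso; lia.
  by exists 0; rewrite (_ : m = 0) ?x0J ?scale0r //; lia.
- have : m%:~R <= (1%:~R / 2) :> rat by move: hn; move: (m%:~R : rat) => x; lra.
  have hm1 : 1 <= m by case: s' hw => /=; lia.
  have : 1%:~R <= m%:~R :> rat by rewrite ler_int.
  by move: (m%:~R : rat) => x; lra.
have : m%:~R <= (1%:~R / 2) :> rat by move: hn; move: (m%:~R : rat) => x; lra.
have hm1 : 1 <= m by case: s' hw => /=; lia.
have : 1%:~R <= m%:~R :> rat by rewrite ler_int.
by move: (m%:~R : rat) => x; lra.
Qed.

(** The easy half of Poincare-Birkhoff-Witt: a mode that is not lowering is moved to the right until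
    it meets [x0], on which it acts by a scalar, and each commutator shortens the word. Hence the
    words in lowering modes span a submodule. *)
Lemma fil_act n u : fil n u -> forall a m, fil n.+1 (act a m u) /\
  (~~ (0 < modes_weight a m) -> fil n (act a m u)).
Proof.
elim=> {n u} [n|n|n k u v _ IHu _ IHv|n b j u hb hu IHu|n u hu IHu] a m.
- by rewrite act0; split=> *; apply: fil0.
- have [hl|hl] := boolP (0 < modes_weight a m); first by split=> //; apply: filS => //; apply: filx.
  have [k ->] := nonlowering_x0 hl.
  by split=> *; apply: filZ; apply: filx.
- have [hu1 hu2] := IHu a m; have [hv1 hv2] := IHv a m; rewrite actP; split=> [|hl].
    exact: filP.
  by apply: filP; [apply: hu2 | apply: hv2].
- have [hl|hl] := boolP (0 < modes_weight a m).
    by split=> //; apply: filS => //; apply: filS.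
  have key : fil n.+1 (act a m (act b j u)).
    rewrite supercommE; apply: filP; first by apply: filS => //; apply: (IHu a m).2.
    apply: supercomm_in => [|k x y|| d i]; [exact: fil0 | exact: filP | exact: filW |].
    exact: (IHu d i).1.
  by split=> [|_]; [exact: filW | exact: key].
have [h1 h2] := IHu a m; split=> [|hl2]; apply: filW; first exact: h1.
exact: h2.
Qed.

Definition gen_by u := exists n, fil n u.

Lemma fil_le n m u : (n <= m)%N -> fil n u -> fil m u.
Proof.
move=> /subnK <-; elim: (m - n)%N => //= k IH hu; rewrite addSn.
exact/filW/IH.
Qed.

Lemma gen_by0 : gen_by 0.
Proof. by exists 0%N; apply: fil0. Qed.

Lemma gen_byx : gen_by x0.
Proof. by exists 0%N; apply: filx. Qed.

Lemma gen_byP k u v : gen_by u -> gen_by v -> gen_by (k *: u + v).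
Proof.
move=> [n hn] [m hm]; exists (maxn n m); apply: filP.
  by apply: fil_le hn; apply: leq_maxl.
by apply: fil_le hm; apply: leq_maxr.
Qed.

Lemma gen_by_act a m u : gen_by u -> gen_by (act a m u).
Proof. by move=> [n /fil_act h1]; exists n.+1; case: (h1 a m). Qed.

(* its eigenvalue increases under all lowering modes, including J^-_0 *)
Definition Top u : M := 4 *: act gL 1 u - act gJ0 0 u.

Lemma TopP k u v : Top (k *: u + v) = k *: Top u + Top v.
Proof.
rewrite /Top !actP scalerDr opprD !scalerBr !scalerA (mulrC 4) -!addrA; congr (_ + _).
by rewrite addrCA.
Qed.

Lemma L0_act a m u : act gL 1 (act a m u) =
  act a m (act gL 1 u) + (ratr (conf_weight a) - (m + 1)%:~R) *: act a m u.
Proof.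
have := actB gL a 1 m u; rewrite /supercomm /= expr0 scale1r.
have e : int_ffact R 1 3 = 0 by rewrite /int_ffact !big_ord_recr /= subrr mulr0 mul0r.
have key : bracket_mode act [:: LTerm 1 0 1 (Some a); LTerm (ratr (conf_weight a)) 1 0 (Some a)]
    1 m u = (ratr (conf_weight a) - (m + 1)%:~R) *: act a m u.
  rewrite /bracket_mode !big_cons big_nil /= addr0 der_mode0 der_mode1 /= ffact0 ffact1.
  rewrite !mulr1 scale1r addr0 -scalerDl addrC (_ : 1 + m = m + 1); last by lia.
  by congr ((_ + _) *: act a _ u); lia.
case: a key => [||s'|s'|s'] key /eqP; rewrite subr_eq => /eqP ->; rewrite addrC; congr (_ + _); try exact: key.
rewrite -key /bracket_mode !big_cons !big_nil /= e ratr_nat.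
by rewrite mulr0 scale0r !addr0.
Qed.

Definition charge (a : gen) : int :=
  match a with gL | gJ0 => 0 | gJ s => if s then 2 else - 2 | gG s | gGbar s => if s then 1 else -1 end.

Lemma J0_act a m u : act gJ0 0 (act a m u) = act a m (act gJ0 0 u) + (charge a)%:~R *: act a m u.
Proof.
case: a => [||s'|s'|s'] /=.
- have := actB gL gJ0 m 0 u; rewrite /supercomm /= expr0 scale1r => /eqP.
  rewrite /bracket_mode !big_cons big_nil /= der_mode0 der_mode1 /= ffact0 ffact1 rmorph1.
  rewrite (_ : m + 0 - 0%:Z - 1 = m + 0 - 1%:Z); last by lia.
  rewrite addr0 mulr1 scale1r mul1r subr0 addr0 -scalerDl addNr scale0r.
  by rewrite subr_eq0 scale0r addr0 => /eqP ->.
- have := actB gJ0 gJ0 0 m u; rewrite /supercomm /= expr0 scale1r => /eqP.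
  rewrite /bracket_mode !big_cons big_nil /= !ffact1 mulr0 scale0r addr0.
  by rewrite subr_eq0 => /eqP ->; rewrite scale0r addr0.
all: have H b := actB gJ0 b 0 m u.
- have := H (gJ s'); rewrite /supercomm /= expr0 scale1r => /eqP; rewrite subr_eq => /eqP ->.
  rewrite /bracket_mode !big_cons big_nil /= der_mode0 /= ffact0 mulr1 addr0 add0r subr0.
  by rewrite addrC /sgnC; case: s'; rewrite ?mul1r ?mulN1r.
- have := H (gG s'); rewrite /supercomm /= expr0 scale1r => /eqP; rewrite subr_eq => /eqP ->.
  rewrite /bracket_mode !big_cons big_nil /= der_mode0 /= ffact0 mulr1 addr0 add0r subr0.
  by rewrite addrC /sgnC; case: s'.
have := H (gGbar s'); rewrite /supercomm /= expr0 scale1r => /eqP; rewrite subr_eq => /eqP ->.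
rewrite /bracket_mode !big_cons big_nil /= der_mode0 /= ffact0 mulr1 addr0 add0r subr0.
by rewrite addrC /sgnC; case: s'.
Qed.

Lemma Top_act a m u : Top (act a m u) = act a m (Top u) + (modes_weight a m)%:~R *: act a m u.
Proof.
rewrite /Top L0_act J0_act actD actN actZ scalerDr opprD addrACA; congr (_ + _).
rewrite scalerA -scalerBl; congr (_ *: _); rewrite ratr_weight /modes_weight /wt.
by case: a => [||[]|[]|[]] /=; rewrite ?rmorphB ?rmorphD ?rmorphN /= ?rmorphMn /= ?rmorphB ?rmorphD ?rmorphN /= ?rmorphMn /=; field.
Qed.

Let t0 : C := 4 * h - s.

Lemma Top_x0 : Top x0 = t0 *: x0.
Proof. by rewrite /Top x0L x0J0 scalerA -scalerBl. Qed.

(** Sums of eigenvectors of [Top] whose eigenvalues exceed that of [x0] by positive integers. *)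
Inductive above : M -> Prop :=
| above0 : above 0
| aboveP k u v : above u -> above v -> above (k *: u + v)
| aboveE (j : nat) u : Top u = (t0 + j.+1%:R) *: u -> above u.

Lemma fil_above n u : fil n u -> exists k y, above y /\ u = k *: x0 + y.
Proof.
elim=> {n u} [n|n|n k u v _ [ku [yu [hu ->]]] _ [kv [yv [hv ->]]]|n a m u ha _ [k [y [hy ->]]]|n u _ IH //].
- by exists 0, 0; rewrite scale0r addr0; split=> //; apply: above0.
- by exists 1, 0; rewrite scale1r addr0; split=> //; apply: above0.
- exists (k * ku + kv), (k *: yu + yv); split; first exact: aboveP.
  by rewrite scalerDr scalerDl scalerA addrACA.
exists 0, (act a m (k *: x0 + y)); split; last by rewrite scale0r add0r.
have [j ej] : exists j : nat, modes_weight a m = j.+1%:Z.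
  by exists `|modes_weight a m|.-1; lia.
rewrite actP; apply: aboveP.
  by apply: (@aboveE j); rewrite Top_act Top_x0 actZ -scalerDl ej.
elim: hy => [|k' u' v' _ IHu _ IHv|i u' eu].
- by rewrite act0; apply: above0.
- by rewrite actP; apply: aboveP.
apply: (@aboveE (i + j.+1)); rewrite Top_act eu actZ -scalerDl ej -addrA.
by rewrite -addSn natrD -[j.+1%:~R]/(j.+1%:R).
Qed.

(** The product of [Top - (t0 + j)] for [j] from 1 to [N]. It annihilates a given sum of higher
    eigenvectors once [N] is large, but is a nonzero scalar on the eigenvalue [t0]. *)
Fixpoint kill (N : nat) u : M :=
  if N is N'.+1 then Top (kill N' u) - (t0 + N%:R) *: kill N' u else u.

Lemma killP N k u v : kill N (k *: u + v) = k *: kill N u + kill N v.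
Proof.
have e t a b x y : k *: a + b - t *: (k *: x + y) = k *: (a - t *: x) + (b - t *: y) :> M.
  by rewrite scalerDr opprD addrACA scalerBr !scalerA (mulrC t).
by elim: N => //= N ->; rewrite TopP e.
Qed.

Lemma kill_eigen N t u : Top u = t *: u -> kill N u = (\prod_(j < N) (t - (t0 + j.+1%:R))) *: u.
Proof.
have TZ k v : Top (k *: v) = k *: Top v.
  have T0 : Top 0 = 0 by rewrite /Top !act0 scaler0 subr0.
  by have := TopP k v 0; rewrite T0 !addr0.
move=> e; elim: N => [|N IH]; first by rewrite big_ord0 scale1r.
by rewrite big_ord_recr /= IH TZ e !scalerA -scalerBl; congr (_ *: _); ring.
Qed.

Lemma above_kill u : above u -> exists N, forall m, (N <= m)%N -> kill m u = 0.
Proof.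
elim=> {u} [|k u v _ [N hN] _ [N' hN']|j u e].
- exists 0%N => m _; have := killP m 0 0 0; rewrite scale0r addr0 scale0r add0r => e.
  by have := killP m (-1) 0 0; rewrite scaler0 addr0 scaleN1r addNr.
- exists (maxn N N') => m; rewrite geq_max => /andP[h1 h2].
  by rewrite killP hN // hN' // scaler0 addr0.
exists j.+1 => m hm; rewrite (kill_eigen _ e) (bigD1 (Ordinal hm)) //= subrr mul0r scale0r.
by [].
Qed.

(** Modulo a multiple of [x0], the vector [u] is a sum of higher eigenvectors that also has
    eigenvalue [t0]; comparing the two effects of [kill] shows that this remainder is 0. *)
Lemma top_eigenvector u : gen_by u -> Top u = t0 *: u -> exists k, u = k *: x0.
Proof.
move=> [n /fil_above[k [y [hy eu]]]] hT; exists k.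
suff y0 : y = 0 by rewrite eu y0 addr0.
have Ty : Top y = t0 *: y.
  have -> : y = (- k) *: x0 + u by rewrite eu addrA -scalerDl addNr scale0r add0r.
  by rewrite TopP hT Top_x0 scalerDr !scalerA mulrC.
have [N /(_ N (leqnn _))] := above_kill hy; rewrite (kill_eigen _ Ty) => /eqP.
rewrite scaler_eq0 => /orP[|/eqP //]; rewrite prodf_seq_eq0 => /hasP[j _].
by rewrite /= opprD addrA subrr add0r oppr_eq0 pnatr_eq0.
Qed.

End HighestWeight.

(** * The diagonal submodule of a sum of two highest weight modules *)

Section PairOfModules.
Variables (R : realType) (c : R[i]) (V F : n4_module c).
Notation C := R[i].
Notation P := ((V : lmodType C) * (F : lmodType C))%type.

Definition pact a m (u : P) : P := (n4_act a m u.1, n4_act a m u.2).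

Lemma pact_linear : act_linear pact.
Proof. by move=> a m k [v f] [v' f']; rewrite /pact /= !n4_act_linear. Qed.

Lemma pbracket_mode ts m n (u : P) : bracket_mode pact ts m n u =
  (bracket_mode (@n4_act _ _ V) ts m n u.1, bracket_mode (@n4_act _ _ F) ts m n u.2).
Proof.
rewrite /bracket_mode; elim: ts => [|t ts IH]; first by rewrite !big_nil.
rewrite !big_cons IH; case: (lfield t) => [a|] //=.
by rewrite /der_mode /=; case: ifP => _ //; case: u {IH}.
Qed.

Lemma pact_bracket : bracket_law c pact.
Proof.
move=> a b m n [v f]; have hv := n4_act_bracket a b m n v; have hf := n4_act_bracket a b m n f.
case: (lbracket c a b) hv hf => [ts hv hf|]; last case: (lbracket c b a) => [//|hv hf].
  by rewrite pbracket_mode /= -hv -hf.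
rewrite -[RHS]/((0 : V), (0 : F)); rewrite -hv -hf //.
Qed.

Definition closed_act (M : n4_module c) (B : M -> Prop) :=
  [/\ B 0, forall k u v, B u -> B v -> B (k *: u + v) & forall a m u, B u -> B (n4_act a m u)].

Variables (h s : C) (v0 : V) (f0 : F) (S : F -> Prop).
Hypotheses (hv0 : highest_weight_vector h s v0) (hf0 : highest_weight_vector h s f0).
Hypotheses (irrV : irreducible_module V) (genV : generated_by v0).
Hypotheses (clS : closed_act S) (Sf0 : S f0).
(** The two halves of the irreducibility of [S], for stable subspaces that need not be compatible
    with the parity. *)
Hypothesis S_sub : forall B, closed_act B -> forall f, S f -> B f -> f <> 0 -> B f0.
Hypothesis S_gen : forall B, closed_act B -> B f0 -> forall f, S f -> B f.

Let x0 : P := (v0, f0).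
(** The submodule generated by the pair of highest weight vectors. It turns out to be the graph of a
    bijection between [V] and [S] that commutes with all modes. *)
Definition W : P -> Prop := gen_by pact x0.

Lemma x0pos a m : 0 < mode_index a m -> pact a m x0 = 0.
Proof.
by case: hv0 => _ _ [h1 _] _ _; case: hf0 => _ _ [h2 _] _ _ hm; rewrite /pact /= h1 ?h2.
Qed.

Lemma x0J : pact (gJ true) 0 x0 = 0.
Proof.
have e : mode_index (gJ true) 0 = 0 by [].
by case: hv0 => _ _ [_ h1] _ _; case: hf0 => _ _ [_ h2] _ _; rewrite /pact /= h1 ?h2.
Qed.

Lemma x0L : pact gL 1 x0 = h *: x0.
Proof. by case: hv0 => _ _ _ h1 _; case: hf0 => _ _ _ h2 _; rewrite /pact /= -[n4_act _ _ v0]/(op_L0 v0) h1 -[n4_act _ _ f0]/(op_L0 f0) h2. Qed.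

Lemma x0J0 : pact gJ0 0 x0 = s *: x0.
Proof. by case: hv0 => _ _ _ _ h1; case: hf0 => _ _ _ _ h2; rewrite /pact /= -[n4_act _ _ v0]/(op_J0 v0) h1 -[n4_act _ _ f0]/(op_J0 f0) h2. Qed.

Lemma W0 : W 0.
Proof. exact: gen_by0. Qed.

Lemma Wx : W (v0, f0).
Proof. exact: gen_byx. Qed.

Lemma WP k u v : W u -> W v -> W (k *: u + v).
Proof. exact: gen_byP. Qed.

Lemma WB u v : W u -> W v -> W (u - v).
Proof. by move=> hu hv; rewrite addrC -scaleN1r; apply: WP. Qed.

Lemma WZ k u : W u -> W (k *: u).
Proof. by move=> hu; rewrite -[_ *: u]addr0; apply: WP => //; apply: W0. Qed.

Lemma W_act a m u : W u -> W (pact a m u).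
Proof. exact: (gen_by_act pact_linear pact_bracket x0pos x0J x0L x0J0). Qed.

Lemma W_ind (Q : P -> Prop) : Q 0 -> Q x0 -> (forall k u v, W u -> W v -> Q u -> Q v -> Q (k *: u + v)) ->
  (forall a m u, W u -> Q u -> Q (pact a m u)) -> forall u, W u -> Q u.
Proof.
move=> Q0 Qx QP Qa u [n]; elim=> {n u} // [n k u v hu IHu hv IHv|n a m u _ hu IHu].
  by apply: QP => //; [exists n | exists n].
by apply: Qa => //; exists n.
Qed.

Lemma W_sector v f : W (v, f) -> S f.
Proof.
have [S0 SD Sa] := clS.
suff H : forall u, W u -> S u.2 by move=> /H.
by apply: W_ind => [||k [u1 u2] [w1 w2] _ _ /= h1 h2|a m [u1 u2] _ /= hu] //; [apply: SD | apply: Sa].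
Qed.

Definition pdeg p (u : P) := n4_deg p u.1 /\ n4_deg p u.2.

Lemma pdegP p k u v : pdeg p u -> pdeg p v -> pdeg p (k *: u + v).
Proof.
move=> [h1 h2] [h3 h4]; have [_ DV] := n4_deg_subspace V p; have [_ DF] := n4_deg_subspace F p.
by split; [apply: DV | apply: DF].
Qed.

Lemma W_parity u : W u -> exists u0 u1, [/\ W u0, W u1, pdeg false u0, pdeg true u1 & u = u0 + u1].
Proof.
have d0 p : pdeg p 0 by split; [case: (n4_deg_subspace V p) | case: (n4_deg_subspace F p)].
move: u; apply: W_ind => [||k _ _ _ _ [u0 [u1 [hu0 hu1 du0 du1 ->]]] [w0 [w1 [hw0 hw1 dw0 dw1 ->]]]
    |a m _ _ [u0 [u1 [hu0 hu1 du0 du1 ->]]]].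
- by exists 0, 0; split=> //; rewrite ?addr0 //; apply: W0.
- exists x0, 0; split=> //; rewrite ?addr0 //; [exact: Wx | exact: W0 |].
  by split; [case: hv0 | case: hf0].
- exists (k *: u0 + w0), (k *: u1 + w1); split; try exact: WP; try exact: pdegP.
  by rewrite scalerDr addrACA.
have pa p (u : P) : pdeg p u -> pdeg (p (+) parity a) (pact a m u).
  by move=> [h1 h2]; split; apply: n4_act_parity.
have e : pact a m (u0 + u1) = pact a m u0 + pact a m u1.
  by have := pact_linear a m 1 u0 u1; rewrite !scale1r.
have := pa _ _ du0; have := pa _ _ du1; rewrite e; case: (parity a) => /= d1 d2.
  by exists (pact a m u1), (pact a m u0); split=> //; try exact: W_act; rewrite addrC.
by exists (pact a m u0), (pact a m u1); split=> //; exact: W_act.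
Qed.

Lemma W_parity_l v f : W (v, f) -> exists va fa vb fb, [/\ W (va, fa), W (vb, fb),
  n4_deg false va /\ n4_deg false fa, n4_deg true vb /\ n4_deg true fb & v = va + vb /\ f = fa + fb].
Proof.
move=> /W_parity[[va fa] [[vb fb] [h1 h2 [h3 h4] [h5 h6] [e1 e2]]]].
by exists va, fa, vb, fb.
Qed.

(** The vector [(v0, 0)] has the same eigenvalue of [Top] as [(v0, f0)], so that it would be a
    multiple of it by [top_eigenvector]. *)
Lemma W_v0 : ~ W (v0, 0).
Proof.
move=> hW; have [v0n _ _ hL hJ] := hv0; have [f0n _ _ _ _] := hf0.
have hT : Top pact (v0, 0) = (4 * h - s) *: ((v0, 0) : P).
  rewrite /Top /pact /= -[n4_act gL 1 v0]/(op_L0 v0) hL -[n4_act gJ0 0 v0]/(op_J0 v0) hJ.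
  rewrite (act0 (@n4_act_linear _ _ F)) (act0 (@n4_act_linear _ _ F)).
  by apply: injective_projections; rewrite /= ?scaler0 ?subrr // scalerA -scalerBl.
have [k [e1 e2]] := top_eigenvector pact_linear pact_bracket x0L x0J0 hW hT.
have /eqP := e2; rewrite eq_sym scaler_eq0 => /orP[/eqP k0|/eqP //].
by apply: v0n; rewrite e1 k0 scale0r.
Qed.

(** The vectors [v] with [(v, 0)] in [W] form a submodule of the irreducible [V], and this submodule
    does not contain [v0]. *)
Lemma W_l v : W (v, 0) -> v = 0.
Proof.
pose A : set V := fun u => W (u, 0).
have subA : is_submodule A.
  split; first split; rewrite /A /=; first exact: W0.
  - move=> k u w hu hw; have := WP k hu hw.
    by rewrite -[_ + _]/((k *: u + w, k *: 0 + 0) : P) scaler0 addr0.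
  - move=> u hu; have [va [fa [vb [fb [h1 h2 [dva dfa] [dvb dfb] [-> e]]]]]] := W_parity_l hu.
    have fa0 : fa = 0.
      apply: n4_deg_direct => //; have [_ D] := n4_deg_subspace F true.
      have -> : fa = - fb by apply/eqP; rewrite -addr_eq0 -e.
      by rewrite -[- fb]addr0 -scaleN1r; apply: D => //; case: (n4_deg_subspace F true).
    have fb0 : fb = 0 by move: e; rewrite fa0 add0r.
    by exists va, vb; split=> //; [rewrite -fa0 | rewrite -fb0].
  move=> a m u hu; have := W_act a m hu; rewrite /pact /=.
  by rewrite (act0 (@n4_act_linear _ _ F)).
case: (irrV.2 A subA) => eA hv.
  by have : A v by []; rewrite eA.
by have : A v0 by [rewrite eA]; move/W_v0.
Qed.

(** If [f] were not 0, the stable subspace of all [g] with [(0, g)] in [W] would contain [f0], and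
    [(v0, 0)] would be a difference of two elements of [W]. *)
Lemma W_r f : W (0, f) -> f = 0.
Proof.
move=> hf; apply: contrapT => fn0; apply: W_v0.
have clB : closed_act (fun g : F => W (0, g)).
  split; first exact: W0.
    move=> k u w hu hw; have := WP k hu hw.
    by rewrite -[_ + _]/((k *: 0 + 0, k *: u + w) : P) scaler0 addr0.
  move=> a m u hu; have := W_act a m hu; rewrite /pact /=.
  by rewrite (act0 (@n4_act_linear _ _ V)).
have := WB Wx (S_sub clB (W_sector hf) hf fn0).
by rewrite -[_ - _]/((v0 - 0, f0 - f0) : P) subr0 subrr.
Qed.

Lemma W_total v : exists f, W (v, f).
Proof.
pose A : set V := fun u => exists f, W (u, f).
have subA : is_submodule A.
  split; first split.
  - by exists 0; exact: W0.
  - by move=> k u w [f hf] [g hg]; exists (k *: f + g); apply: (WP k hf hg).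
  - move=> u [f hf]; have [va [fa [vb [fb [h1 h2 [dva dfa] [dvb dfb] [-> e]]]]]] := W_parity_l hf.
    by exists va, vb; split=> //; [exists fa | exists fb].
  by move=> a m u [f hf]; exists (n4_act a m f); apply: (W_act a m hf).
have : A v by rewrite (genV subA) //; exists f0; exact: Wx.
by [].
Qed.

Lemma W_onto f : S f -> exists v, W (v, f).
Proof.
have clB : closed_act (fun g : F => exists v, W (v, g)).
  split; first by exists 0; exact: W0.
    by move=> k u w [f1 hf] [g hg]; exists (k *: f1 + g); apply: (WP k hf hg).
  by move=> a m u [v hv]; exists (n4_act a m v); apply: (W_act a m hv).
by apply: (S_gen clB); exists v0; exact: Wx.
Qed.

Lemma W_inj_l v v' f : W (v, f) -> W (v', f) -> v = v'.
Proof.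
move=> hv hv'; apply/eqP; rewrite -subr_eq0; apply/eqP/W_l.
by have := WB hv hv'; rewrite -[_ - _]/((v - v', f - f) : P) subrr.
Qed.

Lemma W_inj_r v f f' : W (v, f) -> W (v, f') -> f = f'.
Proof.
move=> hf hf'; apply/eqP; rewrite -subr_eq0; apply/eqP/W_r.
by have := WB hf hf'; rewrite -[_ - _]/((v - v, f - f') : P) subrr.
Qed.

Lemma W_weight v f p Delta mu : W (v, f) ->
  weight_space p Delta mu v <-> weight_space p Delta mu f.
Proof.
move=> hW; have hL := W_act gL 1 hW; have hJ := W_act gJ0 0 hW.
have [va [fa [vb [fb [h1 h2 [dva dfa] [dvb dfb] [ev ef]]]]]] := W_parity_l hW.
have dm (M : n4_module c) (x y : M) q : n4_deg q x -> n4_deg (~~ q) y -> n4_deg q (x + y) -> y = 0.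
  move=> hx hy hxy; have [_ D] := n4_deg_subspace M q.
  have hy' : n4_deg q y.
    by have := D (-1) _ _ hx hxy; rewrite scaleN1r addKr.
  by case: q {D} hx hxy hy hy' => /= *; apply: n4_deg_direct.
split=> -[hp hl hj]; split.
- case: p hp => hp.
    have va0 : va = 0 by apply: (dm _ vb va true) => //; rewrite addrC -ev.
    by rewrite va0 in h1; rewrite ef (W_r h1) add0r.
  have vb0 : vb = 0 by apply: (dm _ va vb false) => //; rewrite -ev.
  by rewrite vb0 in h2; rewrite ef (W_r h2) addr0.
- apply: (@W_inj_r (Delta *: v)); last exact: (WZ Delta hW).
  by rewrite -hl; exact: hL.
- apply: (@W_inj_r (mu *: v)); last exact: (WZ mu hW).
  by rewrite -hj; exact: hJ.
- case: p hp => hp.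
    have fa0 : fa = 0 by apply: (dm _ fb fa true) => //; rewrite addrC -ef.
    by rewrite fa0 in h1; rewrite ev (W_l h1) add0r.
  have fb0 : fb = 0 by apply: (dm _ fa fb false) => //; rewrite -ef.
  by rewrite fb0 in h2; rewrite ev (W_l h2) addr0.
- apply: (@W_inj_l _ _ (Delta *: f)); last exact: (WZ Delta hW).
  by rewrite -hl; exact: hL.
- apply: (@W_inj_l _ _ (mu *: f)); last exact: (WZ mu hW).
  by rewrite -hj; exact: hJ.
Qed.

End PairOfModules.

(** * The operators L_0 and J_0 on states *)

Section FockWeights.
Variable K : numFieldType.
Notation fock := (fock K).
Notation vac := (vac K).
Implicit Types (u v w : fock) (b : occ) (d : grade).

Definition diag (f : occ -> K) : fock -> fock := lext (fun b => f b *: ket K b).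

Lemma coeff_diag f b v : coeff b (diag f v) = f b * coeff b v.
Proof.
move: v; apply: fock_ind => [|c u v hu hv|b'].
- by rewrite /diag !raddf0 mulr0.
- by rewrite /diag linearP !coeffD !coeffZ hu hv; ring.
rewrite /diag lext_ket coeffZ coeff_ket; by case: eqP => [->|_]; rewrite ?mulr0.
Qed.

Lemma diagP f c u v : diag f (c *: u + v) = c *: diag f u + diag f v.
Proof. exact: linearP. Qed.

Lemma diag0 f : diag f 0 = 0.
Proof. exact: raddf0. Qed.

Lemma diag_homog (g : grade -> K) d v : homog d v -> diag (fun b => g (deg b)) v = g d *: v.
Proof.
move=> hv; apply: fockP => b; rewrite coeff_diag coeffZ.
by have [->|/hv ->] := eqVneq (coeff b v) 0; rewrite ?mulr0.
Qed.

Lemma diag_derf (g : grade -> K) : (forall d d', g (d + d') = g d + (g d' - g 0)) ->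
  derf false (diag (fun b => g (deg b)))
    (fun x k v => (g (phideg x k) - g 0) *: phi x k v).
Proof.
move=> hg; split=> [c u v|x k v]; first exact: linearP.
rewrite /= expr0 scale1r; move: v; apply: fock_ind => [|c u v hu hv|b].
- by rewrite (linear0 (phi x k)) diag0 (linear0 (phi x k)) scaler0 addr0.
- by rewrite phiD phiZ !diagP hu hv !phiD !phiZ; module.
rewrite (diag_homog g (@homog_ket K b)).
rewrite (diag_homog g (@homog_phi K (deg b) x k _ (@homog_ket K b))).
by rewrite hg phiZ scalerDl.
Qed.

(** Schur's lemma again: the current and the diagonal operator have the same brackets with all modes
    and agree on the vacuum. The condition on [g] says that it is an additive function of the degree
    plus a constant. *)
Lemma cur_diag A m (g : grade -> K) : parity A = false ->
  (forall d d', g (d + d') = g d + (g d' - g 0)) ->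
  (forall x k v, ev (tab K A m) x k v = (g (phideg x k) - g 0) *: phi x k v) ->
  cur A m vac = g 0 *: vac -> forall v, cur A m v = diag (fun b => g (deg b)) v.
Proof.
move=> pA hg ht hvac v; pose D u := cur A m u - diag (fun b => g (deg b)) u.
have hD : derf false D (fun _ _ _ => 0).
  have [l1 h1] := cur_derf K A m; have [l2 h2] := diag_derf hg.
  split=> [c u w|x k u]; first by rewrite /D l1 l2; module.
  by rewrite /D h1 h2 ht pA /= expr0 !scale1r phiD phiN; module.
apply/eqP; rewrite -subr_eq0; apply/eqP; rewrite -/(D v) (schur0 hD) /D hvac.
by rewrite (diag_homog g (@homog_ket K occ0)) deg0 subrr coeff0 scale0r.
Qed.

Lemma Gp0_vac : cur (gG true) 0 vac = 0.
Proof.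
rewrite GE; apply: lsum0 => i; have [i0|i0] := ltP i 0.
  by rewrite [phi (Fer _) _ _]phi_vac ?linear0 ?scaler0 //= ; lia.
by rewrite bos_fer phi_vac // linear0 scaler0.
Qed.

Lemma homog_neg d v : homog d v -> (d.1.1 < 0)%R || (wt d < 0)%R -> v = 0.
Proof.
move=> hv hd; apply: fockP => b; rewrite coeff0; apply/eqP; apply: contraT => /hv e.
have [h0 _ _ _] := wt_bounds b; have h1 := deg_ge0 b; move: hd; rewrite -e.
by rewrite !ltNge h0 h1.
Qed.

(** [G^+_(0)] and [Gbar^-_(1)] both kill the vacuum, so that the definition of [L_(1)], which is the
    operator [L_0], leaves half the charge -1/2. *)
Lemma L0_vac : cur gL 1 vac = - (1 / 4) *: vac.
Proof.
rewrite -[LHS]/(Lz 1 vac) LzE Gp0_vac linear0 addr0.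
have -> : cur (gGbar false) 1 vac = 0.
  apply: (@homog_neg (deg occ0 + curdeg (gGbar false) 1)) => //.
    by apply: cur_ofdeg; apply: homog_ket.
  by rewrite deg0.
rewrite linear0 add0r subrr -[cur gJ0 0 vac]/(Jz 0 vac) Jz0_vac; to_coeff; by field.
Qed.

Definition energy b : K := (deg b).1.1%:~R / 2 - 1 / 4.
Definition jcharge b : K := (deg b).1.2%:~R - 1 / 2.

Lemma L0_diag v : cur gL 1 v = diag energy v.
Proof.
pose g d : K := d.1.1%:~R / 2 - 1 / 4.
apply: (@cur_diag gL 1 g) => // [d d'|x k u|].
- by rewrite /g /= rmorphD /=; field.
- rewrite /g /=; case: x => [s|[]]; rewrite /ev /=; (rewrite (_ : 1 + k - 1 = k); last by lia);
  rewrite ?rmorphN ?rmorphD ?rmorphMn /=; congr (_ *: _); by field.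
by rewrite L0_vac /g /=; congr (_ *: _); field.
Qed.

Lemma J0_diag v : cur gJ0 0 v = diag jcharge v.
Proof.
pose g d : K := d.1.2%:~R - 1 / 2.
apply: (@cur_diag gJ0 0 g) => // [d d'|x k u|].
- by rewrite /g /= rmorphD /=; ring.
- rewrite /g /=; case: x => [[]|s]; rewrite /ev /= ?add0r ?scale0r /sg; 
   to_coeff; by field.
by rewrite -[cur gJ0 0 vac]/(Jz 0 vac) Jz0_vac /g /=; congr (_ *: _); field.
Qed.

Lemma occt_positive o A m : 0 < mode_index A m -> cur A m (ket K (occt o)) = 0.
Proof.
move=> /mode_index_gt0 hm; apply: (@homog_neg (deg (occt o) + curdeg A m)).
  by apply: cur_ofdeg; apply: homog_ket.
by apply/orP; left; case: o; rewrite /occt ?deg1 ?deg0;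
  case: A hm => [||s|s|s] /=; lia.
Qed.

Lemma occt_Jp o : cur (gJ true) 0 (ket K (occt o)) = 0.
Proof.
apply: (@homog_neg (deg (occt o) + curdeg (gJ true) 0)).
  by apply: cur_ofdeg; apply: homog_ket.
by apply/orP; right; case: o; rewrite /occt ?deg1 ?deg0.
Qed.

Lemma diag_ket f b : diag f (ket K b) = f b *: ket K b.
Proof. exact: lext_ket. Qed.

Lemma ket_neq0 b : ket K b != 0.
Proof.
by apply/eqP => /(congr1 (coeff b)); rewrite coeff_ket eqxx coeff0 => /eqP; rewrite oner_eq0.
Qed.

Lemma diag_eigenP f v (t : K) :
  diag f v = t *: v <-> (forall b, coeff b v != 0 -> f b = t).
Proof.
split=> [h b hb|h]; last first.
  apply: fockP => b; rewrite coeff_diag coeffZ.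
  by have [->|/h ->] := eqVneq (coeff b v) 0; rewrite ?mulr0.
by have := congr1 (coeff b) h; rewrite coeff_diag coeffZ => /(mulIf hb).
Qed.

End FockWeights.

(** * Weight spaces of the irreducible modules *)

Section IrreducibleModules.
Variable R : realType.
Notation C := (R[i] : numFieldType).
Notation F := (fock_module R).

Definition fw (b : occ) : R[i] * R[i] := (energy C b, jcharge C b).

Lemma fock_weight_space p Delta mu (v : fock C) :
  @weight_space R (cM R 2) F p Delta mu v <->
  (forall b, coeff b v != 0 -> fpodd b = p /\ fw b = (Delta, mu)).
Proof.
have e1 : op_L0 (v : F) = diag (energy C) v := L0_diag v.
have e2 : op_J0 (v : F) = diag (jcharge C) v := J0_diag v.
split=> [[h1]|h].
  rewrite e1 e2 => /diag_eigenP h2 /diag_eigenP h3 b hb.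
  by split; [exact: h1 | rewrite /fw h2 ?h3].
split; first by move=> b /h[].
  by rewrite e1; apply/diag_eigenP => b /h[_ [->]].
by rewrite e2; apply/diag_eigenP => b /h[_ [_ ->]].
Qed.

(** The two eigenvalues of a state determine its [wt], and only finitely many states have a given
    [wt]. *)
Lemma fw_fiber o p w : exists B : seq occ, uniq B /\
  forall b, (b \in B) = [&& bodd b == o, fpodd b == p & fw b == w].
Proof.
have [[b0 hb0]|no] := pselect (exists b, fw b = w).
  exists [seq b <- occs `|wt (deg b0)|.+1 | [&& bodd b == o, fpodd b == p & fw b == w]].
  split=> [|b]; first by rewrite filter_uniq // occs_uniq.
  rewrite mem_filter; case: (boolP [&& _, _ & _]) => //= /and3P[_ _ /eqP hb].
  apply: wt_occs; suff -> : wt (deg b) = wt (deg b0) by lia.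
  have [e1 e2] : fw b = fw b0 by rewrite hb hb0.
  have h1 : (deg b).1.1%:~R = (deg b0).1.1%:~R :> R[i].
    by move: e1; rewrite /= /energy => /addIr /(mulIf _); apply; rewrite invr_eq0 pnatr_eq0.
  have h2 : (deg b).1.2%:~R = (deg b0).1.2%:~R :> R[i] by move: e2; rewrite /= /jcharge => /addIr.
  by rewrite /wt (intr_inj h1) (intr_inj h2).
exists [::]; split=> // b; rewrite in_nil; apply/esym/negP => /and3P[_ _ /eqP e].
by apply: no; exists b.
Qed.

Lemma occt_hw (o : bool) : @highest_weight_vector R (cM R 2) F
  (- (1 / 4)) (if o then - (3 / 2) else - (1 / 2)) (ket C (occt o)).
Proof.
split.
- by apply/eqP/ket_neq0.
- move=> b; rewrite coeff_ket; case: (occt o =P b) => [<- _|]; last by rewrite eqxx.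
  by case: o; rewrite /fpodd /occt ?deg1 ?deg0.
- split=> [a m|m]; first exact: occt_positive.
  by rewrite /mode_index /= => /eqP; rewrite subrK intr_eq0 => /eqP ->; apply: occt_Jp.
- have := L0_diag (ket C (occt o)); rewrite diag_ket => e.
  by rewrite [LHS]e /energy; case: o {e}; rewrite /occt ?deg1 ?deg0 /= mul0r sub0r.
have := J0_diag (ket C (occt o)); rewrite diag_ket => e.
rewrite [LHS]e /jcharge; case: o {e}; rewrite /occt ?deg1 ?deg0 /=; last by rewrite sub0r.
by rewrite (_ : (-1)%:~R - 1 / 2 = - (3 / 2) :> C) //; field.
Qed.

(** The correspondence [W] carries the states of the sector to a basis of [V] and preserves parity
    and both eigenvalues, so that dimensions are numbers of states. *)
Theorem irreducible_weights (o : bool) (V : n4_module (cM R 2)) :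
  irreducible_highest_weight V (- (1 / 4)) (if o then - (3 / 2) else - (1 / 2)) ->
  weight_decomposable V /\
  forall p w (B : seq occ), uniq B ->
    (forall b, (b \in B) = [&& bodd b == o, fpodd b == p & fw b == w]) ->
    has_dim (weight_space (V := V) p w.1 w.2) (size B).
Proof.
move=> [irrV [v0 [hv0 genV]]].
pose S (v : F) := bsector o (v : fock C).
have clS : closed_act S.
  split; first by move=> b; rewrite /= coeff0 eqxx.
    by move=> k u v; apply: bsectorP.
  by move=> a m u; apply: bsector_cur.
have cl B : @closed_act R (cM R 2) F B -> closed (K := C) B by case.
have S_sub (B : F -> Prop) : closed_act B -> forall f, S f -> B f -> f <> 0 -> B (ket C (occt o)).
  by move=> /cl cB f sf Bf /eqP f0; apply: (sector_generator cB sf Bf f0).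
have S_gen (B : F -> Prop) : closed_act B -> B (ket C (occt o)) -> forall f, S f -> B f.
  by move=> /cl cB B0 f sf; apply: (fock_generated cB B0 sf).
pose W := W v0 (ket C (occt o) : F).
have hf0 := occt_hw o.
have onto f (Sf : S f) : exists v, W (v, f) := W_onto hv0 hf0 S_gen Sf.
have total v : exists f, W (v, f) := W_total hv0 hf0 genV v.
have sect v f : W (v, f) -> S f.
  apply: (W_sector clS); move=> b; rewrite coeff_ket.
  by case: (occt o =P b) => [<- _|]; [rewrite bodd_occt | rewrite eqxx].
have wsp v f p Delta mu : W (v, f) -> weight_space p Delta mu v <-> weight_space p Delta mu f.
  by apply: (W_weight hv0 hf0 irrV clS _ S_sub); move=> b; rewrite coeff_ket;
    case: (occt o =P b) => [<- _|]; [rewrite bodd_occt | rewrite eqxx].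
have injl v f (h : W (v, f)) v' (h' : W (v', f)) : v = v' := W_inj_l hv0 hf0 irrV h h'.
have Sket b : bodd b = o -> S (ket C b).
  by move=> ob b'; rewrite coeff_ket; case: (b =P b') => [<-//|_]; rewrite eqxx.
(* The vector [e b] is the partner in [V] of the state [b]; outside the sector the value 0 is a
   default. *)
have [e he] : {e : occ -> V & forall b, bodd b = o -> W (e b, ket C b)}.
  apply: (@boolp.choice occ V (fun b v => bodd b = o -> W (v, ket C b))) => b; have [ob|nb] := boolP (bodd b == o).
    by have [v hv] := onto _ (Sket b (eqP ob)); exists v.
  by exists 0 => /eqP; rewrite (negPf nb).
pose kF b : F := ket C b.
have WsumF n (x : 'I_n -> R[i]) (bs : 'I_n -> occ) : (forall i, bodd (bs i) = o) ->
    W (\sum_i x i *: e (bs i), \sum_i x i *: kF (bs i)).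
  elim: n x bs => [|n IH] x bs hbs; first by rewrite !big_ord0; apply: W0.
  have h1 := he _ (hbs ord_max).
  have h2 := IH (fun i => x (widen_ord (leqnSn n) i)) (fun i => bs (widen_ord (leqnSn n) i))
    (fun i => hbs _).
  rewrite !big_ord_recr /= addrC [X in (_, X)]addrC.
  exact: (WP (x ord_max) h1 h2).
have Wsum n (x : 'I_n -> R[i]) (bs : 'I_n -> occ) : (forall i, bodd (bs i) = o) ->
    W (\sum_i x i *: e (bs i), (\sum_i x i *: ket C (bs i) : fock C)).
  exact: WsumF.
have ketw b : weight_space (V := F) (fpodd b) (fw b).1 (fw b).2 (ket C b).
  apply/fock_weight_space => b'; rewrite coeff_ket.
  by case: (b =P b') => [<-//|_]; rewrite eqxx.
split=> [v|p w B uB hB].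
  have [f hf] := total v; have Sf := sect _ _ hf.
  pose bs (i : 'I_(size (fsup (f : fock C)))) := nth occ0 (fsup (f : fock C)) i.
  have hbs i : bs i \in fsup (f : fock C) by apply: mem_nth.
  have obs i : bodd (bs i) = o by apply: Sf; rewrite -fsupP.
  have fE : f = \sum_i coeff (bs i) f *: ket C (bs i) :> fock C.
    by rewrite {1}(fockE f) (big_nth occ0) big_mkord.
  exists _, (fun i => coeff (bs i) f *: e (bs i)); split.
    by apply: (injl _ _ hf); have := Wsum _ (fun i => coeff (bs i) f) bs obs; rewrite -fE.
  move=> i; exists (fpodd (bs i)), (fw (bs i)).1, (fw (bs i)).2.
  apply/(wsp _ (coeff (bs i) f *: ket C (bs i))); first exact: (WZ (coeff (bs i) f) (he _ (obs i))).
  apply/fock_weight_space => b'; rewrite coeffZ coeff_ket.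
  by case: (_ =P b') => [<-|_]; rewrite ?mulr0 ?eqxx.
pose bs (i : 'I_(size B)) := nth occ0 B i.
have hbs i : bs i \in B by apply: mem_nth.
have obs i : bodd (bs i) = o by have := hbs i; rewrite hB => /and3P[/eqP].
have bsI : injective bs.
  move=> i j h; apply: ord_inj; rewrite -(index_uniq occ0 (ltn_ord i) uB).
  by rewrite -/(bs i) h /bs index_uniq.
have csum (x : 'I_(size B) -> R[i]) j : coeff (bs j) (\sum_i x i *: ket C (bs i)) = x j.
  rewrite raddf_sum (bigD1 j) //= coeffZ coeff_ket eqxx mulr1 big1 ?addr0 // => i ni.
  by rewrite coeffZ coeff_ket; case: eqP => [/bsI h|_]; [rewrite h eqxx in ni | rewrite mulr0].
exists (fun i => e (bs i)); split=> [x hx i|].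
  have := Wsum _ x bs obs; rewrite hx => /(W_r hv0 hf0 clS _ S_sub) h.
  rewrite -(csum x) h ?coeff0 // => b; rewrite coeff_ket.
  by case: (occt o =P b) => [<- _|]; [rewrite bodd_occt | rewrite eqxx].
apply/seteqP; split=> [v hv|v [x ->]].
  have [f hf] := total v; have Sf := sect _ _ hf.
  have /fock_weight_space hw := (wsp _ _ _ _ _ hf).1 hv.
  exists (fun i => coeff (bs i) f); apply: (injl _ _ hf).
  suff fE : f = \sum_i coeff (bs i) f *: ket C (bs i) :> fock C.
    by have := Wsum _ (fun i => coeff (bs i) f) bs obs; rewrite -fE.
  apply: fockP => b; have [bB|nB] := boolP (b \in B).
    have hi : (index b B < size B)%N by rewrite index_mem.
    by have := csum (fun i => coeff (bs i) f) (Ordinal hi); rewrite /bs /= nth_index.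
  rewrite raddf_sum big1 => [|i _]; last first.
    rewrite /= coeffZ coeff_ket; case: eqP => [h|_]; last by rewrite mulr0.
    by rewrite -h hbs in nB.
  apply/eqP; apply: contraT => hb; move: nB; rewrite hB (Sf _ hb).
  by have [-> ->] := hw _ hb; rewrite -surjective_pairing !eqxx.
apply/(wsp _ _ _ _ _ (Wsum _ x bs obs))/fock_weight_space => b.
have [bB _|nB] := boolP (b \in B).
  by move: bB; rewrite hB => /and3P[_ /eqP -> /eqP ->]; rewrite -surjective_pairing.
rewrite raddf_sum big1 ?eqxx // => i _; rewrite /= coeffZ coeff_ket.
case: eqP => [h|_]; last by rewrite mulr0.
by rewrite -h hbs in nB.
Qed.

End IrreducibleModules.

(** * Unconditional sums and infinite products *)

Section UnconditionalSums.
Variable R : realType.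
Notation C := R[i].
Implicit Types (z w s : C) (e : R).

Definition nm z : R := Normc.normc z.

Lemma nmE z : `|z| = (nm z)%:C%C.
Proof. by []. Qed.

Lemma rc_le (x y : R) : (x%:C%C <= y%:C%C :> C) = (x <= y).
Proof. exact: lecR. Qed.

Lemma rc_inj (x y : R) : x%:C%C = y%:C%C :> C -> x = y.
Proof. by case. Qed.

Lemma nm_ge0 z : 0 <= nm z.
Proof. by rewrite -rc_le -nmE; apply: normr_ge0. Qed.

Lemma nmM z w : nm (z * w) = nm z * nm w.
Proof. by apply: rc_inj; rewrite rmorphM /= -!nmE normrM. Qed.

Lemma nmD z w : nm (z + w) <= nm z + nm w.
Proof. by rewrite -rc_le rmorphD /= -!nmE; apply: ler_normD. Qed.

Lemma nmN z : nm (- z) = nm z.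
Proof. by apply: rc_inj; rewrite -!nmE normrN. Qed.

Lemma nmB z w : nm (z - w) <= nm z + nm w.
Proof. by rewrite -(nmN w); apply: nmD. Qed.

Lemma nmBC z w : nm (z - w) = nm (w - z).
Proof. by rewrite -opprB nmN. Qed.

Lemma nm0 : nm 0 = 0.
Proof. by apply: rc_inj; rewrite -nmE normr0. Qed.

Lemma nm1 : nm 1 = 1.
Proof. by apply: rc_inj; rewrite -nmE normr1. Qed.

Lemma nm_eq0 z : (nm z == 0) = (z == 0).
Proof.
by apply/eqP/eqP => [h|->]; [apply/normr0_eq0; rewrite nmE h | exact: nm0].
Qed.

Lemma nm_gt0 z : z != 0 -> 0 < nm z.
Proof. by move=> h; rewrite lt_neqAle nm_ge0 eq_sym nm_eq0 h. Qed.

Lemma nmX z n : nm (z ^+ n) = nm z ^+ n.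
Proof. by elim: n => [|n IH]; rewrite ?nm1 // !exprS nmM IH. Qed.

Lemma nmV z : nm z^-1 = (nm z)^-1.
Proof.
have [->|z0] := eqVneq z 0; first by rewrite invr0 nm0 invr0.
have nz : nm z != 0 by rewrite nm_eq0.
by apply: (mulIf nz); rewrite -nmM !mulVf // nm1.
Qed.

Lemma nm_sum (J : Type) (r : seq J) (F : J -> C) : nm (\sum_(i <- r) F i) <= \sum_(i <- r) nm (F i).
Proof.
elim/big_ind2: _ => [|x x' y y' h h'|//]; first by rewrite nm0.
by apply: le_trans (nmD _ _) _; apply: lerD.
Qed.

Lemma nm_eq_small z : (forall e, 0 < e -> nm z <= e) -> z = 0.
Proof.
move=> h; apply/eqP; rewrite -nm_eq0; apply: contraT => nz.
have p : 0 < nm z by rewrite lt_neqAle nm_ge0 eq_sym nz.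
by have := h _ (divr_gt0 p (ltr0n R 2)); lra.
Qed.

Section Families.
Variable I : choiceType.
Implicit Types (f g : I -> C) (A B : {fset I}).

Lemma sum_subset (V : zmodType) (F : I -> V) A B : (A `<=` B)%fset ->
  \sum_(i <- B) F i = \sum_(i <- A) F i + \sum_(i <- (B `\` A)%fset) F i.
Proof.
move=> /fsubsetP AB; rewrite -big_cat /=; apply: perm_big; apply: uniq_perm.
- exact: fset_uniq.
- rewrite cat_uniq !fset_uniq andbT /=; apply/hasPn => i.
  by rewrite inE => /andP[].
move=> i; rewrite mem_cat in_fsetD; case: (boolP (i \in A)) => //= /AB.
by [].
Qed.

Definition has_sumR f s := forall e, 0 < e ->
  exists A, forall B, (A `<=` B)%fset -> nm (\sum_(i <- B) f i - s) <= e.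

(** Absolute summability. It is kept apart from the value of the sum because regrouping, products
    and limits all require it. *)
Definition bdd f := exists M : R, forall A, \sum_(i <- A) nm (f i) <= M.

Lemma nm_sum_ge0 f A : 0 <= \sum_(i <- A) nm (f i).
Proof. by apply: sumr_ge0 => i _; apply: nm_ge0. Qed.

Lemma bdd_tail f e : bdd f -> 0 < e ->
  exists A, forall B, [disjoint A & B]%fset -> \sum_(i <- B) nm (f i) <= e.
Proof.
move=> [M hM] e0; pose E : set R := fun y => exists A, y = \sum_(i <- A) nm (f i).
have sE : has_sup E.
  split; first by exists (\sum_(i <- fset0) nm (f i)), fset0.
  by exists M => _ [A ->].
have [_ [A ->] hA] := sup_adherent e0 sE; exists A => B dAB.
have : \sum_(i <- (A `|` B)%fset) nm (f i) <= sup E.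
  by apply: sup_upper_bound => //; exists (A `|` B)%fset.
rewrite (sum_subset _ (fsubsetUl A B)) fsetDUl fsetDv fset0U.
have /fsetDidPl -> : [disjoint B & A]%fset by rewrite fdisjoint_sym.
by lra.
Qed.

(** Absolute summability makes the sum over any set disjoint from some finite [A] small, so that
    good approximations by arbitrarily large sets control all large sets. *)
Lemma has_sumR_approx f s : bdd f ->
  (forall e A, 0 < e -> exists2 B, (A `<=` B)%fset & nm (\sum_(i <- B) f i - s) <= e) ->
  has_sumR f s.
Proof.
move=> bf h e e0; have e2 : 0 < e / 3 by lra.
have [A hA] := bdd_tail bf e2; exists A => B AB.
have [B' AB' hB'] := h _ A e2.
have small D : (A `<=` D)%fset -> nm (\sum_(i <- D) f i - \sum_(i <- A) f i) <= e / 3.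
  move=> AD; rewrite (sum_subset _ AD) addrC addKr.
  apply: le_trans (nm_sum _ _) _; apply: hA.
  by rewrite fdisjoint_sym; apply/fdisjointP => i; rewrite in_fsetD => /andP[].
have -> : \sum_(i <- B) f i - s = (\sum_(i <- B) f i - \sum_(i <- A) f i)
   - (\sum_(i <- B') f i - \sum_(i <- A) f i) + (\sum_(i <- B') f i - s) by ring.
apply: le_trans (nmD _ _) _; have := nmB (\sum_(i <- B) f i - \sum_(i <- A) f i)
  (\sum_(i <- B') f i - \sum_(i <- A) f i).
by have := small _ AB; have := small _ AB'; lra.
Qed.

Lemma has_sumR_unique f s s' : has_sumR f s -> has_sumR f s' -> s = s'.
Proof.
move=> h h'; apply/eqP; rewrite -subr_eq0; apply/eqP/nm_eq_small => e e0.
have e2 : 0 < e / 2 by lra.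
have [A hA] := h _ e2; have [A' hA'] := h' _ e2.
have -> : s - s' = (\sum_(i <- (A `|` A')%fset) f i - s') - (\sum_(i <- (A `|` A')%fset) f i - s) by ring.
apply: le_trans (nmB _ _) _.
by have := hA _ (fsubsetUl A A'); have := hA' _ (fsubsetUr A A'); lra.
Qed.

Lemma has_sumR_lin f g s s' (c : C) : has_sumR f s -> has_sumR g s' ->
  has_sumR (fun i => c * f i + g i) (c * s + s').
Proof.
move=> h h' e e0; have c0 := nm_ge0 c.
have e1 : 0 < e / (2 * (nm c + 1)) by rewrite divr_gt0 // mulr_gt0 //; lra.
have e2 : 0 < e / 2 by lra.
have [A hA] := h _ e1; have [A' hA'] := h' _ e2; exists (A `|` A')%fset => B.
rewrite fsubUset => /andP[/hA h1 /hA' h2].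
rewrite big_split /= -mulr_sumr.
have -> : c * \sum_(i <- B) f i + \sum_(i <- B) g i - (c * s + s') =
  c * (\sum_(i <- B) f i - s) + (\sum_(i <- B) g i - s') by ring.
apply: le_trans (nmD _ _) _; rewrite nmM.
have : nm c * nm (\sum_(i <- B) f i - s) <= (nm c + 1) * (e / (2 * (nm c + 1))).
  by apply: ler_pM => //; [exact: nm_ge0 | lra].
have -> : (nm c + 1) * (e / (2 * (nm c + 1))) = e / 2 by field; lra.
by lra.
Qed.

Lemma has_sumRZ f s (c : C) : has_sumR f s -> has_sumR (fun i => c * f i) (c * s).
Proof.
move=> h; have h0 : has_sumR (fun _ : I => 0 : C) 0.
  by move=> e e0; exists fset0 => B _; rewrite big1 // subr0 nm0 ltW.
have := has_sumR_lin c h h0; rewrite addr0.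
by rewrite (_ : (fun i => c * f i + 0) = (fun i => c * f i)) //; apply/funext => i; rewrite addr0.
Qed.

Lemma bddZ f (c : C) : bdd f -> bdd (fun i => c * f i).
Proof.
move=> [M hM]; exists (nm c * M) => A.
under eq_bigr do rewrite nmM; rewrite -mulr_sumr.
by apply: ler_wpM2l; [exact: nm_ge0 | exact: hM].
Qed.

Lemma exhaust_subset (J : nat -> {fset I}) A :
  (forall i, exists N0, forall N, (N0 <= N)%N -> i \in J N) ->
  exists N1, forall N, (N1 <= N)%N -> (A `<=` J N)%fset.
Proof.
move=> hJ; elim/finSet_rect: A => A IH.
have [->|[i iA]] := fset_0Vmem A; first by exists 0%N => N _; rewrite fsub0set.
have [N1 h1] := IH (A `\ i)%fset (fproperD1 iA); have [N2 h2] := hJ i.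
exists (maxn N1 N2) => N; rewrite geq_max => /andP[/h1 /fsubsetP k1 /h2 k2].
apply/fsubsetP => j jA; have [->//|ji] := eqVneq j i.
by apply: k1; rewrite in_fsetD1 ji.
Qed.

Lemma has_sumR_exhaust f s (J : nat -> {fset I}) : bdd f ->
  (forall i, exists N0, forall N, (N0 <= N)%N -> i \in J N) ->
  (forall e, 0 < e -> exists N0, forall N, (N0 <= N)%N -> nm (\sum_(i <- J N) f i - s) <= e) ->
  has_sumR f s.
Proof.
move=> bf hJ hs; apply: has_sumR_approx => // e A e0.
have [N0 h0] := hs _ e0.
have [N1 h1] := exhaust_subset A hJ.
exists (J (maxn N0 N1)); first by apply: h1; apply: leq_maxr.
by apply: h0; apply: leq_maxl.
Qed.

Lemma bdd_exhaust f (J : nat -> {fset I}) (M : R) :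
  (forall i, exists N0, forall N, (N0 <= N)%N -> i \in J N) ->
  (forall N, \sum_(i <- J N) nm (f i) <= M) -> bdd f.
Proof.
move=> hJ hM; exists M => A.
have [N1 /(_ _ (leqnn N1)) h1] := exhaust_subset A hJ.
apply: le_trans (hM N1); rewrite (sum_subset _ h1) lerDl.
exact: nm_sum_ge0.
Qed.

End Families.

(** A finite sum of sums over fibres is a sum over the union of these fibres, and this union
    contains any prescribed finite set once the images of its elements are included. *)
Lemma has_sumR_fiber (I J : choiceType) (ph : I -> J) (fib : J -> {fset I}) (f : I -> C) s :
  (forall i j, (i \in fib j) = (ph i == j)) -> bdd f -> has_sumR f s ->
  bdd (fun j => \sum_(i <- fib j) f i) /\ has_sumR (fun j => \sum_(i <- fib j) f i) s.
Proof.
move=> hfib [M hM] hs.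
have key (V : zmodType) (F : I -> V) (E : {fset J}) : exists2 U : {fset I},
    \sum_(j <- E) \sum_(i <- fib j) F i = \sum_(i <- U) F i & forall i, (i \in U) = (ph i \in E).
  elim/finSet_rect: E => E IH; have [->|[j jE]] := fset_0Vmem E.
    by exists fset0; [rewrite !big_seq_fset0 | move=> i; rewrite !in_fset0].
  have [U hU memU] := IH (E `\ j)%fset (fproperD1 jE); exists (fib j `|` U)%fset.
    rewrite (big_fsetD1 j jE) /= hU (sum_subset _ (fsubsetUl _ U)); congr (_ + _).
    rewrite fsetDUl fsetDv fset0U; suff /fsetDidPl -> : [disjoint U & fib j]%fset by [].
    by apply/fdisjointP => i; rewrite memU hfib in_fsetD1 => /andP[].
  move=> i; rewrite in_fsetU hfib memU in_fsetD1.
  by case: eqVneq => [->|].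
have bg : bdd (fun j => \sum_(i <- fib j) f i).
  exists M => E; have [U hU _] := key _ (fun i => nm (f i)) E; apply: le_trans (hM U).
  by rewrite -hU; apply: ler_sum => j _; apply: nm_sum.
split=> //; apply: has_sumR_approx => // e E e0.
have [A hA] := hs _ e0; exists (E `|` [fset ph i | i in A])%fset; first exact: fsubsetUl.
have [U -> memU] := key _ f (E `|` [fset ph i | i in A])%fset; apply: hA.
by apply/fsubsetP => i iA; rewrite memU in_fsetU; apply/orP; right; apply/imfsetP; exists i.
Qed.

Lemma has_sumR_inj (I J : choiceType) (io : I -> J) (F : J -> C) s :
  injective io -> (forall j, (forall i, io i <> j) -> F j = 0) -> bdd (fun i => F (io i)) ->
  has_sumR (fun i => F (io i)) s -> has_sumR F s.
Proof.
move=> ii F0 bf hs.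
have [fib hfib] : {fib : J -> {fset I} & forall j, forall i, (i \in fib j) = (io i == j)}.
  apply: (@boolp.choice J _ (fun j A => forall i, (i \in A) = (io i == j))) => j.
  have [[i0 <-]|no] := pselect (exists i, io i = j).
    by exists [fset i0]%fset => i; rewrite in_fset1 (inj_eq ii).
  by exists fset0 => i; rewrite in_fset0; apply/esym/eqP => e; apply: no; exists i.
have [_] := has_sumR_fiber (fun i j => hfib j i) bf hs.
rewrite (_ : (fun j => _) = F) //; apply/funext => j.
have [[i0 e]|no] := pselect (exists i, io i = j).
  rewrite (_ : fib j = [fset i0]%fset) ?big_seq_fset1 ?e //.
  by apply/fsetP => i; rewrite hfib in_fset1 -e (inj_eq ii).
rewrite F0 => [|i e]; last by apply: no; exists i.
rewrite (_ : fib j = fset0) ?big_seq_fset0 //; apply/fsetP => i; rewrite hfib in_fset0.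
by apply/eqP => e; apply: no; exists i.
Qed.

Lemma has_sumR_prod (I J : choiceType) (f : I -> C) (g : J -> C) s s' :
  bdd f -> bdd g -> has_sumR f s -> has_sumR g s' ->
  bdd (fun k : I * J => f k.1 * g k.2) /\ has_sumR (fun k : I * J => f k.1 * g k.2) (s * s').
Proof.
move=> [M hM] [M' hM'] hs hs'.
have rect (V : pzRingType) (F : I -> V) (G : J -> V) (A : {fset I}) (B : {fset J}) :
    \sum_(k <- (A `*` B)%fset) F k.1 * G k.2 = (\sum_(i <- A) F i) * (\sum_(j <- B) G j).
  rewrite big_distrl /=; under [RHS]eq_bigr do rewrite big_distrr /=.
  rewrite (perm_big [seq (i, j) | i <- A, j <- B]) ?big_allpairs //.
  apply: uniq_perm; first exact: fset_uniq.
    by apply: allpairs_uniq => //; [exact: fset_uniq..| move=> [? ?] [? ?] _ _ [-> ->]].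
  move=> [i j]; rewrite in_fsetM; apply/andP/allpairsP => [[h1 h2]|[[i' j'] /= [h1 h2 [-> ->]]] //].
  by exists (i, j).
have sub (E : {fset I * J}) : (E `<=` ([fset k.1 | k in E] `*` [fset k.2 | k in E]))%fset.
  apply/fsubsetP => k kE; rewrite in_fsetM; apply/andP.
  by split; apply/imfsetP; exists k.
have bfg : bdd (fun k : I * J => f k.1 * g k.2).
  exists (M * M') => E; pose A := [fset k.1 | k in E]%fset; pose B := [fset k.2 | k in E]%fset.
  apply: (@le_trans _ _ (\sum_(k <- (A `*` B)%fset) nm (f k.1 * g k.2))).
    by rewrite (sum_subset _ (sub E)) lerDl; apply: nm_sum_ge0.
  under eq_bigr do rewrite nmM; rewrite (rect _ (fun i => nm (f i)) (fun j => nm (g j))).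
  by apply: ler_pM => //; apply: nm_sum_ge0.
split=> //; apply: has_sumR_approx => // e E e0.
pose K := nm s' + nm s + 1.
have K0 : 0 < K by rewrite /K; have := nm_ge0 s; have := nm_ge0 s'; lra.
pose d := Num.min 1 (e / K).
have d0 : 0 < d by rewrite lt_min ltr01 divr_gt0.
have [A hA] := hs _ d0; have [B hB] := hs' _ d0.
pose A' := (A `|` [fset k.1 | k in E])%fset; pose B' := (B `|` [fset k.2 | k in E])%fset.
exists (A' `*` B')%fset.
  apply: fsubset_trans (sub E) _; apply/fsubsetP => k; rewrite !in_fsetM => /andP[h1 h2].
  by rewrite !in_fsetU h1 h2 !orbT.
rewrite (rect _ f g); have := hA _ (fsubsetUl A _ : (A `<=` A')%fset).
have := hB _ (fsubsetUl B _ : (B `<=` B')%fset).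
move: (\sum_(i <- A') f i) (\sum_(j <- B') g j) => a b hb ha.
have -> : a * b - s * s' = (a - s) * s' + (s + (a - s)) * (b - s') by ring.
apply: le_trans (nmD _ _) _; rewrite !nmM.
have d1 : d <= 1 by rewrite ge_min lexx.
have hs1 : nm (s + (a - s)) <= nm s + 1 by apply: le_trans (nmD _ _) _; lra.
have h1 : nm (a - s) * nm s' <= d * nm s' by apply: ler_wpM2r => //; apply: nm_ge0.
have h2 : nm (s + (a - s)) * nm (b - s') <= (nm s + 1) * d by apply: ler_pM => //; apply: nm_ge0.
have h3 : d * K <= e by rewrite -ler_pdivlMr // ge_min lexx orbT.
apply: le_trans (lerD h1 h2) _; apply: le_trans h3; rewrite /K; lra.
Qed.

Definition lim_to (u : nat -> C) (l : C) :=
  forall e, 0 < e -> exists N0, forall N, (N0 <= N)%N -> nm (u N - l) <= e.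

(** Tannery's theorem: outside a finite set the sums are uniformly small by the bound [K], and on a
    finite set the limit can be taken termwise. *)
Lemma dominated_limit (I : choiceType) (c : nat -> I -> C) (g : I -> C) (S : nat -> C) (l s : C) (K : R) :
  bdd g -> has_sumR g s -> (forall N i, nm (c N i) <= K) -> (forall i, lim_to (c^~ i) l) ->
  (forall N, has_sumR (fun i => c N i * g i) (S N)) -> lim_to S (l * s).
Proof.
move=> bg hg hK hl hS e e0.
have fin (A : {fset I}) (d : R) : 0 < d -> exists N0, forall N, (N0 <= N)%N ->
    nm (\sum_(i <- A) c N i * g i - l * \sum_(i <- A) g i) <= d.
  elim/finSet_rect: A d => A IH d d0.
  have [->|[i iA]] := fset_0Vmem A.
    by exists 0%N => N _; rewrite !big_seq_fset0 mulr0 subrr nm0 ltW.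
  have d2 : 0 < d / 2 by lra.
  have [N1 h1] := IH (A `\ i)%fset (fproperD1 iA) _ d2.
  have g0 := nm_ge0 (g i).
  have d3 : 0 < d / (2 * (nm (g i) + 1)) by rewrite divr_gt0 // mulr_gt0 //; lra.
  have [N2 h2] := hl i _ d3; exists (maxn N1 N2) => N; rewrite geq_max => /andP[/h1 k1 /h2 k2].
  rewrite !(big_fsetD1 i iA) /= mulrDr opprD addrACA -mulrBl; apply: le_trans (nmD _ _) _; rewrite nmM.
  have : nm (c N i - l) * nm (g i) <= d / (2 * (nm (g i) + 1)) * (nm (g i) + 1).
    by apply: ler_pM => //; [exact: nm_ge0 | lra].
  have -> : d / (2 * (nm (g i) + 1)) * (nm (g i) + 1) = d / 2 by field; lra.
  by move: k1; lra.
have K0 : 0 <= Num.max K 0 by rewrite le_max lexx orbT.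
pose d := e / (4 * (Num.max K 0 + nm l + 2)).
have D0 : 0 < Num.max K 0 + nm l + 2 by have := nm_ge0 l; lra.
have d0 : 0 < d by rewrite divr_gt0 // mulr_gt0.
have [A1 hA1] := bdd_tail bg d0; have [A2 hA2] := hg _ d0.
pose A := (A1 `|` A2)%fset.
have hA : nm (\sum_(i <- A) g i - s) <= d by apply: hA2; apply: fsubsetUr.
have hT B : [disjoint A & B]%fset -> \sum_(i <- B) nm (g i) <= d.
  by move=> dAB; apply: hA1; apply/fdisjointP => i iA; apply: (fdisjointP dAB); rewrite in_fsetU iA.
have tailN N : nm (S N - \sum_(i <- A) c N i * g i) <= Num.max K 0 * d + d.
  have [B hB] := hS N _ d0; have := hB _ (fsubsetUr A B).
  rewrite (sum_subset _ (fsubsetUl A B)); set T := \sum_(i <- (_ `\` _)%fset) _ => h.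
  have -> : S N - \sum_(i <- A) c N i * g i = T - (\sum_(i <- A) c N i * g i + T - S N) by ring.
  apply: le_trans (nmB _ _) _; apply: lerD => //; apply: le_trans (nm_sum _ _) _.
  apply: (@le_trans _ _ (\sum_(i <- ((A `|` B) `\` A)%fset) Num.max K 0 * nm (g i))).
    apply: ler_sum => i _; rewrite nmM; apply: ler_wpM2r; first exact: nm_ge0.
    by apply: le_trans (hK N i) _; rewrite le_max lexx.
  rewrite -mulr_sumr; apply: ler_wpM2l => //; apply: hT.
  by rewrite fdisjoint_sym; apply/fdisjointP => i; rewrite in_fsetD => /andP[].
have [N0 hN0] := fin A d d0.
exists N0 => N /hN0 h1.
have -> : S N - l * s = (S N - \sum_(i <- A) c N i * g i) +
   (\sum_(i <- A) c N i * g i - l * \sum_(i <- A) g i) + l * (\sum_(i <- A) g i - s) by ring.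
apply: le_trans (nmD _ _) _; rewrite nmM.
have h2 := nmD (S N - \sum_(i <- A) c N i * g i) (\sum_(i <- A) c N i * g i - l * \sum_(i <- A) g i).
have h3 : nm l * nm (\sum_(i <- A) g i - s) <= nm l * d by apply: ler_wpM2l => //; apply: nm_ge0.
have h4 := tailN N.
have h5 : (Num.max K 0 + nm l + 2) * d = e / 4 by rewrite /d; field; lra.
have : Num.max K 0 * d + d + d + nm l * d <= e by rewrite -[e]mul1r; move: h5; nra.
by lra.
Qed.

End UnconditionalSums.

(** * Infinite products *)

Section InfiniteProducts.
Variable R : realType.
Notation C := R[i].
Implicit Types (y r : C) (u v : nat -> C).

Lemma lim_to_unique u (l l' : C) : lim_to u l -> lim_to u l' -> l = l'.
Proof.
move=> h h'; apply/eqP; rewrite -subr_eq0; apply/eqP/nm_eq_small => e e0.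
have e2 : 0 < e / 2 by lra.
have [N hN] := h _ e2; have [N' hN'] := h' _ e2.
have := hN _ (leq_maxl N N'); have := hN' _ (leq_maxr N N'); move: (u _) => x h1 h2.
have -> : l - l' = (x - l') - (x - l) by ring.
by apply: le_trans (nmB _ _) _; lra.
Qed.

Lemma lim_to_ext u v (l : C) : (forall N, u N = v N) -> lim_to u l -> lim_to v l.
Proof. by move=> /funext ->. Qed.

Lemma lim_toM u v (a b : C) : lim_to u a -> lim_to v b -> lim_to (fun N => u N * v N) (a * b).
Proof.
move=> hu hv e e0; pose K := nm a + nm b + 1.
have K0 : 0 < K by rewrite /K; have := nm_ge0 a; have := nm_ge0 b; lra.
pose d := Num.min 1 (e / K); have d0 : 0 < d by rewrite lt_min ltr01 divr_gt0.
have [N1 h1] := hu _ d0; have [N2 h2] := hv _ d0; exists (maxn N1 N2) => N.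
rewrite geq_max => /andP[/h1 k1 /h2 k2].
have -> : u N * v N - a * b = (u N - a) * b + (a + (u N - a)) * (v N - b) by ring.
apply: le_trans (nmD _ _) _; rewrite !nmM.
have d1 : d <= 1 by rewrite ge_min lexx.
have hs1 : nm (a + (u N - a)) <= nm a + 1 by apply: le_trans (nmD _ _) _; lra.
have g1 : nm (u N - a) * nm b <= d * nm b by apply: ler_wpM2r => //; apply: nm_ge0.
have g2 : nm (a + (u N - a)) * nm (v N - b) <= (nm a + 1) * d by apply: ler_pM => //; apply: nm_ge0.
have g3 : d * K <= e by rewrite -ler_pdivlMr // ge_min lexx orbT.
apply: le_trans (lerD g1 g2) _; apply: le_trans g3; rewrite /K; lra.
Qed.

Lemma lim_toV u (a : C) : a != 0 -> lim_to u a -> lim_to (fun N => (u N)^-1) a^-1.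
Proof.
move=> a0 hu e e0; have na := nm_gt0 a0.
pose d := Num.min (nm a / 2) (e * (nm a ^+ 2 / 2)).
have d0 : 0 < d by rewrite lt_min !(divr_gt0, mulr_gt0, exprn_gt0).
have [N0 h] := hu _ d0; exists N0 => N /h hN.
have h1 : nm (u N - a) <= nm a / 2 by apply: le_trans hN _; rewrite ge_min lexx.
have h2 : nm (u N - a) <= e * (nm a ^+ 2 / 2) by apply: le_trans hN _; rewrite ge_min lexx orbT.
have lb : nm a / 2 <= nm (u N).
  have := nmD (u N) (a - u N); rewrite addrC subrK (nmBC a); lra.
have u0 : u N != 0 by rewrite -nm_eq0; apply/eqP => e'; move: lb; rewrite e'; lra.
have -> : (u N)^-1 - a^-1 = - (u N - a) * ((u N)^-1 * a^-1) by field; rewrite a0 u0.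
have nu0 : 0 < nm (u N) := nm_gt0 u0.
rewrite !nmM nmN !nmV -invfM ler_pdivrMr ?mulr_gt0 //.
apply: le_trans h2 _; rewrite -subr_ge0.
have -> : e * (nm (u N) * nm a) - e * (nm a ^+ 2 / 2) = (e * nm a) * (nm (u N) - nm a / 2) by field.
by rewrite mulr_ge0 ?subr_ge0 // mulr_ge0 // ltW.
Qed.

Lemma lim_to_sub (h : nat -> nat) u (l : C) : (forall N, (N <= h N)%N) -> lim_to u l ->
  lim_to (fun N => u (h N)) l.
Proof. by move=> hh hu e /hu[N0 hN]; exists N0 => N le; apply/hN/(leq_trans le). Qed.

Lemma sum_geo (t : R) N : 0 <= t < 1 -> \sum_(n < N) t ^+ n <= (1 - t)^-1.
Proof.
move=> /andP[t0 t1]; have p : 0 < 1 - t by lra.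
rewrite -[leRHS]mul1r ler_pdivlMr // mulrC.
have -> : (1 - t) * \sum_(n < N) t ^+ n = 1 - t ^+ N.
  elim: N => [|N IH]; first by rewrite big_ord0 mulr0 expr0 subrr.
  by rewrite big_ord_recr /= mulrDr IH exprS; ring.
by have := exprn_ge0 N t0; lra.
Qed.

Lemma prod_le_exp (t : nat -> R) N : (forall n, 0 <= t n) ->
  \prod_(n < N) (1 + t n) <= expR (\sum_(n < N) t n).
Proof.
move=> t0; elim: N => [|N IH]; first by rewrite !big_ord0 expR0.
rewrite !big_ord_recr /= expRD; apply: ler_pM => //.
- by apply: prodr_ge0 => i _; have := t0 i; lra.
- by have := t0 N; lra.
exact: expR_ge1Dx.
Qed.

Lemma nm_prod_le (w : nat -> C) N :
  nm (\prod_(n < N) (1 + w n)) <= expR (\sum_(n < N) nm (w n)).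
Proof.
apply: le_trans (prod_le_exp (t := fun n => nm (w n)) N (fun n => nm_ge0 (w n))).
elim: N => [|N IH]; first by rewrite !big_ord0 nm1.
rewrite !big_ord_recr /= nmM; apply: ler_pM => //; try exact: nm_ge0.
by apply: le_trans (nmD _ _) _; rewrite nm1.
Qed.

Lemma nm_prod_dev (w : nat -> C) N :
  nm (\prod_(n < N) (1 + w n) - 1) <= expR (\sum_(n < N) nm (w n)) - 1.
Proof.
elim: N => [|N IH]; first by rewrite !big_ord0 expR0 !subrr nm0.
have hP := nm_prod_le w N; rewrite !big_ord_recr /= expRD.
move: (\prod_(n < N) _) (expR (\sum_(n < N) _)) IH hP => P E IH hP.
have -> : P * (1 + w N) - 1 = (P - 1) + P * w N by ring.
apply: le_trans (nmD _ _) _; rewrite nmM.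
have h1 := expR_ge1Dx (nm (w N)); have h2 := nm_ge0 P; have h3 := nm_ge0 (w N).
have h4 : nm P * nm (w N) <= E * nm (w N) by apply: ler_wpM2r.
have h5 : E * (1 + nm (w N)) <= E * expR (nm (w N)).
  by apply: ler_wpM2l => //; apply: le_trans hP.
by lra.
Qed.

(** The q-Pochhammer symbol with parameter [- y] and base [r], of length [N]. *)
Definition pw (N : nat) y r : C := \prod_(n < N) (1 + y * r ^+ n).

Lemma sum_nm_geo y r N : nm r < 1 -> \sum_(n < N) nm (y * r ^+ n) <= nm y / (1 - nm r).
Proof.
move=> r1; under eq_bigr do rewrite nmM nmX; rewrite -mulr_sumr.
by apply: ler_wpM2l; [exact: nm_ge0 | apply: sum_geo; rewrite nm_ge0].
Qed.

Lemma nm_pw N y r : nm r < 1 -> nm (pw N y r) <= expR (nm y / (1 - nm r)).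
Proof.
move=> r1; apply: le_trans (nm_prod_le (fun n => y * r ^+ n) N) _.
by rewrite ler_expR sum_nm_geo.
Qed.

(** For [0 <= t <= |y| < 1] one has [(1 - t) (1 + t / (1 - |y|)) >= 1]. This bounds the partial
    products away from 0 uniformly in [N], so that the limit is not 0. *)
Lemma nm_pw_inv N y r : nm y < 1 -> nm r < 1 ->
  1 <= nm (pw N y r) * expR (nm y / ((1 - nm y) * (1 - nm r))).
Proof.
move=> y1 r1; have y0 := nm_ge0 y; have r0 := nm_ge0 r.
pose s N := \sum_(n < N) nm (y * r ^+ n) / (1 - nm y).
suff h : 1 <= nm (pw N y r) * expR (s N).
  apply: le_trans h _; apply: ler_wpM2l; first exact: nm_ge0.
  rewrite ler_expR /s -mulr_suml invfM mulrA mulrAC; apply: ler_wpM2r.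
    by rewrite invr_ge0; lra.
  exact: sum_nm_geo.
rewrite /pw /s; elim: N => [|N IH]; first by rewrite !big_ord0 nm1 expR0 mulr1.
rewrite !big_ord_recr /= expRD nmM mulrACA; apply: mulr_ege1 => //.
set t := nm (y * r ^+ N).
have ty : t <= nm y.
  by rewrite /t nmM nmX ler_piMr // exprn_ile1 // ltW.
have t0 : 0 <= t := nm_ge0 _.
have h1 : 1 - t <= nm (1 + y * r ^+ N).
  have := nmB (1 + y * r ^+ N) (y * r ^+ N); rewrite addrK nm1 -/t; lra.
have h2 := expR_ge1Dx (t / (1 - nm y)).
have p : 0 < 1 - nm y by lra.
have h3 : 0 <= t / (1 - nm y) by rewrite divr_ge0 // ltW.
apply: (@le_trans _ _ ((1 - t) * (1 + t / (1 - nm y)))); last by apply: ler_pM => //; lra.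
have -> : (1 - t) * (1 + t / (1 - nm y)) = 1 + t / (1 - nm y) * (nm y - t) by field; lra.
by rewrite lerDl mulr_ge0 // subr_ge0.
Qed.

Lemma lim_to_neq0 u (l : C) (K : R) : 0 < K -> (forall N, 1 <= nm (u N) * K) -> lim_to u l -> l != 0.
Proof.
move=> K0 h hl; apply/eqP => l0; have e0 : 0 < (2 * K)^-1 by rewrite invr_gt0 mulr_gt0.
have [N /(_ N (leqnn N))] := hl _ e0; rewrite l0 subr0 => h1.
have := h N; have : nm (u N) * K <= (2 * K)^-1 * K by rewrite ler_pM2r.
have -> : (2 * K)^-1 * K = 1 / 2 by field; lra.
by lra.
Qed.

Lemma normc_le (a b : R) : nm (a +i* b)%C <= `|a| + `|b|.
Proof.
have -> : (a +i* b)%C = a%:C%C + b%:C%C * 'i%C by simpc.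
apply: le_trans (nmD _ _) _; rewrite nmM.
have e1 (x : R) : nm x%:C%C = `|x| by rewrite /nm /= expr0n /= addr0 sqrtr_sqr.
have e2 : nm 'i%C = 1 :> R by rewrite /nm /= expr0n /= add0r expr1n sqrtr1.
by rewrite !e1 e2 mulr1.
Qed.

Lemma Re_le (z : C) : `|complex.Re z| <= nm z.
Proof.
case: z => a b; rewrite /nm /= -(sqrtr_sqr a) ler_sqrt ?addr_ge0 ?sqr_ge0 //.
by rewrite lerDl sqr_ge0.
Qed.

Lemma Im_le (z : C) : `|complex.Im z| <= nm z.
Proof.
case: z => a b; rewrite /nm /= -(sqrtr_sqr b) ler_sqrt ?addr_ge0 ?sqr_ge0 //.
by rewrite lerDr sqr_ge0.
Qed.

Lemma real_cauchy (v : nat -> R) (K t : R) : 0 <= t < 1 ->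
  (forall N, `|v N.+1 - v N| <= K * t ^+ N) ->
  exists l, forall e, 0 < e -> exists N0, forall N, (N0 <= N)%N -> `|v N - l| <= e.
Proof.
move=> /andP[t0 t1] h; pose d N := v N.+1 - v N.
have cd : cvgn (series d).
  apply: normed_cvg; apply: (@series_le_cvg _ _ (geometric K t)) => //=.
  - by move=> n; apply: le_trans (h n).
  by apply: is_cvg_geometric_series; rewrite ger0_norm.
have sd N : series d N = v N - v 0%N.
  by rewrite /series /= telescope_sumr.
exists (limn (series d) + v 0%N) => e e0.
have [N0 _ hN] := (cvgrPdist_le _ _).1 cd e e0; exists N0 => N le.
have := hN N le; rewrite /= sd distrC => h1.
by apply: le_trans h1; rewrite opprD addrA addrAC.
Qed.

Lemma lim_to_cauchy u (K t : R) : 0 <= t < 1 ->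
  (forall N, nm (u N.+1 - u N) <= K * t ^+ N) -> exists l, lim_to u l.
Proof.
move=> ht h.
have hRe N : `|complex.Re (u N.+1) - complex.Re (u N)| <= K * t ^+ N.
  by apply: le_trans (h N); rewrite -raddfB; apply: Re_le.
have hIm N : `|complex.Im (u N.+1) - complex.Im (u N)| <= K * t ^+ N.
  by apply: le_trans (h N); rewrite -raddfB; apply: Im_le.
have [a ha] := @real_cauchy (fun N => complex.Re (u N)) K t ht hRe.
have [b hb] := @real_cauchy (fun N => complex.Im (u N)) K t ht hIm.
exists (a +i* b)%C => e e0; have e2 : 0 < e / 2 by lra.
have [N1 h1] := ha _ e2; have [N2 h2] := hb _ e2; exists (maxn N1 N2) => N.
rewrite geq_max => /andP[/h1 k1 /h2 k2].
have -> : u N - (a +i* b)%C = ((complex.Re (u N) - a) +i* (complex.Im (u N) - b))%C.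
  by case: (u N).
by apply: le_trans (normc_le _ _) _; lra.
Qed.

Lemma pw_cvg y r : nm r < 1 -> exists l, lim_to (fun N => pw N y r) l.
Proof.
move=> r1; apply: (@lim_to_cauchy _ (expR (nm y / (1 - nm r)) * nm y) (nm r)).
  by rewrite nm_ge0.
move=> N; rewrite /pw big_ord_recr /= -/(pw N y r).
have -> : pw N y r * (1 + y * r ^+ N) - pw N y r = pw N y r * (y * r ^+ N) by ring.
rewrite !nmM nmX mulrA; apply: ler_wpM2r; first exact/exprn_ge0/nm_ge0.
by apply: ler_wpM2r; [exact: nm_ge0 | exact: nm_pw].
Qed.

Local Open Scope classical_set_scope.

Lemma lim_toP u (l : C) : lim_to u l -> (u : nat -> C^o) @ \oo --> (l : C^o).
Proof.
move=> h; apply/cvgrPdist_le => e e0.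
have er : e = (complex.Re e)%:C%C by apply/esym/complex.RRe_real/gtr0_real.
have [|N0 hN] := h (complex.Re e); first by move: e0; rewrite er ltcR.
exists N0 => // N /= /hN; rewrite distrC er -rc_le; apply: le_trans.
exact: lexx.
Qed.

Lemma lim_to_lim u (l : C) : lim_to u l -> lim ((u : nat -> C^o) @ \oo) = l.
Proof. by move=> /lim_toP h; apply: (cvg_lim (@norm_hausdorff _ C^o)). Qed.

Definition Pinf y r : C := lim ((fun N => pw N y r : C^o) @ \oo).

Local Close Scope classical_set_scope.

Lemma Pinf_lim y r : nm r < 1 -> lim_to (fun N => pw N y r) (Pinf y r).
Proof. by move=> /(pw_cvg y)[l h]; rewrite /Pinf (lim_to_lim h). Qed.

Lemma Pinf_neq0 y r : nm y < 1 -> nm r < 1 -> Pinf y r != 0.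
Proof.
move=> y1 r1; apply: lim_to_neq0 (expR_gt0 _) _ (Pinf_lim y r1) => N.
exact: nm_pw_inv.
Qed.

Lemma nm_sqr_lt1 r : nm r < 1 -> nm (r ^+ 2) < 1.
Proof. by move=> r1; rewrite nmX expr_lt1 // nm_ge0. Qed.

Lemma Pinf_split y r : nm r < 1 -> Pinf y r = Pinf y (r ^+ 2) * Pinf (y * r) (r ^+ 2).
Proof.
move=> r1; have r2 := nm_sqr_lt1 r1.
have hd N : (N <= N.*2)%N by lia.
apply: (lim_to_unique (lim_to_sub hd (Pinf_lim y r1))).
apply: lim_to_ext (lim_toM (Pinf_lim y r2) (Pinf_lim (y * r) r2)) => N.
elim: N => [|N IH]; first by rewrite /pw !big_ord0 mulr1.
rewrite doubleS; move: IH; rewrite /pw !big_ord_recr /= => <-.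
by rewrite -!exprM mulrACA -!mulrA -exprS mul2n.
Qed.

Lemma Pinf_opp y r : nm r < 1 -> Pinf (- y) r * Pinf y r = Pinf (- y ^+ 2) (r ^+ 2).
Proof.
move=> r1; apply/esym/(lim_to_unique (Pinf_lim _ (nm_sqr_lt1 r1))).
apply: lim_to_ext (lim_toM (Pinf_lim (- y) r1) (Pinf_lim y r1)) => N.
rewrite /pw -big_split /=; apply: eq_bigr => n _.
by rewrite -exprM mulnC exprM; ring.
Qed.

End InfiniteProducts.

(** * Theta functions *)

Section JacobiTripleProduct.
Variable R : realType.
Notation C := R[i].
Implicit Types (n m k : int) (y : C).

Fixpoint zball (N : nat) : {fset int} :=
  if N is N'.+1 then (N%:Z |` (- N%:Z |` zball N'))%fset else [fset 0 : int]%fset.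

Lemma zballP N n : (n \in zball N) = (`|n| <= N)%N.
Proof.
elim: N => [|N IH] /=; first by rewrite in_fset1; lia.
by rewrite !in_fset1U IH; lia.
Qed.

Lemma sum_zball (V : zmodType) (f : int -> V) N :
  \sum_(n <- zball N) f n = f 0 + \sum_(j < N) (f j.+1%:Z + f (- j.+1%:Z)).
Proof.
elim: N => [|N IH]; first by rewrite big_ord0 addr0 /= big_seq_fset1.
rewrite big_ord_recr /= big_fsetU1 /=; last by rewrite in_fset1U zballP; lia.
rewrite big_fsetU1 /=; last by rewrite zballP; lia.
by rewrite IH addrA [_ + (f 0 + _)]addrC -addrA.
Qed.

Lemma zball_exhaust n : exists N0, forall N, (N0 <= N)%N -> n \in zball N.
Proof. by exists `|n|%N => N; rewrite zballP. Qed.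

Lemma int_geo_sum (f : int -> C) (K t : R) : 0 <= t < 1 ->
  (forall n, nm (f n) <= K * t ^+ `|n|%N) -> bdd f /\ exists s, has_sumR f s.
Proof.
move=> ht hf; have /andP[t0 t1] := ht.
have K0 : 0 <= K by have := hf 0; rewrite expr0 mulr1; apply: le_trans; apply: nm_ge0.
have bf : bdd f.
  apply: (@bdd_exhaust R int f zball (K + 2 * K / (1 - t)) zball_exhaust) => N.
  rewrite (sum_zball (fun n => nm (f n))); apply: lerD.
    by apply: le_trans (hf 0) _; rewrite expr0 mulr1.
  apply: (@le_trans _ _ (\sum_(j < N) 2 * K * t ^+ j)).
    apply: ler_sum => j _.
    have h1 := hf j.+1%:Z; have h2 := hf (- j.+1%:Z); rewrite abszN in h2.
    have h3 : K * t ^+ j.+1 <= K * t ^+ j.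
      by apply: ler_wpM2l => //; rewrite exprS ler_piMl ?exprn_ge0 // ltW.
    by rewrite /= in h1 h2; lra.
  rewrite -mulr_sumr; apply: ler_wpM2l; first by rewrite mulr_ge0.
  exact: sum_geo.
split=> //.
have [|s hs] := @lim_to_cauchy R (fun N => \sum_(n <- zball N) f n) (2 * K) t ht.
  move=> N; rewrite !sum_zball big_ord_recr /= addrA [X in nm X]addrC addKr.
  apply: le_trans (nmD _ _) _.
  have h1 := hf N.+1%:Z; have h2 := hf (- N.+1%:Z); rewrite abszN in h2.
  have h3 : K * t ^+ N.+1 <= K * t ^+ N.
    by apply: ler_wpM2l => //; rewrite exprS ler_piMl ?exprn_ge0 // ltW.
  by rewrite /= in h1 h2; lra.
exists s; apply: (has_sumR_exhaust bf zball_exhaust) => e e0.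
by have [N0 h0] := hs _ e0; exists N0 => N /h0.
Qed.

Lemma nm_exprz y n : nm (y ^ n) = nm y ^ n.
Proof. by case: n => n; [exact: nmX | rewrite -[y ^ Negz n]/((y ^+ n.+1)^-1) nmV nmX]. Qed.

Definition tterm (p y : C) n : C := p ^ (n * n) * y ^ n.

Lemma small_power (t e : R) : 0 <= t < 1 -> 0 < e -> exists k : nat, t ^+ k <= e.
Proof.
move=> /andP[t0 t1] e0; have ht : `|t| < 1 by rewrite ger0_norm.
have [N0 _ hN] := (cvgrPdist_le _ _).1 (cvg_expr ht) e e0; exists N0.
by have := hN N0 (leqnn N0); rewrite /= sub0r normrN ger0_norm // exprn_ge0.
Qed.

(** The power [p ^ (n * n)] wins: once [|p| ^ |n| <= 1 / (2 Y)], where [Y] bounds [|y|] and its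
    inverse, the term is at most [2 ^ (- |n|)]. The constant absorbs the finitely many other
    terms. *)
Lemma tterm_geo (p y : C) : p != 0 -> y != 0 -> nm p < 1 ->
  exists K : R, forall n, nm (tterm p y n) <= K * (2^-1) ^+ `|n|%N.
Proof.
move=> p0 y0 p1; have np := nm_ge0 p.
pose Y := nm y + (nm y)^-1 + 1.
have ny := nm_gt0 y0; have nyi : 0 < (nm y)^-1 by rewrite invr_gt0.
have Y1 : 1 <= Y by rewrite /Y; lra.
have hp : 0 <= nm p < 1 by rewrite np.
have hY : 0 < (2 * Y)^-1 by rewrite invr_gt0; lra.
have [k0 hk0] := small_power hp hY.
have hYn n : nm y ^ n <= Y ^+ `|n|%N.
  case: n => n /=; first by apply: lerXn2r; rewrite ?nnegrE /Y; lra.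
  by rewrite -[nm y ^ Negz n]/((nm y ^+ n.+1)^-1) -exprVn; apply: lerXn2r; rewrite ?nnegrE /Y; lra.
exists ((2 * Y) ^+ k0) => n; rewrite /tterm nmM !nm_exprz.
have -> : nm p ^ (n * n) = (nm p ^+ `|n|%N) ^+ `|n|%N.
  by rewrite -exprM -[RHS]/(nm p ^ (`|n| * `|n|)%N%:Z); congr (_ ^ _); lia.
move: (hYn n); set k := `|n|%N => hYk.
apply: (@le_trans _ _ ((nm p ^+ k) ^+ k * Y ^+ k)).
  by apply: ler_wpM2l => //; rewrite !exprn_ge0.
rewrite -exprMn; have b0 : 0 <= nm p ^+ k * Y by rewrite mulr_ge0 ?exprn_ge0 //; lra.
have [hk|hk] := leqP k0 k.
  have : nm p ^+ k * Y <= 2^-1.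
    apply: (@le_trans _ _ ((2 * Y)^-1 * Y)); last first.
      have -> : (2 * Y)^-1 * Y = 2^-1 :> R by field; lra.
      exact: lexx.
    apply: ler_wpM2r; first by lra.
    by apply: le_trans hk0; apply: ler_wiXn2l => //; exact: ltW.
  move=> hb; apply: (@le_trans _ _ (1 * 2^-1 ^+ k)).
    by rewrite mul1r; apply: lerXn2r => //; rewrite nnegrE.
  by apply: ler_wpM2r; [rewrite exprn_ge0 | apply: exprn_ege1; lra].
apply: (@le_trans _ _ (Y ^+ k)).
  apply: lerXn2r; rewrite ?nnegrE //; first by lra.
  by rewrite ler_piMl ?exprn_ile1 //; lra.
have -> : Y ^+ k = (2 * Y) ^+ k * 2^-1 ^+ k.
  by rewrite -exprMn; congr (_ ^+ k); field.
apply: ler_wpM2r; first by rewrite exprn_ge0.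
by apply: ler_weXn2l; [lra | exact: ltnW].
Qed.

Section Product.
Variables p y : C.
Hypotheses (p0 : p != 0) (y0 : y != 0) (p1 : nm p < 1).
Let q := p ^+ 2.

Let q0 : q != 0.
Proof. by rewrite expf_neq0. Qed.

Let q1 : nm q < 1.
Proof. exact: nm_sqr_lt1. Qed.

Let qp N : C := pw N (- q) q.

Let one_sub_neq0 N : 1 - q ^+ N.+1 != 0.
Proof.
rewrite subr_eq0; apply/eqP => /(congr1 (@nm R)); rewrite nm1 nmX => e.
have h : nm q ^+ N <= 1 by apply: exprn_ile1; [exact: nm_ge0 | exact: ltW].
by move: q1 (nm_ge0 q) h; move: e; rewrite exprS; nra.
Qed.

Let qpS N : qp N.+1 = qp N * (1 - q ^+ N.+1).
Proof. by rewrite /qp /pw big_ord_recr /= mulNr -exprS. Qed.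

Let qp_neq0 N : qp N != 0.
Proof. by elim: N => [|N IH]; [rewrite /qp /pw big_ord0 oner_eq0 | rewrite qpS; apply: mulf_neq0 (one_sub_neq0 N)]. Qed.

(* 1 / (q; q)_k, extended by 0 so that [Dpred] holds for all integers k *)
Let D k : C := if k is Posz j then (qp j)^-1 else 0.

Let Dpred k : D (k - 1) = (1 - q ^ k) * D k.
Proof.
case: k => [[|j]|j].
- by rewrite /= expr0z subrr mul0r.
- rewrite (_ : j.+1%:Z - 1 = j%:Z); last by lia.
  rewrite /D qpS invfM mulrCA -[q ^ j.+1]/(q ^+ j.+1) mulfV ?mulr1 //.
have -> : Negz j - 1 = Negz j.+1 by lia.
by rewrite /D mulr0.
Qed.

(* the q-binomial coefficient [2N choose N + n] *)
Let c (N : nat) n : C := qp N.*2 * (D (N%:Z + n) * D (N%:Z - n)).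

Let c_supp N n : n \notin zball N -> c N n = 0.
Proof.
rewrite zballP -ltnNge => h; rewrite /c.
case: (lerP 0 n) => n0.
  by rewrite (_ : N%:Z - n = Negz (`|n| - N).-1) ?mulr0 //; lia.
by rewrite (_ : N%:Z + n = Negz (`|n| - N).-1) ?mul0r ?mulr0 //; lia.
Qed.

Let lsumZ (a : C) (F : int -> C) : fsupp F -> a * lsum F = lsum (fun n => a * F n).
Proof.
move=> [A hA]; rewrite (lsumE hA) (@lsumE _ _ A) ?mulr_sumr // => n /hA ->.
by rewrite mulr0.
Qed.

Let F N n := c N n * tterm p y n.

Let F_supp N : fsupp (F N).
Proof. by exists (zball N) => n /c_supp h; rewrite /F h mul0r. Qed.

(** Two steps of the q-Pascal rule at once, one for each factor added when [N] grows by 1. Written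
    through [D], it is a rational identity in the powers of [q], valid also at the ends of the
    range. *)
Let c_rec N n : c N.+1 n = (1 + q ^+ (N.*2.+1)) * c N n
  + q ^ (N%:Z + 1 - n) * c N (n - 1) + q ^ (N%:Z + 1 + n) * c N (n + 1).
Proof.
rewrite /c doubleS !qpS.
have ea : N.+1%:Z + n = N%:Z + 1 + n by lia.
have eb : N.+1%:Z - n = N%:Z + 1 - n by lia.
rewrite ea eb; set a := N%:Z + 1 + n; set b := N%:Z + 1 - n.
rewrite (_ : N%:Z + n = a - 1); last by rewrite /a; lia.
rewrite (_ : N%:Z - n = b - 1); last by rewrite /b; lia.
rewrite (_ : N%:Z + (n - 1) = a - 1 - 1); last by rewrite /a; lia.
rewrite (_ : N%:Z - (n - 1) = b); last by rewrite /b; lia.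
rewrite (_ : N%:Z + (n + 1) = a); last by rewrite /a; lia.
rewrite (_ : N%:Z - (n + 1) = b - 1 - 1); last by rewrite /b; lia.
rewrite !(Dpred (_ - 1)) !Dpred.
have e1 k : q ^ (k - 1) = q ^ k / q by rewrite expfzDr.
rewrite !e1.
have eAB : q ^+ N.*2.+2 = q ^ a * q ^ b.
  by rewrite -expfzDr // -[LHS]/(q ^ N.*2.+2%:Z); congr (_ ^ _); rewrite /a /b; lia.
have eAB1 : q ^+ N.*2.+1 = q ^ a * q ^ b / q by rewrite -eAB [q ^+ N.*2.+2]exprSr mulfK.
rewrite eAB eAB1; move: (q ^ a) (q ^ b) (D a) (D b) (qp _) q0 => A B Da Db X h.
by field.
Qed.

Let tterm_pred N n : y * p * q ^+ N * tterm p y (n - 1) = q ^ (N%:Z + 1 - n) * tterm p y n.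
Proof.
rewrite /tterm.
have -> : p ^ ((n - 1) * (n - 1)) = p ^ (n * n) * (p ^ (1 - n) * p ^ (- n)).
  by rewrite -!expfzDr //; congr (_ ^ _); lia.
have -> : y ^ (n - 1) = y ^ n * y^-1 by rewrite expfzDr.
have -> : q ^ (N%:Z + 1 - n) = q ^+ N * p * (p ^ (1 - n) * p ^ (- n)).
  rewrite -[N%:Z + 1 - n]addrA expfzDr // -mulrA; congr (_ * _).
  rewrite /q -[p ^+ 2]/(p ^ 2%:Z) exprz_exp -expfzDr // -[p in RHS]expr1z -expfzDr //.
  by congr (_ ^ _); lia.
by move: (p ^ _) (p ^ _) (p ^ _) (y ^ n) (q ^+ N) => *; field.
Qed.

Let tterm_succ N n : p / y * q ^+ N * tterm p y (n + 1) = q ^ (N%:Z + 1 + n) * tterm p y n.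
Proof.
rewrite /tterm.
have -> : p ^ ((n + 1) * (n + 1)) = p ^ (n * n) * (p ^ (1 + n) * p ^ n).
  by rewrite -!expfzDr //; congr (_ ^ _); lia.
have -> : y ^ (n + 1) = y ^ n * y by rewrite expfzDr.
have -> : q ^ (N%:Z + 1 + n) = q ^+ N * p * (p ^ (1 + n) * p ^ n).
  rewrite -[N%:Z + 1 + n]addrA expfzDr // -mulrA; congr (_ * _).
  rewrite /q -[p ^+ 2]/(p ^ 2%:Z) exprz_exp -expfzDr // -[p in RHS]expr1z -expfzDr //.
  by congr (_ ^ _); lia.
by move: (p ^ _) (p ^ _) (p ^ _) (y ^ n) (q ^+ N) => *; field.
Qed.

(** The finite form of the triple product, an instance of the q-binomial theorem centred so that
    both products have [N] factors. *)
Let finite_product N : pw N (y * p) q * pw N (p / y) q = lsum (F N).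
Proof.
elim: N => [|N IH].
  rewrite /pw !big_ord0 mulr1 (@lsum1 _ 0) => [|n n0].
    rewrite /F /c /tterm -[D (0%N%:Z + 0)]/((qp 0)^-1).
    by rewrite /qp /pw big_ord0 invr1 !mulr1.
  by rewrite /F c_supp ?mul0r // zballP; lia.
rewrite /pw !big_ord_recr /= -!/(pw _ _ _) mulrACA IH.
have -> : (1 + y * p * q ^+ N) * (1 + p / y * q ^+ N) =
   (1 + q ^+ N.*2.+1) + y * p * q ^+ N + p / y * q ^+ N.
  have -> : q ^+ N.*2.+1 = p ^+ 2 * q ^+ N * q ^+ N by rewrite exprS -addnn exprD mulrA.
  by field.
rewrite mulrDr mulrDr ![lsum _ * _]mulrC !lsumZ //.
rewrite -(lsum_shift (- 1) (fun n => y * p * q ^+ N * F N n)).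
rewrite -(lsum_shift 1 (fun n => p / y * q ^+ N * F N n)).
have fs (a : C) j : fsupp (fun n => a * F N (n + j)).
  have [A hA] := F_supp N; exists [fset n - j | n in A]%fset => n hn.
  rewrite hA ?mulr0 //; apply: contra hn => h; apply/imfsetP; exists (n + j) => //.
  by rewrite addrK.
have fs0 (a : C) : fsupp (fun n => a * F N n).
  by have [A hA] := F_supp N; exists A => n /hA ->; rewrite mulr0.
rewrite -lsumD //; rewrite -lsumD //; last exact: fsuppD.
apply: eq_lsum => n; rewrite /F c_rec.
have e1 := tterm_pred N n; have e2 := tterm_succ N n.
rewrite [y * p * q ^+ N * _]mulrCA e1 [p / y * q ^+ N * _]mulrCA e2.
by ring.
Qed.

Definition thetaT : C := Pinf (- q) q * (Pinf (y * p) q * Pinf (p / y) q).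

(** The coefficients of [finite_product] are uniformly bounded and tend to the inverse of
    [Pinf (- q) q] for each [n], so that [dominated_limit] applies. *)
Lemma jacobi_triple : bdd (tterm p y) /\ has_sumR (tterm p y) thetaT.
Proof.
have [K hK] := tterm_geo p0 y0 p1.
have h2 : ((0 : R) <= 2^-1) && (2^-1 < (1 : R)) by apply/andP; split; lra.
have [bt [s hs]] := @int_geo_sum (tterm p y) K 2^-1 h2 hK; split=> //.
have nq1 : nm (- q) < 1 by rewrite nmN.
have ph0 : Pinf (- q) q != 0 by apply: Pinf_neq0.
have lqp : lim_to qp (Pinf (- q) q) by apply: Pinf_lim.
have lD n : lim_to (fun N => D (N%:Z + n)) (Pinf (- q) q)^-1.
  move=> e e0; have [N0 hN] := lim_toV ph0 lqp e0; exists (N0 + `|n|)%N => N hN'.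
  have -> : N%:Z + n = (absz (N%:Z + n))%:Z by lia.
  by apply: hN; lia.
have lc n : lim_to (c^~ n) (Pinf (- q) q)^-1.
  have hd N : (N <= N.*2)%N by lia.
  have := lim_toM (lim_to_sub hd lqp) (lim_toM (lD n) (lD (- n))).
  by rewrite mulrA mulfV // mul1r.
pose E1 := expR (nm q / (1 - nm q)); pose E2 := expR (nm q / ((1 - nm q) * (1 - nm q))).
have hqp N : nm (qp N) <= E1 by have := nm_pw N (- q) q1; rewrite nmN.
have hD k : nm (D k) <= E2.
  case: k => j; last by rewrite -[D _]/(0 : C) nm0 expR_ge0.
  rewrite -[D _]/((qp j)^-1).
  have := nm_pw_inv j nq1 q1; rewrite !nmN -/(qp j) -/E2 nmV => h.
  by rewrite -[leLHS]mul1r ler_pdivrMr ?nm_gt0 // mulrC.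
have hc N n : nm (c N n) <= E1 * (E2 * E2).
  by rewrite !nmM; do 2![apply: ler_pM; rewrite ?mulr_ge0 ?nm_ge0 //].
have hS N : has_sumR (fun n => c N n * tterm p y n) (pw N (y * p) q * pw N (p / y) q).
  rewrite finite_product => e e0; have [A hA] := F_supp N; exists A => B AB.
  rewrite (lsumE hA) (sum_subset _ AB) -[X in X - _]/(\sum_(i <- A) F N i + _) addrC addKr.
  rewrite big_seq big1 ?nm0 ?ltW // => n; rewrite in_fsetD => /andP[/hA].
  by [].
have h1 := dominated_limit bt hs hc lc hS.
have h3 := lim_toM (Pinf_lim (y * p) q1) (Pinf_lim (p / y) q1).
suff -> : thetaT = s by [].
by rewrite /thetaT (lim_to_unique h3 h1) mulrA mulfV // mul1r.
Qed.

End Product.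
End JacobiTripleProduct.

(** * Quadratic theta identities and the Fock space quotients *)

Section ThetaIdentities.
Variable R : realType.
Notation C := R[i].

Lemma thetaT_inv (p y : C) : thetaT p y^-1 = thetaT p y.
Proof.
rewrite /thetaT invrK [y^-1 * p]mulrC [p * y]mulrC; congr (_ * _); exact: mulrC.
Qed.

Lemma thetaT_shift (p y : C) : p != 0 -> nm p < 1 -> y != 0 -> thetaT p (y * p ^+ 2) = (y * p)^-1 * thetaT p y.
Proof.
move=> p0 p1 y0; have y2 : y * p ^+ 2 != 0 by rewrite mulf_neq0 // expf_neq0.
have [_ h1] := jacobi_triple p0 y2 p1; have [b2 h2] := jacobi_triple p0 y0 p1.
have e (n : int) : tterm p (y * p ^+ 2) (n - 1) = (y * p)^-1 * tterm p y n.
  rewrite /tterm -[p ^+ 2]/(p ^ 2) expfzMl exprz_exp.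
  have -> : p ^ ((n - 1) * (n - 1)) = p ^ (n * n) * p ^ (- (2 * (n - 1))) * p ^ (- 1).
    by rewrite -!expfzDr //; congr (_ ^ _); lia.
  rewrite -invr_expz expfzDr // -[p ^ (-1)]/(p^-1) -[y ^ (-1)]/(y^-1).
  have : p ^ (2 * (n - 1)) != 0 by rewrite expfz_neq0.
  by move: (p ^ _) (p ^ _) (y ^ n) => A B Y A0; field; rewrite ?A0 ?y0 ?p0.
apply: has_sumR_unique h1 _.
apply: (has_sumR_inj (io := fun n : int => n - 1)) => [m n /addIr //|n hn||].
- by case: (hn (n + 1)); rewrite addrK.
- by rewrite (funext e); apply: bddZ.
- by rewrite (funext e); apply: has_sumRZ.
Qed.

Lemma int_parity (n : int) : exists r : int, n = 2 * r \/ n = 2 * r + 1.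
Proof.
exists (n %/ 2)%Z; have := divz_eq n 2; have := modz_ge0 n (isT : 2 != 0 :> int).
have := ltz_pmod n (isT : 0 < 2 :> int).
by move: (n %/ 2)%Z (n %% 2)%Z => u w; lia.
Qed.

Variable p : C.
Hypotheses (p0 : p != 0) (p1 : nm p < 1).
Let q := p ^+ 2.

Let q0 : q != 0.
Proof. by rewrite expf_neq0. Qed.

Let q1 : nm q < 1.
Proof. exact: nm_sqr_lt1. Qed.

Let sgz2 (k : int) : (-1 : C) ^ (2 * k) = 1.
Proof. by rewrite -exprz_exp -[(-1) ^ 2]/((-1) ^+ 2) sqrrN expr1n exp1rz. Qed.

Let ttermN (y : C) (n : int) : tterm p (- y) n = (-1) ^ n * tterm p y n.
Proof. by rewrite /tterm -[- y]mulN1r expfzMl mulrCA. Qed.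

(* The left side is the sum over the sublattice of [m + n = e mod 2] of Z^2,
   which is parametrised by [m = r + s + e], [n = r - s]. *)
Lemma theta_pair (e : bool) (a b u v k : C) : a != 0 -> b != 0 -> u != 0 -> v != 0 ->
  (forall r s : int, tterm p a (r + s + e%:Z) * tterm p b (r - s) =
                     k * (tterm q u r * tterm q v s)) ->
  thetaT p a * thetaT p b + (-1) ^+ e * (thetaT p (- a) * thetaT p (- b)) =
  2 * k * (thetaT q u * thetaT q v).
Proof.
move=> a0 b0 u0 v0 huv.
have [ba ha] := jacobi_triple p0 a0 p1; have [bb hb] := jacobi_triple p0 b0 p1.
have a0' : - a != 0 by rewrite oppr_eq0.
have b0' : - b != 0 by rewrite oppr_eq0.
have [ba' ha'] := jacobi_triple p0 a0' p1; have [bb' hb'] := jacobi_triple p0 b0' p1.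
have [bu hu] := jacobi_triple q0 u0 q1; have [bv hv] := jacobi_triple q0 v0 q1.
have [b1 h1] := has_sumR_prod ba bb ha hb; have [b2 h2] := has_sumR_prod ba' bb' ha' hb'.
have [b3 h3] := has_sumR_prod bu bv hu hv.
have h4 := has_sumR_lin ((-1) ^+ e) h2 h1; rewrite addrC.
have m1e : (-1 : C) ^+ e = (-1) ^ e%:Z by [].
pose F (k : int * int) := (-1) ^+ e * (tterm p (- a) k.1 * tterm p (- b) k.2)
  + tterm p a k.1 * tterm p b k.2.
have FE (j : int * int) : F j = (1 + (-1) ^ (e%:Z + j.1 + j.2)) * (tterm p a j.1 * tterm p b j.2).
  rewrite /F !ttermN m1e !expfzDr ?oppr_eq0 ?oner_eq0 //.
  by move: (tterm _ _ _) (tterm _ _ _) (_ ^ _) (_ ^ _) (_ ^ _) => *; ring.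
pose io (j : int * int) : int * int := (j.1 + j.2 + e%:Z, j.1 - j.2).
have ee (j : int * int) : F (io j) = 2 * k * (tterm q u j.1 * tterm q v j.2).
  have e5 : e%:Z + (j.1 + j.2 + e%:Z) + (j.1 - j.2) = 2 * (j.1 + e%:Z).
    by move: (e%:Z) j.1 j.2; clear => *; lia.
  rewrite FE /io huv e5 sgz2.
  by move: (_ * tterm q v _) => X; ring.
apply: has_sumR_unique h4 _.
apply: (has_sumR_inj (F := F) (io := io)) => [[m n] [m' n']|[m n] hn||].
- rewrite /io /= => -[]; clear; move: (e%:Z) => d h5 h6; congr (_, _); lia.
- rewrite FE /=.
  have [r [hr|hr]] := int_parity (e%:Z + m + n).
  + case: (hn (r - e%:Z, r - e%:Z - n)); rewrite /io /=; move: hr; clear.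
    by move: (e%:Z) => d hr; congr (_, _); lia.
  + by rewrite hr expfzDr ?oppr_eq0 ?oner_eq0 // sgz2 mul1r expr1z subrr mul0r.
- by rewrite (funext ee); apply: bddZ.
- by rewrite (funext ee); apply: has_sumRZ.
Qed.

Let qE (n : int) : q ^ n = p ^ (2 * n).
Proof. by rewrite /q -[p ^+ 2]/(p ^ 2) exprz_exp. Qed.

Lemma theta_even (a b : C) : a != 0 -> b != 0 ->
  thetaT p a * thetaT p b + thetaT p (- a) * thetaT p (- b) =
  2 * (thetaT q (a * b) * thetaT q (a / b)).
Proof.
move=> a0 b0; have := @theta_pair false a b (a * b) (a / b) 1 a0 b0.
rewrite expr0 mul1r mulr1; apply; rewrite ?mulf_neq0 ?invr_neq0 // => r s.
rewrite mul1r /tterm !qE addr0 !expfzMl.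
have e1 : p ^ ((r + s) * (r + s)) * p ^ ((r - s) * (r - s)) = p ^ (2 * (r * r)) * p ^ (2 * (s * s)).
  by rewrite -!expfzDr //; congr (_ ^ _); lia.
rewrite mulrACA e1 !expfzDr // exprz_inv.
by move: (p ^ _) (p ^ _) (a ^ _) (a ^ _) (b ^ _) (b ^ _) => *; ring.
Qed.

Lemma theta_odd (a b : C) : a != 0 -> b != 0 ->
  thetaT p a * thetaT p b - thetaT p (- a) * thetaT p (- b) =
  2 * (p * a) * (thetaT q (a * b * q) * thetaT q (a / b * q)).
Proof.
move=> a0 b0; have := @theta_pair true a b (a * b * q) (a / b * q) (p * a) a0 b0.
rewrite expr1 mulN1r; apply; rewrite ?mulf_neq0 ?invr_neq0 // => r s.
rewrite /tterm (expfzMl (a * b)) (expfzMl (a / b)) (expfzMl a b) (expfzMl a) !qE.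
have e1 : p ^ ((r + s + true%:Z) * (r + s + true%:Z)) * p ^ ((r - s) * (r - s)) =
   p * (p ^ (2 * (r * r)) * p ^ (2 * r) * (p ^ (2 * (s * s)) * p ^ (2 * s))).
  by rewrite -[p in RHS]expr1z -!expfzDr //; congr (_ ^ _); lia.
rewrite mulrACA e1 !expfzDr // exprz_inv -[a ^ true%:Z]/a.
by move: (p ^ _) (p ^ _) (p ^ _) (p ^ _) (a ^ _) (a ^ _) (b ^ _) (b ^ _) => *; ring.
Qed.

Definition phi1 : C := Pinf (- q) q.
Definition phi2 : C := Pinf (- q ^+ 2) (q ^+ 2).

(** Splitting each of the two products in [T(p, x)] into even and odd factors gives the four
    products of the two theta functions of nome [q]. *)
Lemma theta_product (x : C) : x != 0 ->
  thetaT p x * phi2 ^+ 2 = phi1 * (thetaT q (p * x) * thetaT q (x / p)).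
Proof.
move=> x0; rewrite /thetaT -/q -/phi1 -/phi2.
rewrite (Pinf_split (x * p) q1) (Pinf_split (p / x) q1).
have -> : x / p * q = x * p by rewrite /q; field.
have -> : q / (p * x) = p / x by rewrite /q; field; rewrite x0.
have -> : q / (x / p) = p / x * q by field; rewrite p0 x0.
have -> : p * x * q = x * p * q by ring.
by move: phi1 phi2 (Pinf _ _) (Pinf _ _) (Pinf _ _) (Pinf _ _) => *; ring.
Qed.

Variable x : C.
Hypotheses (x1 : 1 < nm x) (xp1 : nm x * nm p < 1).

Let x0 : x != 0.
Proof. by apply/eqP => x0; move: x1; rewrite x0 nm0; lra. Qed.

Let np0 : 0 < nm p.
Proof. exact: nm_gt0. Qed.

Let nq : nm q = nm p * nm p.
Proof. by rewrite /q expr2 nmM. Qed.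

Lemma phi1_neq0 : phi1 != 0.
Proof. by apply: Pinf_neq0; rewrite ?nmN. Qed.

Lemma phi2_neq0 : phi2 != 0.
Proof. by apply: Pinf_neq0; rewrite ?nmN nm_sqr_lt1. Qed.

Lemma nm_xi : nm x^-1 < 1.
Proof. by rewrite nmV invf_lt1 //; apply: lt_trans x1. Qed.

Lemma nm_xq : nm (x * q) < 1.
Proof.
rewrite nmM nq mulrA; apply: le_lt_trans p1; apply: ler_piMl; exact: ltW.
Qed.

(** The generating function of all states: the two fermions give the square in the numerator, [b^+]
    and [b^-] the two denominators. The first factor of the last product, [1 - t / x], belongs to
    the zero mode [b^-_0]. *)
Definition fock_quot (s t : C) : C :=
  Pinf (s * t * p) q ^+ 2 / (Pinf (- (t * x * q)) q * Pinf (- (t * x^-1)) q).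

Lemma thetaT_denom_neq0 : thetaT q (- (x ^+ 2 * q)) != 0.
Proof.
rewrite /thetaT !mulf_neq0 //; first exact: phi2_neq0.
  apply: Pinf_neq0; last exact: nm_sqr_lt1.
  rewrite (_ : _ * q = - (x * q) ^+ 2); last by ring.
  by rewrite nmN nm_sqr_lt1 // nm_xq.
apply: Pinf_neq0; last exact: nm_sqr_lt1.
rewrite (_ : q / _ = - (x^-1) ^+ 2); last by field; rewrite q0 x0.
by rewrite nmN nm_sqr_lt1 // nm_xi.
Qed.

(** Extending the fraction by the two products with [t] in place of [- t] makes the denominator
    depend on [t ^+ 2] only. The average over [t] then concerns just a product of two theta
    functions. *)
Lemma fock_quotE (s t : C) : s ^+ 2 = 1 -> t ^+ 2 = 1 ->
  fock_quot s t = phi2 / (phi1 ^+ 2 * thetaT q (- (x ^+ 2 * q))) *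
    (thetaT p (s * t) * thetaT p (t * (x * p))).
Proof.
move=> s2 t2.
have h0 (u : C) : u ^+ 2 = 1 -> u != 0 by move=> h; apply/eqP => u0; move: h; rewrite u0 expr0n => /eqP; rewrite eq_sym oner_eq0.
have s0 := h0 _ s2; have t0 := h0 _ t2.
have hV (u : C) : u ^+ 2 = 1 -> u^-1 = u.
  by move=> h; apply: (mulfI (h0 _ h)); rewrite mulfV ?h0 // -expr2.
have nt : nm t = 1.
  have := congr1 (@nm R) t2; rewrite nmX nm1 => h; have := nm_ge0 t; nra.
have d1 : Pinf (- (t * x * q)) q != 0.
  by apply: Pinf_neq0 => //; rewrite nmN -mulrA nmM nt mul1r nm_xq.
have d2 : Pinf (- (t * x^-1)) q != 0.
  by apply: Pinf_neq0 => //; rewrite nmN nmM nt mul1r nm_xi.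
have eT : thetaT q (- (x ^+ 2 * q)) = phi2 *
    (Pinf (- (t * x * q)) q * Pinf (t * x * q) q * (Pinf (- (t * x^-1)) q * Pinf (t * x^-1) q)).
  rewrite (Pinf_opp (t * x * q) q1) (Pinf_opp (t * x^-1) q1).
  have -> : - (t * x * q) ^+ 2 = - (x ^+ 2 * q) * q.
    by transitivity (- (t ^+ 2 * x ^+ 2 * q ^+ 2)); [ring | rewrite t2; ring].
  have -> : - (t * x^-1) ^+ 2 = q / - (x ^+ 2 * q).
    by transitivity (- (t ^+ 2 / x ^+ 2)); [field | rewrite t2; field; rewrite q0 x0].
  by [].
have := thetaT_denom_neq0; rewrite eT /fock_quot /thetaT -/q -/phi1.
have -> : p / (s * t) = s * t * p by rewrite mulrC hV // exprMn s2 t2 mulr1.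
have -> : t * (x * p) * p = t * x * q by rewrite /q; ring.
have -> : p / (t * (x * p)) = t * x^-1.
  by rewrite invfM (hV t) //; field; rewrite p0 x0.
move: phi1_neq0 phi2_neq0 d1 d2; move: phi1 phi2 (Pinf _ _) (Pinf _ _) (Pinf _ _) (Pinf _ _) (Pinf _ _).
move=> f1 f2 A B D E G f10 f20 D0 E0.
rewrite !mulf_eq0 !negb_or => /andP[_ /andP[/andP[_ B0] /andP[_ G0]]].
by field; rewrite f10 f20 D0 E0 B0 G0.
Qed.

(** In [theta_even] with [a = s] and [b = x p] the two arguments on the right are inverse to each
    other, whence the square. *)
Lemma fock_quot_even (s : C) : s ^+ 2 = 1 ->
  (fock_quot s 1 + fock_quot s (-1)) / 2 =
  phi2 / phi1 ^+ 2 * (thetaT q (s * x * p) ^+ 2 / thetaT q (- (x ^+ 2 * q))).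
Proof.
move=> s2; rewrite !fock_quotE ?sqrrN ?expr1n // mulr1 mul1r mulrN1 mulN1r -mulrDr.
have s0 : s != 0 by apply/eqP => u0; move: s2; rewrite u0 expr0n => /eqP; rewrite eq_sym oner_eq0.
rewrite theta_even ?mulf_neq0 //.
have -> : thetaT q (s / (x * p)) = thetaT q (s * x * p).
  rewrite -(thetaT_inv q (s * x * p)).
  suff -> : s / (x * p) = (s * x * p)^-1 by [].
  apply: (mulIf s0); transitivity (s ^+ 2 / (x * p)); first by rewrite expr2; ring.
  by rewrite s2; field; rewrite s0 p0 x0.
have -> : s * (x * p) = s * x * p by ring.
move: (thetaT _ _) (thetaT _ _) thetaT_denom_neq0 phi1_neq0 => *; field.
by apply/andP.
Qed.

(** The square again comes from inverse arguments, after one of them is shifted by [q ^+ 2]. *)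
Lemma fock_quot_odd (s : C) : s ^+ 2 = 1 ->
  (fock_quot s 1 - fock_quot s (-1)) / 2 =
  x^-1 * (phi2 / phi1 ^+ 2 * (thetaT q (s * x / p) ^+ 2 / thetaT q (- (x ^+ 2 * q)))).
Proof.
move=> s2; rewrite !fock_quotE ?sqrrN ?expr1n // mulr1 mul1r mulrN1 mulN1r -mulrBr.
have s0 : s != 0 by apply/eqP => u0; move: s2; rewrite u0 expr0n => /eqP; rewrite eq_sym oner_eq0.
rewrite theta_odd ?mulf_neq0 //.
have -> : thetaT q (s / (x * p) * q) = thetaT q (s * x / p).
  rewrite -(thetaT_inv q (s * x / p)).
  suff -> : s / (x * p) * q = (s * x / p)^-1 by [].
  apply: (mulIf s0); transitivity (s ^+ 2 / (x * p) * q); first by rewrite expr2; ring.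
  by rewrite s2 /q; field; rewrite s0 p0 x0.
have -> : s * (x * p) * q = s * x / p * q ^+ 2 by rewrite /q; field.
rewrite (thetaT_shift q0 q1) ?mulf_neq0 ?invr_neq0 //.
have -> : (s * x / p * q)^-1 = s / (x * p).
  apply: (mulIf s0); transitivity (s ^+ 2 / (x * p)); last by rewrite expr2; ring.
  by rewrite s2 /q; field; rewrite s0 p0 x0.
have -> : 2 * (p * s) * (s / (x * p) * thetaT q (s * x / p) * thetaT q (s * x / p)) =
   2 * x^-1 * thetaT q (s * x / p) ^+ 2.
  transitivity (2 * x^-1 * (s ^+ 2 * thetaT q (s * x / p) ^+ 2)); last by rewrite s2 mul1r.
  by move: (thetaT _ _) => *; field; rewrite p0 x0.

move: (thetaT _ _) (thetaT _ _) phi2 thetaT_denom_neq0 phi1_neq0 => A B f A0 F0; field.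
by rewrite A0 F0 x0.
Qed.

End ThetaIdentities.

(** * The sum over states *)

Section FockSum.
Variable R : realType.
Notation C := R[i].

Section FiniteSums.
Variable g : grade -> C.
Hypotheses (g0 : g 0 = 1) (gD : {morph g : d e / d + e >-> d * e}).

Let gX d k : g (d *+ k) = g d ^+ k.
Proof. by elim: k => [|k IH]; rewrite ?mulr0n ?g0 // mulrS gD IH exprS. Qed.

Lemma sum_msets N S : \sum_(M <- msets N S) g (deg (M, fset0)) =
  \prod_(i <- S) \sum_(k < N) g (bdeg i) ^+ k.
Proof.
elim: S => [|i S IH] /=; first by rewrite big_seq1 big_nil -[(mset0, fset0)]/occ0 deg0 g0.
rewrite big_allpairs_dep big_cons -IH mulr_suml -(big_mkord predT (fun k => g (bdeg i) ^+ k * _)).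
rewrite /index_iota subn0; apply: eq_bigr => k _; rewrite mulr_sumr; apply: eq_bigr => M _.
suff -> : deg (iter k (madd i) M, fset0) = bdeg i *+ k + deg (M, fset0) by rewrite gD gX.
by elim: k => [|k IHk] /=; rewrite ?mulr0n ?add0r // deg_madd IHk mulrS addrA.
Qed.

Lemma sum_fsets S : uniq S -> \sum_(A <- fsets S) g (deg (mset0, A)) =
  \prod_(i <- S) (1 + g (fdeg i)).
Proof.
elim: S => [|i S IH] /=; first by rewrite big_seq1 big_nil -[(mset0, fset0)]/occ0 deg0 g0.
case/andP=> iS uS; rewrite big_cat big_map big_cons -IH // mulrDl mul1r; congr (_ + _).
rewrite mulr_sumr !big_seq; apply: eq_bigr => A; rewrite mem_fsets // => /allP hA.
have iA : i \notin A by apply: contra iS => /hA.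
by rewrite deg_flip (negPf iA) addrC gD.
Qed.

Lemma sum_occs N : \sum_(b <- occs N) g (deg b) =
  (\prod_(i <- slots N) \sum_(k < N) g (bdeg i) ^+ k) * \prod_(i <- slots N) (1 + g (fdeg i)).
Proof.
rewrite -sum_msets -sum_fsets ?slots_uniq // /occs big_allpairs_dep mulr_suml.
apply: eq_bigr => M _; rewrite mulr_sumr; apply: eq_bigr => A _; rewrite -gD; congr g.
by rewrite /deg /= big_mset0 big_seq_fset0 addr0 add0r.
Qed.

Lemma prod_slots N (F : slot -> C) :
  \prod_(i <- slots N) F i = \prod_(n < N) F (true, n : nat) * \prod_(n < N) F (false, n : nat).
Proof.
rewrite /slots big_allpairs_dep big_cons big_seq1 -!(big_mkord predT (fun n => F (_, n))).
by rewrite /index_iota subn0.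
Qed.

End FiniteSums.

Lemma geo_sum (y : C) N : y != 1 -> \sum_(k < N) y ^+ k = (1 - y ^+ N) / (1 - y).
Proof.
move=> y1; have h : 1 - y != 0 by rewrite subr_eq0 eq_sym.
by apply: (mulIf h); rewrite divfK // -[RHS]opprB subrX1 -mulNr opprB mulrC.
Qed.

(** These are the numerators of the geometric sums truncated at [N] in a box of states; they
    disappear in the limit. *)
Lemma lim_to_prod_pow (y r : C) : nm y < 1 -> nm r < 1 ->
  lim_to (fun N => \prod_(n < N) (1 - (y * r ^+ n) ^+ N)) 1.
Proof.
move=> y1 r1 e e0; have hy := nm_ge0 y; have hr := nm_ge0 r.
have r2 : 0 < 1 - nm r by lra.
have l0 : 0 < ln (1 + e) by apply: ln_gt0; lra.
have d0 : 0 < ln (1 + e) * (1 - nm r) by rewrite mulr_gt0.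
have hy' : 0 <= nm y < 1 by rewrite hy.
have [k hk] := small_power hy' d0; exists k.+1 => -[//|N] hN.
have := nm_prod_dev (fun n => - (y * r ^+ n) ^+ N.+1) N.+1; move/le_trans; apply.
suff : \sum_(n < N.+1) nm (- (y * r ^+ n) ^+ N.+1) <= ln (1 + e).
  have eln : expR (ln (1 + e)) = 1 + e by apply: lnK; rewrite posrE; lra.
  move=> h; have h2 : expR (\sum_(n < N.+1) nm (- (y * r ^+ n) ^+ N.+1)) <= expR (ln (1 + e)).
    by rewrite ler_expR.
  by rewrite eln in h2; lra.
apply: (@le_trans _ _ (\sum_(n < N.+1) nm y ^+ k * nm r ^+ n)).
  apply: ler_sum => n _; rewrite nmN nmX nmM exprMn nmX; apply: ler_pM; rewrite ?exprn_ge0 //.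
    by apply: ler_wiXn2l => //; [exact: ltW | lia].
  rewrite -exprM; apply: ler_wiXn2l => //; first exact: ltW.
  by rewrite mulnS leq_addr.
rewrite -mulr_sumr; have h1 : \sum_(n < N.+1) nm r ^+ n <= (1 - nm r)^-1.
  by apply: sum_geo; rewrite hr.
apply: le_trans (ler_wpM2l (exprn_ge0 _ hy) h1) _.
by rewrite ler_pdivrMr.
Qed.

(* With s^2 = t^2 = 1, the sign s sees the fermion number and t the sector, so
   that averaging over t = 1, -1 projects to one sector. *)
Definition gval (s t p x : C) (d : grade) : C :=
  s ^ d.2 * t ^ (d.1.2 + d.2) * p ^ d.1.1 * x ^ d.1.2.

Lemma gval0 s t p x : gval s t p x 0 = 1.
Proof. by rewrite /gval /= !expr0z !mulr1. Qed.

Lemma gvalD s t p x : s != 0 -> t != 0 -> p != 0 -> x != 0 ->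
  {morph gval s t p x : d e / d + e >-> d * e}.
Proof.
move=> s0 t0 p0 x0 [[d1 d2] d3] [[e1 e2] e3]; rewrite /gval /= addrACA !expfzDr //.
by move: (s ^ _) (s ^ _) (t ^ _) (t ^ _) (t ^ _) (t ^ _) (p ^ _) (p ^ _) (x ^ _) (x ^ _) => *; ring.
Qed.

Section ProductFormula.
Variables p x : C.
Hypotheses (p0 : p != 0) (p1 : nm p < 1) (x1 : 1 < nm x) (xp1 : nm x * nm p < 1).
Let q := p ^+ 2.

Let x0 : x != 0.
Proof. by apply/eqP => x0; move: x1; rewrite x0 nm0; lra. Qed.

Let q1 : nm q < 1.
Proof. exact: nm_sqr_lt1. Qed.

Let nt1 (t : C) : t ^+ 2 = 1 -> nm t = 1.
Proof. by move=> /(congr1 (@nm R)); rewrite nmX nm1 => h; have := nm_ge0 t; nra. Qed.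

Let neq0 (u : C) : u ^+ 2 = 1 -> u != 0.
Proof.
by move=> h; apply/eqP => u0; move: h; rewrite u0 expr0n => /eqP; rewrite eq_sym oner_eq0.
Qed.

Let inv1 (u : C) : u ^+ 2 = 1 -> u^-1 = u.
Proof. by move=> h; apply: (mulfI (neq0 h)); rewrite mulfV ?neq0 // -expr2. Qed.

Lemma lim_occs (s t : C) : s ^+ 2 = 1 -> t ^+ 2 = 1 ->
  lim_to (fun N => \sum_(b <- occs N) gval s t p x (deg b)) (fock_quot p x s t).
Proof.
move=> s2 t2; have [s0 t0] := (neq0 s2, neq0 t2).
have g0 := gval0 s t p x; have gD := gvalD s0 t0 p0 x0.
have y1 : nm (t * x * q) < 1 by rewrite -mulrA nmM nt1 // mul1r; apply: nm_xq.
have y2 : nm (t * x^-1) < 1 by rewrite nmM nt1 // mul1r; apply: nm_xi x1.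
have ef b n : gval s t p x (fdeg (b, n)) = s * t * p * q ^+ n.
  rewrite /gval /fdeg /= -[p ^ _]/(p ^+ n.*2.+1) exprS -mul2n exprM -/q expr0z mulr1 add0r.
  case: b; first by rewrite !expr1z !mulrA.
  by rewrite -[s ^ -1]/(s^-1) -[t ^ -1]/(t^-1) !inv1 // !mulrA.
have ebt n : gval s t p x (bdeg (true, n)) = t * x * q * q ^+ n.
  rewrite /gval /bdeg /= addr0 expr0z mul1r !expr1z -[p ^ _]/(p ^+ (n + 1).*2) -mul2n exprM -/q addn1 exprS.
  by ring.
have ebf n : gval s t p x (bdeg (false, n)) = t * x^-1 * q ^+ n.
  rewrite /gval /bdeg /= addr0 expr0z mul1r -[t ^ -1]/(t^-1) inv1 // -[x ^ -1]/(x^-1).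
  by rewrite -[p ^ _]/(p ^+ (n + 0).*2) -mul2n exprM -/q addn0; ring.
have ne1 y n : nm y < 1 -> y * q ^+ n != 1.
  move=> hy; apply/eqP => /(congr1 (@nm R)); rewrite nm1 nmM nmX => e.
  have h : nm q ^+ n <= 1 by apply: exprn_ile1; [exact: nm_ge0 | exact: ltW].
  have := nm_ge0 y; have : 0 <= nm q ^+ n by rewrite exprn_ge0 // nm_ge0.
  by move: e hy h; move: (nm y) (nm q ^+ n) => a b; nra.
have geo y N : nm y < 1 -> \prod_(n < N) \sum_(k < N) (y * q ^+ n) ^+ k =
    \prod_(n < N) (1 - (y * q ^+ n) ^+ N) * (pw N (- y) q)^-1.
  move=> hy; rewrite /pw -prodfV -big_split; apply: eq_bigr => n _ /=.
  by rewrite geo_sum ?ne1 // mulNr.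
apply: (@lim_to_ext R (fun N => (\prod_(n < N) (1 - (t * x * q * q ^+ n) ^+ N) * (pw N (- (t * x * q)) q)^-1) *
  (\prod_(n < N) (1 - (t * x^-1 * q ^+ n) ^+ N) * (pw N (- (t * x^-1)) q)^-1) *
  (pw N (s * t * p) q * pw N (s * t * p) q))) => [N|].
  rewrite sum_occs // !prod_slots -!geo //; congr (_ * _ * _).
  - by apply: eq_bigr => n _; apply: eq_bigr => k _; rewrite ebt.
  - by apply: eq_bigr => n _; apply: eq_bigr => k _; rewrite ebf.
  by congr (_ * _); apply: eq_bigr => n _; rewrite ef.
have -> : fock_quot p x s t = 1 * (Pinf (- (t * x * q)) q)^-1 * (1 * (Pinf (- (t * x^-1)) q)^-1) *
    (Pinf (s * t * p) q * Pinf (s * t * p) q).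
  by rewrite /fock_quot -/q invfM !mul1r mulrC expr2.
do ![apply: lim_toM]; try exact: lim_to_prod_pow; try exact: Pinf_lim.
- by apply: lim_toV; [apply: Pinf_neq0; rewrite ?nmN | exact: Pinf_lim].
- by apply: lim_toV; [apply: Pinf_neq0; rewrite ?nmN | exact: Pinf_lim].
Qed.

End ProductFormula.

Lemma big_fset_seq (I : choiceType) (V : nmodType) (s : seq I) (F : I -> V) : uniq s ->
  \sum_(b <- [fset b in s]%fset) F b = \sum_(b <- s) F b.
Proof.
move=> us; apply: perm_big; apply: uniq_perm => //= b.
by rewrite in_fset.
Qed.

Lemma real_complexXz (a : R) (n : int) : (a ^ n)%:C%C = a%:C%C ^ n :> C.
Proof.
case: n => n; first by rewrite -[a ^ n]/(a ^+ n) rmorphXn.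
by rewrite -[a ^ Negz n]/((a ^+ n.+1)^-1) fmorphV rmorphXn.
Qed.

(** The absolute values of the terms form the same family with [s = t = 1] and [p], [x] replaced by
    their norms. The sums of that family over boxes converge, which gives absolute summability. *)
Lemma occs_sum (p x s t : C) : p != 0 -> nm p < 1 -> 1 < nm x -> nm x * nm p < 1 ->
  s ^+ 2 = 1 -> t ^+ 2 = 1 ->
  let f (b : occ) := gval s t p x (deg b) in bdd f /\ has_sumR f (fock_quot p x s t).
Proof.
move=> p0 p1 x1 xp1 s2 t2 f.
have nc (a : R) : 0 <= a -> nm a%:C%C = a by move=> a0; rewrite /nm /= expr0n addr0 sqrtr_sqr ger0_norm.
have nt1 (u : C) : u ^+ 2 = 1 -> nm u = 1.
  by move=> /(congr1 (@nm R)); rewrite nmX nm1 => h; have := nm_ge0 u; nra.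
have hp := nm_ge0 p; have hx := nm_ge0 x.
have P0 : (nm p)%:C%C != 0 :> C by rewrite -nm_eq0 nc // nm_eq0.
have lim1 : lim_to (fun N => \sum_(b <- occs N) gval 1 1 (nm p)%:C%C (nm x)%:C%C (deg b))
    (fock_quot (nm p)%:C%C (nm x)%:C%C 1 1).
  by apply: lim_occs; rewrite ?nc ?expr1n.
have fE b : (nm (f b))%:C%C = gval 1 1 (nm p)%:C%C (nm x)%:C%C (deg b).
  rewrite /f /gval !nmM !nm_exprz (nt1 _ s2) (nt1 _ t2) !exp1rz !mul1r.
  by rewrite rmorphM /= !real_complexXz.
have ex b : exists N0, forall N, (N0 <= N)%N -> b \in [fset b in occs N]%fset.
  by have [N0 h] := occs_exhaust b; exists N0 => N /h; rewrite in_fset.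
have bf : bdd f.
  have [N0 h0] := lim1 1 ltr01.
  (* The bound by the limit plus 1 is known only from [N0] on, so that the boxes are shifted by
     [N0]. *)
  apply: (@bdd_exhaust R occ f (fun N => [fset b in occs (N0 + N)]%fset)
    (nm (fock_quot (nm p)%:C%C (nm x)%:C%C 1 1) + 1)) => [b|N].
    by have [N1 h1] := ex b; exists N1 => N hN; apply: h1; lia.
  rewrite big_fset_seq ?occs_uniq //.
  have := h0 (N0 + N)%N (leq_addr _ _).
  rewrite -(eq_bigr _ (fun b _ => fE b)) -rmorph_sum /=.
  set S := \sum_(_ <- _) _; set L := fock_quot _ _ _ _ => h.
  have S0 : 0 <= S by apply: sumr_ge0 => b _; apply: nm_ge0.
  have := nmD (S%:C%C - L) L; rewrite subrK nc // => h'.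
  by lra.
split=> //; apply: (has_sumR_exhaust bf ex) => e e0.
have [N0 h0] := lim_occs p0 p1 x1 xp1 s2 t2 e0.
by exists N0 => N /h0; rewrite big_fset_seq ?occs_uniq.
Qed.

Definition sector_value (o : bool) (p x s : C) : C :=
  (fock_quot p x s 1 + (-1) ^+ o * fock_quot p x s (-1)) / 2.

Lemma sector_sum (o : bool) (p x s : C) : p != 0 -> nm p < 1 -> 1 < nm x -> nm x * nm p < 1 ->
  s ^+ 2 = 1 ->
  let f (b : occ) := (bodd b == o)%:R * (s ^+ fpodd b * (p ^ (deg b).1.1 * x ^ (deg b).1.2)) in
  bdd f /\ has_sumR f (sector_value o p x s).
Proof.
move=> p0 p1 x1 xp1 s2 f.
have o2 : (-1 : C) ^+ 2 = 1 by rewrite sqrrN expr1n.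
have [b1 h1] := occs_sum p0 p1 x1 xp1 s2 (expr1n _ 2).
have [b2 h2] := occs_sum p0 p1 x1 xp1 s2 o2.
have zodd (u : C) (n : int) : u ^+ 2 = 1 -> u ^ n = u ^+ odd `|n|.
  move=> u2; have u0 : u != 0.
    by apply/eqP => u0; move: u2; rewrite u0 expr0n => /eqP; rewrite eq_sym oner_eq0.
  have hX k : u ^+ k = u ^+ odd k.
    by rewrite -{1}(odd_double_half k) exprD -mul2n exprM u2 expr1n mulr1.
  case: n => n; first exact: hX.
  rewrite -[u ^ Negz n]/((u ^+ n.+1)^-1) hX /=.
  by case: (odd n) => /=; rewrite ?invr1 // !expr1; apply: (mulfI u0); rewrite mulfV // -expr2.
have fE b : f b = 2^-1 * ((-1) ^+ o * gval s (-1) p x (deg b) + gval s 1 p x (deg b)).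
  rewrite /f /gval exp1rz mulr1 (zodd s) // (zodd (-1)) // -/(fpodd b) -/(bodd b).
  move: (s ^+ _) (p ^ _) (x ^ _) => S P X.
  by case: (bodd b); case: (o); rewrite /= ?expr0 ?expr1; field.
split.
  have [M1 k1] := b1; have [M2 k2] := b2.
  exists (M2 + M1) => A; apply: le_trans (lerD (k2 A) (k1 A)); rewrite -big_split /=.
  apply: ler_sum => b _; rewrite fE nmM.
  have h2' : nm (2^-1 : C) <= 1.
    rewrite nmV invf_le1 ?nm_gt0 ?pnatr_eq0 //.
    by rewrite -rc_le -nmE normr_nat ler1n.
  apply: (@le_trans _ _ (nm ((-1) ^+ o * gval s (-1) p x (deg b) + gval s 1 p x (deg b)))).
    by apply: ler_piMl => //; exact: nm_ge0.
  apply: le_trans (nmD _ _) _; rewrite nmM nmX nmN nm1 expr1n mul1r.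
  exact: lexx.
have := has_sumRZ 2^-1 (has_sumR_lin ((-1) ^+ o) h2 h1).
rewrite (_ : (fun b => _) = f); last by apply/funext => b; rewrite fE.
by rewrite /sector_value addrC mulrC.
Qed.

End FockSum.

(** * Characters *)

Section Exponentials.
Variable R : realType.
Notation C := R[i].
Implicit Types (z w tau : C) (n : int).

Lemma cexpD z w : cexp (z + w) = cexp z * cexp w.
Proof.
case: z w => [a b] [c d]; rewrite /cexp /= expRD cosD sinD.
by apply/eqP; rewrite eq_complex /=; apply/andP; split; apply/eqP; ring.
Qed.

Lemma cexp0 : cexp (0 : C) = 1.
Proof. by rewrite /cexp /= expR0 cos0 sin0 mul1r. Qed.

Lemma cexp_neq0 z : cexp z != 0.
Proof.
apply/eqP => e; have := cexpD z (- z); rewrite subrr cexp0 e mul0r => /eqP.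
by rewrite oner_eq0.
Qed.

Lemma cexpN z : cexp (- z) = (cexp z)^-1.
Proof.
have h := cexp_neq0 z; apply: (mulfI h); rewrite mulfV // -cexpD subrr; exact: cexp0.
Qed.

Lemma e2piD z w : e2pi (z + w) = e2pi z * e2pi w.
Proof. by rewrite /e2pi mulrDr cexpD. Qed.

Lemma e2pi_neq0 z : e2pi z != 0.
Proof. exact: cexp_neq0. Qed.

Lemma e2piN z : e2pi (- z) = (e2pi z)^-1.
Proof. by rewrite /e2pi mulrN cexpN. Qed.

Lemma e2pi0 : e2pi (0 : C) = 1.
Proof. by rewrite /e2pi mulr0 cexp0. Qed.

Lemma e2pi_nat z (k : nat) : e2pi (z *+ k) = e2pi z ^+ k.
Proof. by elim: k => [|k IH]; rewrite ?e2pi0 // mulrS e2piD IH exprS. Qed.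

Lemma e2pi_int z n : e2pi (z *~ n) = e2pi z ^ n.
Proof.
case: n => n; first exact: e2pi_nat.
by rewrite NegzE mulrNz e2piN -[z *~ n.+1]/(z *+ n.+1) e2pi_nat.
Qed.

Lemma arg_lin (a b : R) : 2 * piC R * 'i%C * (a%:C%C + b%:C%C * 'i%C) =
  (- (2 * pi * b))%:C%C + (2 * pi * a)%:C%C * 'i%C.
Proof.
have i2 : 'i%C * 'i%C = - 1 :> C by rewrite -expr2 sqr_i.
rewrite rmorphN /= !rmorphM /= rmorph_nat /piC.
transitivity (2 * pi%:C%C * b%:C%C * ('i%C * 'i%C) + 2 * pi%:C%C * a%:C%C * 'i%C : C); first by ring.
by rewrite i2; ring.
Qed.

Lemma complexE_lin z : z = (complex.Re z)%:C%C + (complex.Im z)%:C%C * 'i%C.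
Proof. by rewrite {1}[z]complexE mulrC. Qed.

Lemma e2piE z : e2pi z = (expR (- (2 * pi * complex.Im z)))%:C%C *
  (cos (2 * pi * complex.Re z) +i* sin (2 * pi * complex.Re z))%C.
Proof.
rewrite /e2pi {1}(complexE_lin z) arg_lin /cexp /=.
by rewrite !(mul0r, mulr0, mulr1, subr0, addr0, add0r).
Qed.

Lemma nm_e2pi z : nm (e2pi z) = expR (- (2 * pi * complex.Im z)).
Proof.
rewrite e2piE nmM [X in _ * X]/nm /= cos2Dsin2 sqrtr1 mulr1 /nm /=.
by rewrite expr0n addr0 sqrtr_sqr ger0_norm // expR_ge0.
Qed.

Lemma e2pi_quarter : e2pi (1 / 4 : C) = 'i%C.
Proof.
have -> : 1 / 4 = (4^-1 : R)%:C%C :> C by rewrite fmorphV rmorph_nat mul1r.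
rewrite e2piE /= mulr0 oppr0 expR0 mul1r.
have -> : 2 * pi * 4^-1 = pi / 2 :> R by field.
by rewrite cos_pihalf sin_pihalf.
Qed.

Lemma e2pi_half : e2pi (1 / 2 : C) = -1.
Proof.
have -> : 1 / 2 = 1 / 4 + 1 / 4 :> C by field.
by rewrite e2piD e2pi_quarter -expr2 sqr_i.
Qed.

(** With [p] the square root of the nome, the domain is the annulus in which the geometric series of
    all bosonic modes converge. *)
Lemma ch_domainP tau z : ch_domain tau z ->
  let p := e2pi (tau / 2) in let x := e2pi z in
  [/\ p != 0, nm p < 1, 1 < nm x & nm x * nm p < 1].
Proof.
case=> t0 x1 hx p x; have p0 : p != 0 by apply: e2pi_neq0.
have np : 0 < nm p by apply: nm_gt0.
have eq2 : e2pi tau = p ^+ 2 by rewrite /p expr2 -e2piD; congr e2pi; field.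
have q1 : nm (e2pi tau) < 1.
  by rewrite nm_e2pi -expR0 ltr_expR oppr_lt0 !mulr_gt0 // pi_gt0.
have p1 : nm p < 1.
  by move: q1; rewrite eq2 nmX -[X in _ < X](expr1n R 2) ltr_pXn2r // nnegrE // ltW.
split=> //; move: hx; rewrite -/(nm (e2pi z)) -/x -/(nm (e2pi tau)) eq2 nmX.
rewrite -powR_mulrn ?ltW // -powRrM mulrN mulfV ?pnatr_eq0 // powR_inv1 ?ltW // => h.
by rewrite -ltr_pdivlMr // mul1r.
Qed.

Lemma has_sumRP (I : choiceType) (f : I -> C) (s : C) : has_sumR f s -> has_sum f s.
Proof.
move=> h; have FF := @totally_filter I; apply/cvgrPdist_le => e e0.
have er : e = (complex.Re e)%:C%C by apply/esym/complex.RRe_real/gtr0_real.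
have [|A hA] := h (complex.Re e); first by move: e0; rewrite er ltcR.
exists A => // B /= /hA; rewrite distrC er -rc_le; apply: le_trans.
rewrite /partial_sum big_seq_fsetE /=; exact: lexx.
Qed.

Lemma has_sumR_sum (I : choiceType) (f : I -> C) (s : C) : has_sumR f s ->
  sum (f : I -> C^o) = s.
Proof.
move=> /has_sumRP h; have FF := @totally_filter I.
exact: (cvg_lim (@norm_hausdorff _ C^o)).
Qed.

Lemma thetaE (a b : nat) tau z : nm (e2pi (tau / 2)) < 1 ->
  theta a b tau z = e2pi (a%:R ^+ 2 * tau / 8 + a%:R * (z + b%:R / 2) / 2) *
    thetaT (e2pi (tau / 2)) (e2pi (z + b%:R / 2 + a%:R * tau / 2)).
Proof.
move=> p1; have [_ h] := jacobi_triple (e2pi_neq0 (tau / 2)) (e2pi_neq0 (z + b%:R / 2 + a%:R * tau / 2)) p1.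
have := has_sumRZ (e2pi (a%:R ^+ 2 * tau / 8 + a%:R * (z + b%:R / 2) / 2)) h.
move=> h2; rewrite /theta; apply: has_sumR_sum.
rewrite (_ : (fun n : int => _) = fun n : int => e2pi (a%:R ^+ 2 * tau / 8 + a%:R * (z + b%:R / 2) / 2) *
     tterm (e2pi (tau / 2)) (e2pi (z + b%:R / 2 + a%:R * tau / 2)) n) //.
apply/funext => n; rewrite /tterm -!e2pi_int -!e2piD /e2pi; congr cexp.
rewrite -[(tau / 2) *~ _]mulrzl -[(z + _ + _) *~ _]mulrzl intrM.
by move: (n%:~R) (a%:R) (b%:R) => N A B; field.
Qed.

Lemma etaE tau : dedekind_eta tau = e2pi (tau / 24) * Pinf (- e2pi tau) (e2pi tau).
Proof.
rewrite /dedekind_eta /Pinf (_ : (fun N => \prod_(1 <= n < N.+1) _) = (fun N => pw N (- e2pi tau) (e2pi tau))) //.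
apply/funext => N; rewrite /pw big_add1 big_mkord; apply: eq_bigr => n _.
by rewrite mulNr exprS.
Qed.

End Exponentials.

(** * The algebra that joins the theta quotients to the sums over states *)

Section FieldIdentities.
Variable K : fieldType.
Variables k s d i u w x p F1 F2 A B D G : K.
Hypotheses (s2 : s ^+ 2 = 1) (hk : k * s = d * i) (d0 : d != 0) (i0 : i != 0).
Hypotheses (u0 : u != 0) (w0 : w != 0) (x0 : x != 0) (pE : p = u ^+ 4).
Hypotheses (F10 : F1 != 0) (F20 : F2 != 0) (G0 : G != 0).

(** [k] is the constant in front of the formula, [d] the constant factor of the first theta function
    in the denominator (1 or i), and [s] the sign of the supertrace. The relation [k s = d i]
    explains the constants i and 1 in the two formulas. *)
Lemma field_even : A * B / D = s * x * p * (F1 / F2 ^+ 2 * A ^+ 2) ->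
  k * (u * (F2 / F1) ^+ 3) * (A * B / (d * (u ^+ 2 * (w * u ^+ 2)) * D * (i * (u ^+ 2 * x) * G))) =
  u^-1 * w^-1 * (F2 / F1 ^+ 2 * (A ^+ 2 / G)).
Proof.
move=> h; have hs : k = d * i * s by rewrite -hk -mulrA -expr2 s2 mulr1.
transitivity (k * (u * (F2 / F1) ^+ 3) * (A * B / D) / (d * (u ^+ 2 * (w * u ^+ 2)) * (i * (u ^+ 2 * x) * G))).
  by rewrite !invfM; ring.
rewrite h hs pE; transitivity (s ^+ 2 * (d * i * (u * (F2 / F1) ^+ 3) * (x * u ^+ 4 * (F1 / F2 ^+ 2 * A ^+ 2)) /
    (d * (u ^+ 2 * (w * u ^+ 2)) * (i * (u ^+ 2 * x) * G)))); first by ring.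
by rewrite s2; field; rewrite F10 F20 G0 d0 i0 u0 w0 x0.
Qed.

Lemma field_odd : A * B / D = F1 / F2 ^+ 2 * A ^+ 2 ->
  d * i * (u * (F2 / F1) ^+ 3) * (A * B / (d * (u ^+ 2 * (w / u ^+ 2)) * D * (i * (u ^+ 2 * x) * G))) =
  u^-1 * w^-1 * (x^-1 * (F2 / F1 ^+ 2 * (A ^+ 2 / G))).
Proof.
move=> h; transitivity (d * i * (u * (F2 / F1) ^+ 3) * (A * B / D) / (d * (u ^+ 2 * (w / u ^+ 2)) * (i * (u ^+ 2 * x) * G))).
  by rewrite !invfM; ring.
by rewrite h; field; rewrite F10 F20 G0 d0 i0 u0 w0 x0.
Qed.

End FieldIdentities.

Lemma imag_neq0 (R : realType) : 'i%C != 0 :> R[i].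
Proof. by rewrite eq_complex /= oner_eq0 andbF. Qed.

Section CharacterAlgebra.
Variable R : realType.
Notation C := R[i].
Variables p q x u w : C.
Hypotheses (p0 : p != 0) (p1 : nm p < 1) (x1 : 1 < nm x) (xp1 : nm x * nm p < 1).
Hypotheses (qp : q = p ^+ 2) (u0 : u != 0) (w0 : w != 0) (pE : p = u ^+ 4) (xE : x = w ^+ 2).

Let x0 : x != 0.
Proof. by rewrite xE expf_neq0. Qed.

Let q0 : q != 0.
Proof. by rewrite qp expf_neq0. Qed.

Let q1 : nm q < 1.
Proof. by rewrite qp nm_sqr_lt1. Qed.

Let i2 : 'i%C ^+ 2 = -1 :> C.
Proof. exact: sqr_i. Qed.

Let o2 : (-1 : C) ^+ 2 = 1.
Proof. by rewrite sqrrN expr1n. Qed.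

Lemma thetaT_neq0 (y : C) : nm y = nm x -> thetaT q (y * p) != 0 /\ thetaT q (y / p) != 0.
Proof.
move=> hy; have np := nm_gt0 p0; have ph := phi2_neq0 p1.
have y0 : y != 0 by rewrite -nm_eq0 hy nm_eq0.
have q2' := nm_sqr_lt1 q1.
have h1 : nm (y * p * q) < 1.
  by rewrite !nmM hy -[X in _ < X](mulr1 1); apply: ltr_pM => //; rewrite ?mulr_ge0 ?nm_ge0.
have h2 : nm (q / (y * p)) < 1.
  rewrite (_ : q / (y * p) = p / y); last by rewrite qp; field; rewrite y0 p0.
  rewrite nmM nmV hy ltr_pdivrMr; last by apply: lt_trans x1.
  by rewrite mul1r; apply: lt_trans x1.
have h3 : nm (y / p * q) < 1.
  by rewrite (_ : y / p * q = y * p) ?nmM ?hy //; rewrite qp; field.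
have h4 : nm (q / (y / p)) < 1.
  rewrite (_ : q / (y / p) = p / y * q); last by field; rewrite y0 p0.
  rewrite nmM -[X in _ < X](mulr1 1); apply: ltr_pM; rewrite ?nm_ge0 //.
  rewrite nmM nmV hy ltr_pdivrMr; last by apply: lt_trans x1.
  by rewrite mul1r; apply: lt_trans x1.
have ph' : Pinf (- q ^+ 2) (q ^+ 2) != 0 by rewrite qp.
split.
  exact: (mulf_neq0 ph' (mulf_neq0 (Pinf_neq0 h1 q2') (Pinf_neq0 h2 q2'))).
exact: (mulf_neq0 ph' (mulf_neq0 (Pinf_neq0 h3 q2') (Pinf_neq0 h4 q2'))).
Qed.

(** The denominator is shifted back to [T(q, s x / p)], which is one of the two factors that
    [theta_product] finds in [T(p, s x)]. *)
Lemma quot_even (s : C) : s ^+ 2 = 1 ->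
  thetaT q (s * x * p) * thetaT p (s * x) / thetaT q (s * x * p * q) =
  s * x * p * (phi1 p / phi2 p ^+ 2 * thetaT q (s * x * p) ^+ 2).
Proof.
move=> s2; have s0 : s != 0.
  by apply/eqP => s0; move: s2; rewrite s0 expr0n => /eqP; rewrite eq_sym oner_eq0.
have ns : nm s = 1 by have := congr1 (@nm R) s2; rewrite nmX nm1 => h; have := nm_ge0 s; nra.
have sx0 : s * x != 0 by rewrite mulf_neq0.
have [h1 h2] : thetaT q (s * x * p) != 0 /\ thetaT q (s * x / p) != 0.
  by apply: thetaT_neq0; rewrite nmM ns mul1r.
have e1 : s * x * p * q = s * x / p * q ^+ 2 by rewrite qp; field.
rewrite e1 (thetaT_shift q0 q1) ?mulf_neq0 ?invr_neq0 //.
have f0 := phi2_neq0 p1; have := theta_product p0 p1 sx0; rewrite -qp.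
have -> : p * (s * x) = s * x * p by rewrite mulrC.
move=> h; have -> : thetaT p (s * x) = phi1 p * (thetaT q (s * x * p) * thetaT q (s * x / p)) / phi2 p ^+ 2.
  by rewrite -h mulfK // expf_neq0.
have -> : s * x / p * q = s * x * p by rewrite qp; field.
move: h2 f0; move: (thetaT q (s * x / p)) (thetaT q (s * x * p)) (phi1 p) (phi2 p) => A B f1 f2 A0 f0.
by field; rewrite A0 f0 p0 x0 s0.
Qed.

Lemma quot_odd (s : C) : s ^+ 2 = 1 ->
  thetaT q (s * x / p) * thetaT p (s * x) / thetaT q (s * x / p * q) =
  phi1 p / phi2 p ^+ 2 * thetaT q (s * x / p) ^+ 2.
Proof.
move=> s2; have s0 : s != 0.
  by apply/eqP => s0; move: s2; rewrite s0 expr0n => /eqP; rewrite eq_sym oner_eq0.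
have ns : nm s = 1 by have := congr1 (@nm R) s2; rewrite nmX nm1 => h; have := nm_ge0 s; nra.
have sx0 : s * x != 0 by rewrite mulf_neq0.
have [h1 h2] : thetaT q (s * x * p) != 0 /\ thetaT q (s * x / p) != 0.
  by apply: thetaT_neq0; rewrite nmM ns mul1r.
have -> : s * x / p * q = s * x * p by rewrite qp; field.
have f0 := phi2_neq0 p1; have := theta_product p0 p1 sx0; rewrite -qp.
have -> : p * (s * x) = s * x * p by rewrite mulrC.
move=> h; have -> : thetaT p (s * x) = phi1 p * (thetaT q (s * x * p) * thetaT q (s * x / p)) / phi2 p ^+ 2.
  by rewrite -h mulfK // expf_neq0.
move: h1 f0; move: (thetaT q (s * x / p)) (thetaT q (s * x * p)) (phi1 p) (phi2 p) => A B f1 f2 B0 f0.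
by field; rewrite B0 f0.
Qed.

Lemma character_algebra_even (k s t d : C) : s ^+ 2 = 1 -> t = s * x * p ->
  k * s = d * 'i%C -> d != 0 ->
  k * (u * (phi2 p / phi1 p) ^+ 3) * ((thetaT q t * thetaT p (s * x)) /
    (d * (u ^+ 2 * (w * u ^+ 2)) * thetaT q (t * q) * ('i%C * (u ^+ 2 * x) * thetaT q (- (x ^+ 2 * q))))) =
  u^-1 * w^-1 * (phi2 p / phi1 p ^+ 2 * (thetaT q t ^+ 2 / thetaT q (- (x ^+ 2 * q)))).
Proof.
move=> s2 -> hk d0; have h := quot_even s2.
have f1 := phi1_neq0 p1; have f2 := phi2_neq0 p1.
have g0 := thetaT_denom_neq0 p0 p1 x1 xp1; rewrite -qp in g0.
exact: (field_even s2 hk d0 (imag_neq0 R) u0 w0 x0 pE f1 f2 g0 h).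
Qed.

Lemma character_algebra_odd (k s t d : C) : s ^+ 2 = 1 -> t = s * x / p ->
  k = d * 'i%C -> d != 0 ->
  k * (u * (phi2 p / phi1 p) ^+ 3) * ((thetaT q t * thetaT p (s * x)) /
    (d * (u ^+ 2 * (w / u ^+ 2)) * thetaT q (t * q) * ('i%C * (u ^+ 2 * x) * thetaT q (- (x ^+ 2 * q))))) =
  u^-1 * w^-1 * (x^-1 * (phi2 p / phi1 p ^+ 2 * (thetaT q t ^+ 2 / thetaT q (- (x ^+ 2 * q))))).
Proof.
move=> s2 -> -> d0; have h := quot_odd s2.
have f1 := phi1_neq0 p1; have f2 := phi2_neq0 p1.
have g0 := thetaT_denom_neq0 p0 p1 x1 xp1; rewrite -qp in g0.
exact: (field_odd d0 (imag_neq0 R) u0 w0 x0 f1 f2 g0 h).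
Qed.

End CharacterAlgebra.

(** * Evaluation of the eta and theta quotients *)

Section CharacterFormulas.
Variable R : realType.
Notation C := R[i].
Variables tau z : C.
Hypothesis dom : ch_domain tau z.

Let p := e2pi (tau / 2).
Let x := e2pi z.
Let q := p ^+ 2.
Let u := e2pi (tau / 8).
Let w := e2pi (z / 2).

Let p0 : p != 0. Proof. by have [] := ch_domainP dom. Qed.
Let p1 : nm p < 1. Proof. by have [] := ch_domainP dom. Qed.
Let x1 : 1 < nm x. Proof. by have [] := ch_domainP dom. Qed.
Let xp1 : nm x * nm p < 1. Proof. by have [] := ch_domainP dom. Qed.
Let x0 : x != 0. Proof. exact: e2pi_neq0. Qed.
Let u0 : u != 0. Proof. exact: e2pi_neq0. Qed.
Let w0 : w != 0. Proof. exact: e2pi_neq0. Qed.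
Let q0 : q != 0. Proof. exact: expf_neq0. Qed.
Let q1 : nm q < 1. Proof. exact: nm_sqr_lt1. Qed.

Let pE : p = u ^+ 4.
Proof. by rewrite /p /u -e2pi_nat; congr e2pi; rewrite -mulr_natl; field. Qed.

Let xE : x = w ^+ 2.
Proof. by rewrite /x /w -e2pi_nat; congr e2pi; rewrite -mulr_natl; field. Qed.

Let qE : e2pi (2 * tau / 2) = q.
Proof. by rewrite /q /p -e2pi_nat; congr e2pi; rewrite -mulr_natl; field. Qed.

Let qE1 : e2pi tau = q.
Proof. by rewrite -qE; congr e2pi; field. Qed.

Let q2 : nm (e2pi (2 * tau / 2)) < 1.
Proof. by rewrite qE. Qed.

Lemma eta_quot : (dedekind_eta (2 * tau) / dedekind_eta tau) ^+ 3 = u * (phi2 p / phi1 p) ^+ 3.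
Proof.
rewrite !etaE.
have -> : e2pi (2 * tau) = q ^+ 2 by rewrite -qE1 -e2pi_nat; congr e2pi; rewrite mulr2n; ring.
rewrite qE1 -/q -/(phi2 p) -/(phi1 p).
have -> : e2pi (2 * tau / 24) = e2pi (tau / 24) ^+ 2.
  by rewrite -e2pi_nat; congr e2pi; rewrite -mulr_natl; field.
have -> : u = e2pi (tau / 24) ^+ 3.
  by rewrite -e2pi_nat; congr e2pi; rewrite -mulr_natl; field.
have := e2pi_neq0 (tau / 24); have := phi1_neq0 p1.
by move: (e2pi _) (phi1 _) (phi2 _) => a b c b0 a0; field; rewrite a0 b0.
Qed.

Let shift (v : C) : e2pi (v + 1 / 2) = - e2pi v.
Proof. by rewrite e2piD e2pi_half mulrN1. Qed.

Lemma theta00E : theta 0 0 tau z = thetaT p x.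
Proof.
rewrite thetaE // (_ : _ + _ / 2 = 0) ?e2pi0 ?mul1r; last by field.
by congr (thetaT _ (e2pi _)); field.
Qed.

Lemma theta01E : theta 0 1 tau z = thetaT p (- x).
Proof.
rewrite thetaE // (_ : 0%:R ^+ 2 * _ / 8 + _ = 0) ?e2pi0 ?mul1r; last by field.
by rewrite -shift; congr (thetaT _ (e2pi _)); field.
Qed.

Lemma theta00_doubleE v : theta 0 0 (2 * tau) v = thetaT q (e2pi v).
Proof.
rewrite thetaE // qE (_ : 0%:R ^+ 2 * _ / 8 + _ = 0) ?e2pi0 ?mul1r; last by field.
by congr (thetaT _ (e2pi _)); field.
Qed.

Lemma theta01_doubleE v : theta 0 1 (2 * tau) v = thetaT q (- e2pi v).
Proof.
rewrite thetaE // qE (_ : 0%:R ^+ 2 * _ / 8 + _ = 0) ?e2pi0 ?mul1r; last by field.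
by rewrite -shift; congr (thetaT _ (e2pi _)); field.
Qed.

Lemma theta10_doubleE v :
  theta 1 0 (2 * tau) v = u ^+ 2 * e2pi (v / 2) * thetaT q (e2pi v * q).
Proof.
have e1 : e2pi (1%:R ^+ 2 * (2 * tau) / 8 + 1%:R * (v + 0%:R / 2) / 2) = u ^+ 2 * e2pi (v / 2).
  by rewrite /u -e2pi_nat -e2piD; congr e2pi; rewrite -mulr_natl; field.
have e2 : e2pi (v + 0%:R / 2 + 1%:R * (2 * tau) / 2) = e2pi v * q.
  by rewrite -qE1 -e2piD; congr e2pi; field.
by rewrite (thetaE _ _ _ q2) qE e1 e2.
Qed.

Lemma theta11_doubleE v :
  theta 1 1 (2 * tau) v = 'i%C * (u ^+ 2 * e2pi (v / 2)) * thetaT q (- (e2pi v * q)).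
Proof.
have e1 : e2pi (1%:R ^+ 2 * (2 * tau) / 8 + 1%:R * (v + 1%:R / 2) / 2) = 'i%C * (u ^+ 2 * e2pi (v / 2)).
  rewrite -e2pi_quarter /u -e2pi_nat -!e2piD; congr e2pi.
  by rewrite -[tau / 8 *+ 2]mulr_natl; field.
have e2 : e2pi (v + 1%:R / 2 + 1%:R * (2 * tau) / 2) = - (e2pi v * q).
  by rewrite -qE1 -e2piD -shift; congr e2pi; field.
by rewrite (thetaE _ _ _ q2) qE e1 e2.
Qed.

Let e2pi_up : e2pi (z + tau / 2) = x * p. Proof. exact: e2piD. Qed.
Let e2pi_um : e2pi (z - tau / 2) = x / p. Proof. by rewrite e2piD e2piN. Qed.

Let e2pi_hp : e2pi ((z + tau / 2) / 2) = w * u ^+ 2.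
Proof. by rewrite -e2pi_nat -e2piD; congr e2pi; rewrite -mulr_natl; field. Qed.

Let e2pi_hm : e2pi ((z - tau / 2) / 2) = w / u ^+ 2.
Proof. by rewrite -e2pi_nat -e2piN -e2piD; congr e2pi; rewrite -mulr_natl; field. Qed.

(** The prefactor is the contribution of the vacuum, of energy -1/4 - c/24 = -1/8 and charge -1/2.
    It is the same for both sectors, since degrees are counted from the vacuum. *)
Definition char_value (o super : bool) : C :=
  e2pi (- (tau / 8)) * e2pi (- (z / 2)) * sector_value o p x ((-1) ^+ super).

Let t11 : theta 1 1 (2 * tau) (2 * z) = 'i%C * (u ^+ 2 * x) * thetaT q (- (x ^+ 2 * q)).
Proof.
rewrite theta11_doubleE (_ : 2 * z / 2 = z); last by field.
by rewrite (_ : e2pi (2 * z) = x ^+ 2) // -e2pi_nat; congr e2pi; rewrite mulr2n; ring.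
Qed.

Let valE (o super : bool) : char_value o super = u^-1 * w^-1 *
  (if o then x^-1 * (phi2 p / phi1 p ^+ 2 * (thetaT q ((-1) ^+ super * x / p) ^+ 2 / thetaT q (- (x ^+ 2 * q))))
   else phi2 p / phi1 p ^+ 2 * (thetaT q ((-1) ^+ super * x * p) ^+ 2 / thetaT q (- (x ^+ 2 * q)))).
Proof.
have o2 : (-1 : C) ^+ 2 = 1 by rewrite sqrrN expr1n.
have s2 : ((-1 : C) ^+ super) ^+ 2 = 1 by rewrite -exprM mulnC exprM o2 expr1n.
rewrite /char_value !e2piN -/u -/w /sector_value; congr (_ * _).
case: o; first by rewrite expr1 mulN1r; exact: (fock_quot_odd p0 p1 x1 xp1 s2).
by rewrite expr0 mul1r; exact: (fock_quot_even p0 p1 x1 xp1 s2).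
Qed.

Lemma character_even : char_value false false =
  'i%C * (dedekind_eta (2 * tau) / dedekind_eta tau) ^+ 3 *
   ((theta 0 0 (2 * tau) (z + tau / 2) * theta 0 0 tau z) /
    (theta 1 0 (2 * tau) (z + tau / 2) * theta 1 1 (2 * tau) (2 * z))).
Proof.
have o2 : (-1 : C) ^+ 2 = 1 by rewrite sqrrN expr1n.
rewrite valE eta_quot theta00_doubleE theta00E theta10_doubleE t11 e2pi_up e2pi_hp expr0 mul1r.
have := @character_algebra_even _ _ _ _ _ _ p0 p1 x1 xp1 (erefl _) u0 w0 pE xE 'i%C 1 (x * p) 1 (expr1n _ 2); rewrite !mul1r mulr1 => -> //.
Qed.

Lemma character_odd : char_value true false =
  'i%C * (dedekind_eta (2 * tau) / dedekind_eta tau) ^+ 3 *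
   ((theta 0 0 (2 * tau) (z - tau / 2) * theta 0 0 tau z) /
    (theta 1 0 (2 * tau) (z - tau / 2) * theta 1 1 (2 * tau) (2 * z))).
Proof.
have o2 : (-1 : C) ^+ 2 = 1 by rewrite sqrrN expr1n.
rewrite valE eta_quot theta00_doubleE theta00E theta10_doubleE t11 e2pi_um e2pi_hm expr0 mul1r.
have := @character_algebra_odd _ _ _ _ _ _ p0 p1 x1 xp1 (erefl _) u0 w0 xE 'i%C 1 (x / p) 1 (expr1n _ 2); rewrite !mul1r => -> //.
Qed.

Lemma supercharacter_even : char_value false true =
  (dedekind_eta (2 * tau) / dedekind_eta tau) ^+ 3 *
   ((theta 0 1 (2 * tau) (z + tau / 2) * theta 0 1 tau z) /
    (theta 1 1 (2 * tau) (z + tau / 2) * theta 1 1 (2 * tau) (2 * z))).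
Proof.
have o2 : (-1 : C) ^+ 2 = 1 by rewrite sqrrN expr1n.
rewrite valE eta_quot theta01_doubleE theta01E [theta 1 1 _ (z + _)]theta11_doubleE t11 e2pi_up e2pi_hp expr1.
have := @character_algebra_even _ _ _ _ _ _ p0 p1 x1 xp1 (erefl _) u0 w0 pE xE 1 (-1) (- (x * p)) 'i%C o2; rewrite !mulN1r !mul1r !mulNr => -> //.
  by rewrite -expr2 sqr_i.
exact: imag_neq0.
Qed.

Lemma supercharacter_odd : char_value true true =
  - (dedekind_eta (2 * tau) / dedekind_eta tau) ^+ 3 *
   ((theta 0 1 (2 * tau) (z - tau / 2) * theta 0 1 tau z) /
    (theta 1 1 (2 * tau) (z - tau / 2) * theta 1 1 (2 * tau) (2 * z))).
Proof.
have o2 : (-1 : C) ^+ 2 = 1 by rewrite sqrrN expr1n.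
rewrite valE eta_quot theta01_doubleE theta01E [theta 1 1 _ (z - _)]theta11_doubleE t11 e2pi_um e2pi_hm expr1.
have := @character_algebra_odd _ _ _ _ _ _ p0 p1 x1 xp1 (erefl _) u0 w0 xE (-1) (-1) (- (x / p)) 'i%C o2; rewrite !mulN1r !mulNr => -> //.
  by rewrite -expr2 sqr_i.
exact: imag_neq0.
Qed.

End CharacterFormulas.

(** * Traces over weight spaces and their lowest terms *)

Section Traces.
Variable R : realType.
Notation C := R[i].
Variable o : bool.
Variable B : bool -> C * C -> seq occ.
Hypothesis uB : forall p w, uniq (B p w).
Hypothesis memB : forall p w b, (b \in B p w) = [&& bodd b == o, fpodd b == p & fw R b == w].

Definition mult (super : bool) (w : C * C) : int :=
  (size (B false w))%:Z + (-1) ^+ super * (size (B true w))%:Z.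

Lemma mult_neq0 super w : mult super w <> 0 -> exists2 b, bodd b = o & fw R b = w.
Proof.
have h p b : b \in B p w -> exists2 b, bodd b = o & fw R b = w.
  by rewrite memB => /and3P[/eqP h1 _ /eqP h2]; exists b.
rewrite /mult; case E0 : (B false w) => [|b s]; last by move=> _; apply: (h false b); rewrite E0 mem_head.
case E1 : (B true w) => [|b s]; last by move=> _; apply: (h true b); rewrite E1 mem_head.
by rewrite /= mulr0 addr0.
Qed.

Lemma sum_bool_count (r : seq occ) (P : pred occ) : \sum_(b <- r) (P b)%:R = (count P r)%:R :> C.
Proof. by elim: r => [|b r IH]; rewrite ?big_nil // big_cons IH /= natrD. Qed.

Lemma e2pi_state tau z b :
  e2pi (- (tau / 8)) * e2pi (- (z / 2)) * (e2pi (tau / 2) ^ (deg b).1.1 * e2pi z ^ (deg b).1.2) =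
  e2pi (tau * ((fw R b).1 - cM R 2 / 24)) * e2pi (z * (fw R b).2).
Proof.
rewrite -!e2pi_int mulrACA -!e2piD cM2 /fw /energy /jcharge /=.
rewrite -[(tau / 2) *~ _]mulrzl -[z *~ _]mulrzl.
have -> : - (tau / 8) + (deg b).1.1%:~R * (tau / 2) =
   tau * ((deg b).1.1%:~R / 2 - 1 / 4 - - 3 / 24) :> C by move: (_%:~R) => *; field.
have -> : - (z / 2) + (deg b).1.2%:~R * z = z * ((deg b).1.2%:~R - 1 / 2) :> C.
  by move: (_%:~R) => *; field.
by [].
Qed.

(** The absolutely convergent sum over the states of the sector is regrouped by weights; the signed
    number of states in each fibre is the multiplicity. *)
Lemma trace_sum super tau z : ch_domain tau z ->
  has_sum (trace_term (cM R 2) (mult super) tau z) (char_value tau z o super).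
Proof.
move=> dom; have [p0 p1 x1 xp1] := ch_domainP dom.
pose s : C := (-1) ^+ super.
have s2 : s ^+ 2 = 1 by rewrite /s -exprM mulnC exprM sqrrN !expr1n.
have [bf hf] := sector_sum o p0 p1 x1 xp1 s2.
pose pr : C := e2pi (- (tau / 8)) * e2pi (- (z / 2)).
have [fib hfib] : {fib : C * C -> {fset occ} & forall w, forall b, (b \in fib w) = (fw R b == w)}.
  apply: (@boolp.choice _ _ (fun w A => forall b, (b \in A) = (fw R b == w))) => w.
  have [B0 [_ h0]] := fw_fiber true false w; have [B1 [_ h1]] := fw_fiber true true w.
  have [B2 [_ h2]] := fw_fiber false false w; have [B3 [_ h3]] := fw_fiber false true w.
  exists [fset b in B0 ++ B1 ++ B2 ++ B3]%fset => b; rewrite in_fset !mem_cat h0 h1 h2 h3.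
  by case: (bodd b); case: (fpodd b) => /=; rewrite ?orbF.
have hfib' b w : (b \in fib w) = (fw R b == w) by apply: hfib.
have [_ h] := has_sumR_fiber hfib' (bddZ pr bf) (has_sumRZ pr hf).
apply: has_sumRP; move: h; rewrite -/pr; set F := (fun j : C * C => _).
suff -> : F = trace_term (cM R 2) (mult super) tau z by [].
apply/funext => w; rewrite /F /trace_term.
have cnt p : count (fun b => (bodd b == o) && (fpodd b == p)) (fib w) = size (B p w).
  rewrite -size_filter; apply/perm_size/uniq_perm; rewrite ?filter_uniq ?fset_uniq ?uB // => b.
  by rewrite mem_filter memB -andbA; congr (_ && (_ && _)); exact: hfib'.
pose T := e2pi (tau * (w.1 - cM R 2 / 24)) * e2pi (z * w.2).
transitivity (\sum_(b <- fib w) (((bodd b == o) && (fpodd b == false))%:R + s * ((bodd b == o) && (fpodd b == true))%:R) * T).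
  rewrite big_seq [RHS]big_seq; apply: eq_bigr => b; rewrite hfib' => /eqP hw.
  rewrite /T -hw -e2pi_state -/pr /s; move: (e2pi _ ^ _ * e2pi _ ^ _) => X.
  case: (bodd b == o) => /=; last by rewrite !mul0r !mulr0 addr0 mul0r.
  by case: (fpodd b) => /=; rewrite ?mulr0 ?mulr1 ?addr0 ?add0r ?mul1r ?expr0 ?expr1 // mulrCA.
rewrite -mulr_suml big_split -mulr_sumr !sum_bool_count !cnt /T mulrA; congr (_ * _ * _).
by rewrite /mult rmorphD rmorphM rmorphXn rmorphN1.
Qed.

(** The state given by the power [k] of [b^-_0] on the vacuum. These are all the states of least
    energy, since every other creation mode costs energy. *)
Definition ground (k : nat) : occ := (iter k (madd (false, 0%N)) mset0, fset0).

Lemma deg_ground k : deg (ground k) = (0, - k%:Z, 0).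
Proof.
elim: k => [|k IH]; first by rewrite -[ground 0]/occ0 deg0.
rewrite /ground /= deg_madd -/(ground k) IH; apply: gradeP => //=.
by rewrite /=; lia.
Qed.

Lemma ground_exhaust b : (deg b).1.1 = 0 -> exists k, b = ground k.
Proof.
elim/occ_ind: b => [_|i M A IH h|i M A iA IH h]; first by exists 0%N.
  have {}h : (bdeg i).1.1 + (deg (M, A)).1.1 = 0 by rewrite -h deg_madd.
  have := deg_ge0 (M, A); move: h IH; move: ((deg (M, A)).1.1) => d h IH h2.
  have hi : i = (false, 0%N).
    by case: i h => [[] n] /= h; [lia | congr (_, _); lia].
  have d0 : d = 0 by move: h; rewrite hi /= add0r.
  by have [k [-> ->]] := IH d0; exists k.+1; rewrite hi.
have {}h : (deg (M, A)).1.1 + (fdeg i).1.1 = 0 by rewrite -h deg_flip (negPf iA).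
by have := deg_ge0 (M, A); move: h; move: ((deg (M, A)).1.1) => d /= h h2; lia.
Qed.

Lemma ground_weight b : (fw R b).1 = - (1 / 4) -> exists k, b = ground k.
Proof.
rewrite /fw /energy /= => h; apply: ground_exhaust; apply/eqP.
have : (deg b).1.1%:~R = 0 :> C.
  have : (deg b).1.1%:~R / 2 = 0 :> C by move: h; move: (_%:~R / 2) => X h; rewrite -[X](subrK (1 / 4)) h; ring.
  by move/eqP; rewrite mulf_eq0 invr_eq0 pnatr_eq0 orbF => /eqP.
by move/eqP; rewrite intr_eq0.
Qed.

Lemma fw_ground k : fw R (ground k) = (- (1 / 4), - (1 / 2) - k%:R).
Proof.
rewrite /fw /energy /jcharge deg_ground /=; congr (_, _); first by rewrite mul0r sub0r.
by rewrite rmorphN /= addrC.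
Qed.

Lemma bodd_ground k : bodd (ground k) = odd k.
Proof. by rewrite /bodd deg_ground /= addr0 abszN. Qed.

Lemma fpodd_ground k : fpodd (ground k) = false.
Proof. by rewrite /fpodd deg_ground. Qed.

(** The state is the only one of its weight and contains no fermion; hence the lowest terms of the
    character and of the super-character coincide. *)
Lemma mult_ground super k : odd k = o -> mult super (- (1 / 4), - (1 / 2) - k%:R) = 1.
Proof.
move=> ok; set w := (_, _).
have e p b : b \in B p w -> b = ground k.
  rewrite memB => /and3P[_ _ /eqP hb]; have [j bj] := @ground_weight b (congr1 fst hb).
  move: hb; rewrite bj fw_ground => -[/addrI/oppr_inj/eqP].
  by rewrite eqr_nat => /eqP ->.
have h1 : B true w = [::].
  case E : (B true w) => [//|b r]; have hb : b \in B true w by rewrite E mem_head.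
  by have := hb; rewrite memB (e _ _ hb) fpodd_ground andbF.
have h0 : perm_eq (B false w) [:: ground k].
  apply: uniq_perm => // b; rewrite inE; apply/idP/eqP => [/e //|->].
  by rewrite memB bodd_ground ok fpodd_ground fw_ground !eqxx.
by rewrite /mult h1 (perm_size h0) mulr0 addr0.
Qed.

Lemma mult_lowest super mu : mult super (- (1 / 4), mu) <> 0 ->
  exists j : nat, mu = - (1 / 2) - (o + j.*2)%:R.
Proof.
move=> /mult_neq0[b ob hb]; have [k bk] := @ground_weight b (congr1 fst hb).
exists k./2; move: ob hb; rewrite bk bodd_ground fw_ground => <- [<-].
by rewrite odd_double_half.
Qed.

Lemma energy_ge super (Delta mu : C) : mult super (Delta, mu) <> 0 -> - (1 / 4) <= Delta.
Proof.
move=> /mult_neq0[b _ [<- _]]; rewrite /energy -[leLHS]add0r lerD2r.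
by rewrite divr_ge0 // ler0z deg_ge0.
Qed.

Lemma geo_has_sumR (a y : C) : nm y < 1 ->
  let f (j : nat) := a * y ^+ j in bdd f /\ has_sumR f (a / (1 - y)).
Proof.
move=> y1 f; have hy := nm_ge0 y; have y1' : y != 1 by apply/eqP => e; move: y1; rewrite e nm1 ltxx.
pose J N : {fset nat} := [fset j in iota 0 N]%fset.
have exJ j : exists N0, forall N, (N0 <= N)%N -> j \in J N.
  by exists j.+1 => N hN; rewrite in_fset mem_iota.
have sJ (V : nmodType) (F : nat -> V) N : \sum_(j <- J N) F j = \sum_(j < N) F j.
  by rewrite big_fset_seq ?iota_uniq // -(big_mkord predT F) /index_iota subn0.
have bf : bdd f.
  apply: (@bdd_exhaust R nat f J (nm a * (1 - nm y)^-1) exJ) => N; rewrite sJ.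
  under eq_bigr do rewrite nmM nmX.
  by rewrite -mulr_sumr; apply: ler_wpM2l; [exact: nm_ge0 | apply: sum_geo; rewrite hy].
split=> //; apply: (has_sumR_exhaust bf exJ) => e e0.
have K0 := nm_ge0 (a / (1 - y)); set K := nm _ in K0.
have hy' : 0 <= nm y < 1 by rewrite hy.
have eK : 0 < e / (K + 1) by rewrite divr_gt0 //; lra.
have [k hk] := small_power hy' eK; exists k => N hN.
rewrite sJ /f -mulr_sumr geo_sum //.
rewrite (_ : _ - _ = - (a / (1 - y) * y ^+ N)); last first.
  by move: (y ^+ N) => Y; ring.
rewrite nmN nmM nmX -/K; apply: (@le_trans _ _ (K * (e / (K + 1)))).
  by apply: ler_wpM2l => //; apply: le_trans hk; apply: ler_wiXn2l => //; exact: ltW.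
by rewrite mulrA ler_pdivrMr; [rewrite mulrC; apply: ler_wpM2l; lra | lra].
Qed.

(** The sector admits the powers [o + 2 j] of [b^-_0], so that the lowest terms form a geometric
    series in the inverse square of [e2pi z], which converges because the norm of [e2pi z] exceeds
    1. *)
Lemma lowest_sum super tau z : ch_domain tau z ->
  has_sum (fun mu => trace_term (cM R 2) (mult super) tau z (- (1 / 4), mu))
    (e2pi (- (tau / 8)) * (e2pi (- (z / 2)) * e2pi (- z) ^+ o / (1 - e2pi (- z) ^+ 2))).
Proof.
move=> dom; have [_ _ x1 _] := ch_domainP dom.
have y1 : nm (e2pi (- z) ^+ 2) < 1.
  by rewrite e2piN nmX nmV exprVn invf_lt1 ?exprn_gt0 ?exprn_egt1 //; apply: lt_trans x1.
have [b h] := geo_has_sumR (e2pi (- (tau / 8)) * (e2pi (- (z / 2)) * e2pi (- z) ^+ o)) y1.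
pose io (j : nat) : C := - (1 / 2) - (o + j.*2)%:R.
have oj (j : nat) : odd (o + j.*2) = o by rewrite oddD odd_double addbF oddb.
have e j : trace_term (cM R 2) (mult super) tau z (- (1 / 4), io j) =
    e2pi (- (tau / 8)) * (e2pi (- (z / 2)) * e2pi (- z) ^+ o) * (e2pi (- z) ^+ 2) ^+ j.
  have ex : e2pi (z * io j) = e2pi (- (z / 2)) * e2pi (- z) ^+ o * (e2pi (- z) ^+ 2) ^+ j.
    rewrite -exprM -mulrA -exprD mul2n -e2pi_nat -e2piD /io; congr e2pi.
    by rewrite -[(- z) *+ _]mulr_natl; move: ((_ + _)%:R) => X; field.
  have et : e2pi (tau * (- (1 / 4) - cM R 2 / 24)) = e2pi (- (tau / 8)).
    by rewrite cM2; congr e2pi; field.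
  transitivity (1%:~R * e2pi (tau * (- (1 / 4) - cM R 2 / 24)) * e2pi (z * io j)).
    by rewrite /trace_term mult_ground ?oj.
  by rewrite et ex mul1r !mulrA.
apply: has_sumRP; rewrite mulrA; apply: (has_sumR_inj (io := io)) => [i j|mu hmu||].
- by move=> /addrI/oppr_inj/eqP; rewrite eqr_nat eqn_add2l => /eqP/double_inj.
- rewrite /trace_term; have [->|/eqP m0] := eqVneq (mult super (- (1 / 4), mu)) 0; first by rewrite !mul0r.
  by have [j /esym/hmu] := mult_lowest m0.
- by rewrite (funext e).
- by rewrite (funext e).
Qed.

Variable V : n4_module (cM R 2).
Hypothesis irrV : irreducible_highest_weight V (- (1 / 4)) (if o then - (3 / 2) else - (1 / 2)).

Lemma trace_coefs_mult super : trace_coefs V super (mult super).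
Proof.
have [wd hd] := irreducible_weights irrV; split=> //.
by exists (fun p w => size (B p w)); split=> // p w; apply: hd.
Qed.

Lemma leading_term super tau z : ch_domain tau z ->
  has_leading_term V super tau z
    (e2pi (- (tau / 8)) * (e2pi (- (z / 2)) * e2pi (- z) ^+ o / (1 - e2pi (- z) ^+ 2))).
Proof.
move=> dom; exists (mult super), (- (1 / 4)); split.
- exact: trace_coefs_mult.
- exists (- (1 / 2) - o%:R); rewrite mult_ground; first exact/eqP/oner_neq0.
  exact: oddb.
- exact: energy_ge.
exact: lowest_sum.
Qed.

End Traces.

Section Modules.
Variable R : realType.
Notation C := R[i].
Variables (o : bool) (V : n4_module (cM R 2)).
Hypothesis irrV : irreducible_highest_weight V (- (1 / 4)) (if o then - (3 / 2) else - (1 / 2)).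

Lemma sector_states : exists B : bool -> C * C -> seq occ,
  (forall p w, uniq (B p w)) /\
  forall p w b, (b \in B p w) = [&& bodd b == o, fpodd b == p & fw R b == w].
Proof.
have [B hB] : {B : bool * (C * C) -> seq occ & forall k, uniq (B k) /\
    forall b, (b \in B k) = [&& bodd b == o, fpodd b == k.1 & fw R b == k.2]}.
  apply: (@boolp.choice _ _ (fun (k : bool * (C * C)) A => uniq A /\
    forall b, (b \in A) = [&& bodd b == o, fpodd b == k.1 & fw R b == k.2])) => k.
  exact: fw_fiber.
by exists (fun p w => B (p, w)); split=> p w; have [] := hB (p, w).
Qed.

Lemma has_character_value super tau z : ch_domain tau z ->
  has_character V super tau z (char_value tau z o super).
Proof.
have [B [uB memB]] := sector_states => dom; exists (mult B super).
by split; [exact: (trace_coefs_mult (o := o)) | exact: trace_sum].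
Qed.

Lemma has_leading_value super tau z : ch_domain tau z ->
  has_leading_term V super tau z
    (e2pi (- (tau / 8)) * (e2pi (- (z / 2)) * e2pi (- z) ^+ o / (1 - e2pi (- z) ^+ 2))).
Proof. by have [B [uB memB]] := sector_states; exact: (leading_term uB memB). Qed.

End Modules.

Section LowestTerms.
Variable R : realType.
Notation C := R[i].

Lemma cM2_hM : hM 2 (1 / 2 : C) = - (1 / 4).
Proof. by rewrite /hM; field. Qed.

Lemma cM2_hMN : hM 2 (- (1 / 2) : C) = - (1 / 4).
Proof. by rewrite /hM; field. Qed.

Lemma cM2_sM : sM 2 (1 / 2 : C) = - (1 / 2).
Proof. by rewrite /sM; field. Qed.

Lemma cM2_sMN : sM 2 (- (1 / 2) : C) = - (3 / 2).
Proof. by rewrite /sM; field. Qed.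

Lemma lead_even (z : C) :
  e2pi (- (z / 2)) * e2pi (- z) ^+ false / (1 - e2pi (- z) ^+ 2) =
  cexp (- (piC R * 'i%C * z)) / (1 - cexp (- (4 * piC R * 'i%C * z))).
Proof.
rewrite mulr1 -e2pi_nat /e2pi; congr (cexp _ / (1 - cexp _)); first by field.
by rewrite mulr2n; ring.
Qed.

Lemma lead_odd (z : C) :
  e2pi (- (z / 2)) * e2pi (- z) ^+ true / (1 - e2pi (- z) ^+ 2) =
  cexp (- (3 * piC R * 'i%C * z)) / (1 - cexp (- (4 * piC R * 'i%C * z))).
Proof.
rewrite expr1 -e2pi_nat -e2piD /e2pi; congr (cexp _ / (1 - cexp _)); first by field.
by rewrite mulr2n; ring.
Qed.

End LowestTerms.

Local Open Scope complex_scope.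

Theorem proposition10p1 (R : realType)
    (Vp Vm : n4_module (cM R 2))
    (hVp : irreducible_highest_weight Vp (hM 2 (1 / 2)) (sM 2 (1 / 2)))
    (hVm : irreducible_highest_weight Vm (hM 2 (- (1 / 2))) (sM 2 (- (1 / 2)))) :
  (* part 1 *)
  [/\ cM R 2 = -3,
      hM 2 (1 / 2 : R[i]) = - (1 / 4) /\ sM 2 (1 / 2 : R[i]) = - (1 / 2)
    & hM 2 (- (1 / 2) : R[i]) = - (1 / 4) /\ sM 2 (- (1 / 2) : R[i]) = - (3 / 2)]
  (* part 2 *)
  /\ (forall tau z : R[i], ch_domain tau z ->
      [/\ has_character Vp false tau z
            ('i%C * (dedekind_eta (2 * tau) / dedekind_eta tau) ^+ 3 *
             ((theta 0 0 (2 * tau) (z + tau / 2) * theta 0 0 tau z) /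
              (theta 1 0 (2 * tau) (z + tau / 2) * theta 1 1 (2 * tau) (2 * z)))),
          has_character Vm false tau z
            ('i%C * (dedekind_eta (2 * tau) / dedekind_eta tau) ^+ 3 *
             ((theta 0 0 (2 * tau) (z - tau / 2) * theta 0 0 tau z) /
              (theta 1 0 (2 * tau) (z - tau / 2) * theta 1 1 (2 * tau) (2 * z)))),
          has_character Vp true tau z
            ((dedekind_eta (2 * tau) / dedekind_eta tau) ^+ 3 *
             ((theta 0 1 (2 * tau) (z + tau / 2) * theta 0 1 tau z) /
              (theta 1 1 (2 * tau) (z + tau / 2) * theta 1 1 (2 * tau) (2 * z))))
        & has_character Vm true tau z
            (- (dedekind_eta (2 * tau) / dedekind_eta tau) ^+ 3 *
             ((theta 0 1 (2 * tau) (z - tau / 2) * theta 0 1 tau z) /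
              (theta 1 1 (2 * tau) (z - tau / 2) * theta 1 1 (2 * tau) (2 * z))))])
  (* part 3 *)
  /\ (forall tau z : R[i], ch_domain tau z ->
      let leadp := e2pi (tau * (1 / 8 - 1 / 4)) *
        (cexp (- (piC R * 'i%C * z)) / (1 - cexp (- (4 * piC R * 'i%C * z)))) in
      let leadm := e2pi (tau * (1 / 8 - 1 / 4)) *
        (cexp (- (3 * piC R * 'i%C * z)) / (1 - cexp (- (4 * piC R * 'i%C * z)))) in
      [/\ (forall super, has_leading_term Vp super tau z leadp),
          leadp = e2pi (tau * (- (1 / 24) * cM R 2 + hM 2 (1 / 2))) *
            (cexp (2 * piC R * 'i%C * sM 2 (1 / 2) * z) /
             (1 - cexp (- (4 * piC R * 'i%C * z)))),
          (forall super, has_leading_term Vm super tau z leadm)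
        & leadm = e2pi (tau * (- (1 / 24) * cM R 2 + hM 2 (- (1 / 2)))) *
            (cexp (2 * piC R * 'i%C * sM 2 (- (1 / 2)) * z) /
             (1 - cexp (- (4 * piC R * 'i%C * z))))]).
Proof.
have hp : irreducible_highest_weight Vp (- (1 / 4)) (if false then - (3 / 2) else - (1 / 2)).
  by move: hVp; rewrite cM2_hM cM2_sM.
have hm : irreducible_highest_weight Vm (- (1 / 4)) (if true then - (3 / 2) else - (1 / 2)).
  by move: hVm; rewrite cM2_hMN cM2_sMN.
split; first by rewrite cM2 cM2_hM cM2_hMN cM2_sM cM2_sMN.
split=> tau z dom.
  split.
  - by rewrite -(character_even dom); exact: (has_character_value (o := false) hp false dom).
  - by rewrite -(character_odd dom); exact: (has_character_value (o := true) hm false dom).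
  - by rewrite -(supercharacter_even dom); exact: (has_character_value (o := false) hp true dom).
  - by rewrite -(supercharacter_odd dom); exact: (has_character_value (o := true) hm true dom).
have e1 : tau * (1 / 8 - 1 / 4) = - (tau / 8) by field.
move=> leadp leadm; rewrite cM2_hM cM2_hMN cM2_sM cM2_sMN /leadp /leadm.
have e2 (c : R[i]) : c = - (1 / 2) -> 2 * piC R * 'i%C * c * z = - (piC R * 'i%C * z).
  by move=> ->; field.
have e3 (c : R[i]) : c = - (3 / 2) -> 2 * piC R * 'i%C * c * z = - (3 * piC R * 'i%C * z).
  by move=> ->; field.
have e4 : tau * (- (1 / 24) * cM R 2 + - (1 / 4)) = - (tau / 8) by rewrite cM2; field.
rewrite e1 e4 (e2 _ erefl) (e3 _ erefl) -lead_even -lead_odd; split=> // super.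
- exact: (has_leading_value (o := false) hp super dom).
- exact: (has_leading_value (o := true) hm super dom).
Qed.
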